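(* Let $\Omega\subset\mathbb R^3$ be a bounded domain, let $N\ge 3$ be an integer and let $f\in H^1(\Omega,S^2)$. With $\mathcal H$, $F_\lambda$, $E_\lambda(f)$, $\mathcal H_f$, $F_\infty$, $E_\infty(f)$, $W_f$ and $E_{\lambda,\mathrm{reg}}(f)$ as defined in the context, the following hold. 1. The class $\mathcal H_f$ is nonempty. 2. The family $(F_\lambda)_{\lambda>0}$ $\Gamma$-converges, as $\lambda\to+\infty$, with respect to the weak topology of $\mathcal H$, to the functional $F_\infty$ (extended by $+\infty$ on $\mathcal H\setminus\mathcal H_f$). Consequently $\displaystyle\lim_{\lambda\to+\infty}E_\lambda(f)=E_\infty(f)$. 3. Furthermore, $$E_\infty(f)=\frac1{2N}\int_\Omega|\nabla f|^2\,dx+\min_{(w_1,\dots,w_N)\in W_f}\frac12\sum_{i=1}^N\int_\Omega|\nabla w_i|^2\,dx$$ (in particular the minimum over $W_f$ is attained). 4. Assume that $f$ cannot be decomposed as $f=\sum_{i=1}^N u_i$ where each map $u_i\in H^1(\Omega,S^2)$ is a strong limit in $H^1$ of smooth maps in $H^1(\Omega,S^2)$. Then there exists $\lambda_0>0$, depending on $f$ and $N$, such that for all $\lambda\ge\lambda_0$, any minimizer $(u_1^\lambda,\dots,u_N^\lambda)$ of $F_\lambda$ over $\mathcal H$ is not regular in $\Omega$; in particular, at least one component $u_i^\lambda$ admits a singularity in $\Omega$. Moreover, for all $\lambda\ge\lambda_0$, $$E_\lambda(f)<E_{\lambda,\mathrm{reg}}(f).$$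
   Context: $S^2$ is the unit sphere of $\mathbb R^3$, $H^1(\Omega,S^2)=\{u\in H^1(\Omega,\mathbb R^3):|u|=1\text{ a.e. in }\Omega\}$, and $\mathcal H:=H^1(\Omega,S^2)^N$, endowed with the weak topology of $H^1(\Omega,\mathbb R^3)^N$. For $\lambda>0$ and $U=(u_1,\dots,u_N)\in\mathcal H$, $$F_\lambda(U)=\int_\Omega\Big(\frac12\sum_{i=1}^N|\nabla u_i|^2+\lambda\Big|\sum_{i=1}^N u_i-f\Big|^2\Big)dx,\qquad E_\lambda(f)=\inf_{U\in\mathcal H}F_\lambda(U);$$ the infimum is attained, and a minimizer of $F_\lambda$ is an element of $\mathcal H$ attaining it. Further, $$\mathcal H_f=\Big\{U\in\mathcal H:\sum_{i=1}^N u_i=f\text{ a.e. in }\Omega\Big\},\qquad F_\infty(U)=\frac12\sum_{i=1}^N\int_\Omega|\nabla u_i|^2dx\ \ (U\in\mathcal H_f),\qquad E_\infty(f)=\inf_{U\in\mathcal H_f}F_\infty(U),$$ $$W_f=\Big\{(w_1,\dots,w_N)\in H^1(\Omega,\mathbb R^3)^N:\sum_{i=1}^N w_i=0,\ \Big|\frac1N f+w_i\Big|=1\text{ a.e. in }\Omega\text{ for every }i\Big\},$$ $$E_{\lambda,\mathrm{reg}}(f)=\inf_{U\in C^1(\overline\Omega,S^2)^N}F_\lambda(U).$$ $\Gamma$-convergence is understood in the sequential sense: $F_\infty$ is extended to $\mathcal H$ by $F_\infty(U)=+\infty$ for $U\notin\mathcal H_f$, and for every sequence $\lambda_n\to+\infty$: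 (i) whenever $U^n\in\mathcal H$ and $U^n\rightharpoonup U$ weakly in $\mathcal H$, $F_\infty(U)\le\liminf_{n}F_{\lambda_n}(U^n)$; (ii) for every $U\in\mathcal H_f$ there is a sequence $U^n\in\mathcal H$ with $U^n\rightharpoonup U$ weakly in $\mathcal H$ and $\limsup_n F_{\lambda_n}(U^n)\le F_\infty(U)$. A smooth map in $H^1(\Omega,S^2)$ means an element of $H^1(\Omega,S^2)$ that is of class $C^1$ in $\Omega$ (has a $C^1$ representative). A configuration is regular in $\Omega$ if each of its components is of class $C^1$ in $\Omega$; a map admits a singularity in $\Omega$ if there is a point of $\Omega$ having no neighbourhood on which the map is of class $C^1$. *)

(* Defs.v *)
From HB Require Import structures.
From mathcomp Require Export all_boot all_order all_algebra.
From mathcomp Require Export all_classical all_reals all_analysis.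

Set Implicit Arguments.
Unset Strict Implicit.
Unset Printing Implicit Defensive.

Import Order.TTheory GRing.Theory Num.Theory.
Import numFieldNormedType.Exports.

Local Open Scope classical_set_scope.
Local Open Scope ring_scope.

Section Euclidean3.
Context {R : realType}.

(* The domain space is the product R * R * R, which carries both the product
   measure and the product topology; the target space is 'rV[R]_3.  The library
   norms on both are sup norms, hence [enorm].  [vol] is Lebesgue measure on the
   (uncompleted) product sigma-algebra: every Lebesgue measurable map agrees
   a.e. with a measurable one in this sense, so the L^2 classes are the usual
   ones. *)
Local Notation leb := (@lebesgue_measure R).

Definition vol : {measure set _ -> \bar R} := (leb \x leb \x leb)%E.

Definition basis3 (j : 'I_3) : R * R * R :=
  ((val j == 0%N)%:R, (val j == 1%N)%:R, (val j == 2%N)%:R).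

Definition enorm (v : 'rV[R]_3) : R := Num.sqrt (\sum_(k < 3) v ord0 k ^+ 2).

End Euclidean3.

Section Smoothness.
Context {R : realType}.

Definition domain (Om : set (R * R * R)) : Prop :=
  [/\ Om !=set0, open Om & connected Om].

(* [u] is of class C^k on the open set [O]; the values of [u] outside [O] are
   irrelevant. *)
Fixpoint Ck (k : nat) (W : normedModType R) (O : set (R * R * R))
    (u : R * R * R -> W) : Prop :=
  (forall x, O x -> {for x, continuous u}) /\
  match k with
  | 0%N => True
  | k'.+1 => forall j : 'I_3,
      (forall x, O x -> derivable u x (basis3 j)) /\
      Ck k' O (fun x => 'D_(basis3 j) u x)
  end.

Definition test_function (Om : set (R * R * R)) (phi : R * R * R -> R) : Prop :=
  [/\ forall k, Ck k setT phi,
      compact (closure [set x | phi x != 0]) &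
      closure [set x | phi x != 0] `<=` Om].

End Smoothness.

Section Sobolev.
Context {R : realType}.
Implicit Types (Om : set (R * R * R)) (u g : R * R * R -> 'rV[R]_3).

(* Maps in L^2 and H^1 are represented by functions on the whole space that are
   only looked at on [Om], up to a.e. equality. *)
Definition L2 Om u : Prop :=
  forall k : 'I_3, ((fun x => u x ord0 k) \_ Om) \in Lfun (@vol R) 2%:E.

Definition is_weak_partial Om (j : 'I_3) u g : Prop :=
  L2 Om g /\
  forall (k : 'I_3) (phi : R * R * R -> R), test_function Om phi ->
    \int[vol]_(x in Om) (u x ord0 k * 'D_(basis3 j) phi x) =
    - \int[vol]_(x in Om) (g x ord0 k * phi x).

Definition H1 Om u : Prop :=
  L2 Om u /\ forall j : 'I_3, exists g, is_weak_partial Om j u g.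

(* A choice of the weak partial derivative, unique up to a null set. *)
Definition weak_partial Om (j : 'I_3) u : R * R * R -> 'rV[R]_3 :=
  xget (cst 0) [set g | is_weak_partial Om j u g].

Definition grad_sqr Om u (x : R * R * R) : R :=
  \sum_(j < 3) enorm (weak_partial Om j u x) ^+ 2.

Definition dirichlet Om u : \bar R :=
  (\int[vol]_(x in Om) (grad_sqr Om u x)%:E)%E.

Definition H1norm Om u : R :=
  Num.sqrt (\int[vol]_(x in Om) (enorm (u x) ^+ 2 + grad_sqr Om u x)).

Definition H1S2 Om u : Prop :=
  H1 Om u /\ {ae vol, forall x, Om x -> enorm (u x) = 1}.

Definition has_C1_repr Om u : Prop :=
  exists2 v, Ck 1 Om v & u = v %[ae vol in Om].

Definition smooth_H1S2 Om u : Prop := H1S2 Om u /\ has_C1_repr Om u.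

Definition strong_limit_of_smooth Om u : Prop :=
  exists v : nat -> R * R * R -> 'rV[R]_3,
    (forall n, smooth_H1S2 Om (v n)) /\
    H1norm Om (fun x => v n x - u x) @[n --> \oo] --> (0 : R).

(* C^1 up to the boundary, with values in S^2: the map and its first partial
   derivatives extend continuously from [Om] to its closure. *)
Definition C1bar_S2 Om u : Prop :=
  [/\ Ck 1 Om u, {within closure Om, continuous u},
      forall j : 'I_3, exists2 g : R * R * R -> 'rV[R]_3,
        {within closure Om, continuous g} &
        forall x, Om x -> g x = 'D_(basis3 j) u x &
      forall x, closure Om x -> enorm (u x) = 1].

Definition admits_singularity Om u : Prop :=
  exists2 x, Om x &
    forall B : set (R * R * R), open B -> B x -> B `<=` Om -> ~ has_C1_repr B u.

End Sobolev.

Section Configurations.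
Context {R : realType} {N : nat}.
Local Notation config := ('I_N -> R * R * R -> 'rV[R]_3).
Implicit Types (Om : set (R * R * R)) (f : R * R * R -> 'rV[R]_3) (U : config).

Definition H1N Om : set config := [set U | forall i, H1 Om (U i)].

Definition H1N_norm Om U : R := Num.sqrt (\sum_i H1norm Om (U i) ^+ 2).

(* The elements of the topological dual of H^1(Om, R^3)^N.  Boundedness makes
   [L] insensitive to modifications of its argument on null sets. *)
Definition bounded_functional Om (L : config -> R) : Prop :=
  (forall (a : R) U V, H1N Om U -> H1N Om V ->
     L (fun i x => a *: U i x + V i x) = a * L U + L V) /\
  (exists C : R, forall U, H1N Om U -> `|L U| <= C * H1N_norm Om U).

Definition weak_cvg Om (Un : nat -> config) U : Prop :=
  forall L, bounded_functional Om L -> L (Un n) @[n --> \oo] --> L U.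

Definition calH Om : set config := [set U | forall i, H1S2 Om (U i)].

Definition calHf Om f : set config :=
  [set U | calH Om U /\ (fun x => \sum_i U i x) = f %[ae vol in Om]].

Definition Wf Om f : set config :=
  [set w | [/\ H1N Om w,
     (fun x => \sum_i w i x) = cst 0 %[ae vol in Om] &
     forall i, {ae vol, forall x, Om x -> enorm (N%:R^-1 *: f x + w i x) = 1}]].

Definition Flam Om f (lam : R) U : \bar R :=
  (\int[vol]_(x in Om)
    (2^-1 * (\sum_i grad_sqr Om (U i) x) +
     lam * enorm ((\sum_i U i x) - f x) ^+ 2)%R%:E)%E.

(* F_infty on [calHf]; also the energy minimized over [Wf]. *)
Definition half_dirichlet Om U : \bar R :=
  ((2^-1)%:E * \sum_(i < N) dirichlet Om (U i))%E.

Definition Finf_ext Om f U : \bar R :=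
  if `[< calHf Om f U >] then half_dirichlet Om U else +oo%E.

Definition is_regular Om U : Prop := forall i, has_C1_repr Om (U i).

Definition Gamma_cvg_Flam Om f : Prop :=
  forall lam : nat -> R,
    (forall n, 0 < lam n) -> lam n @[n --> \oo] --> +oo ->
    (forall (Un : nat -> config) U,
       (forall n, calH Om (Un n)) -> calH Om U -> weak_cvg Om Un U ->
       (Finf_ext Om f U <= limn_einf (fun n => Flam Om f (lam n) (Un n)))%E) /\
    (forall U, calHf Om f U ->
       exists Un : nat -> config,
         [/\ forall n, calH Om (Un n), weak_cvg Om Un U &
             (limn_esup (fun n => Flam Om f (lam n) (Un n))
                <= Finf_ext Om f U)%E]).

End Configurations.

Section Energies.
Context {R : realType} (N : nat).
Implicit Types (Om : set (R * R * R)) (f : R * R * R -> 'rV[R]_3).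

Definition Elam Om f (lam : R) : \bar R :=
  ereal_inf [set Flam Om f lam U | U in @calH R N Om].

Definition Einf Om f : \bar R :=
  ereal_inf [set half_dirichlet Om U | U in @calHf R N Om f].

Definition Ereg Om f (lam : R) : \bar R :=
  ereal_inf [set Flam Om f lam U | U in
    [set U : 'I_N -> R * R * R -> 'rV[R]_3 | forall i, C1bar_S2 Om (U i)]].

Definition is_minimizer Om f (lam : R) (U : 'I_N -> R * R * R -> 'rV[R]_3) :
    Prop :=
  calH Om U /\ Flam Om f lam U = Elam Om f lam.

End Energies.

(* Main.v *)
From HB Require Import structures.
Require Import Defs.
From mathcomp Require Import ring lra measurable_realfun.

(** The argument is the direct method of the calculus of variations, applied to
    configurations with bounded penalized energy as the penalization parameter
    $\lambda$ tends to infinity.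

    Compactness. A sequence of configurations of unit vector fields with bounded
    Dirichlet energy has a subsequence converging in $L^2$ ([rellich],
    [calH_compact]). Unit vector fields are uniformly bounded and hence have little
    $L^2$ norm near the boundary, however irregular it is, while on boxes inside
    the set Poincare's inequality ([poincare]) bounds the $L^2$ norm by finitely many
    means and a small multiple of the energy. Poincare's inequality itself comes
    from Haar coefficients on dyadic boxes: each of them is an inner product of the
    weak derivative with a tent function. The limit takes values in the sphere
    ([unit_norm_cvg]), and the Dirichlet energy is lower semicontinuous
    ([energy_lsc]). If the penalized energies stay bounded while $\lambda_n$ tends to
    infinity, the limit satisfies the constraint ([penalized_compact]).

    The energies. The class of admissible configurations contains [f] completed by
    constant unit vectors with zero sum, which exist because $N - 1 \ge 2$
    ([calHf_nonempty]). Gamma-convergence follows by bounding quadratic terms from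
    below by their tangents at the limit, which are elements of the dual of $H^1$
    ([Gamma_cvg]); convergence of the infima and existence of a constrained
    minimizer follow from compactness ([Elam_cvg], [Einf_attained]). With
    $u_i = f/N + w_i$ and $\sum_i w_i = 0$, the cross terms in the energy cancel
    ([split_energy]), which gives the formula for the constrained minimum.

    Singularities. If for arbitrarily large $\lambda$ there were a regular
    minimizer, or if the infimum over maps smooth up to the boundary were equal to
    the minimum, one would have smooth configurations $U^n$ with
    $F_{\lambda_n}(U^n) \le E_\infty(f) + 1/(n+1)$ and $\lambda_n$ tending to infinity. A
    limit is admissible and minimizing, so the energies converge to the energy of
    the limit, and the parallelogram law turns $L^2$ convergence into strong $H^1$
    convergence ([strong_cvg]). The limit is then a decomposition of [f] into strong
    limits of smooth maps, which is excluded. Finally, a map without a global $C^1$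
    representative has a singular point, since local representatives can be glued
    ([singularity_of_not_regular]). *)

Import Order.TTheory GRing.Theory Num.Theory.
Import numFieldNormedType.Exports.
Local Open Scope classical_set_scope.
Local Open Scope ring_scope.
Set Implicit Arguments.
Unset Strict Implicit.
Unset Printing Implicit Defensive.


(** * Square-integrable functions on a measurable set *)

Section SquareIntegrable.
Context d (T : measurableType d) (R : realType).
Variables (mu : {measure set T -> \bar R}) (D : set T).
Implicit Types f g h : T -> R.

Definition sq f := measurable_fun D f /\
  mu.-integrable D (EFin \o (fun x => f x ^+ 2)).

(** The inner product of $L^2(D)$. Estimates are made on [ip f f] rather than on its
    square root, so that they stay polynomial. *)
Definition ip f g : R := \int[mu]_(x in D) (f x * g x).

Hypothesis mD : measurable D.

Lemma sqM f g : sq f -> sq g -> mu.-integrable D (EFin \o (fun x => f x * g x)).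
Proof.
move=> [mf f2] [mg g2].
have := integrableD mD f2 g2; apply: le_integrable => //.
  by apply/measurable_EFinP; apply: measurable_funM.
move=> x Dx /=; rewrite lee_fin normrM [leRHS]ger0_norm ?addr_ge0 ?sqr_ge0//.
rewrite -(real_normK (num_real (f x))) -(real_normK (num_real (g x))).
have := sqr_ge0 (`|f x| - `|g x|); have := normr_ge0 (f x); have := normr_ge0 (g x).
by nra.
Qed.

Lemma sqD f g : sq f -> sq g -> sq (fun x => f x + g x).
Proof.
move=> hf hg; split; first by apply: measurable_funD; [case: hf|case: hg].
have := integrableD mD (integrableD mD hf.2 hg.2)
  (integrableZl mD 2 (sqM hf hg)).
by apply: eq_integrable => // x _ /=; congr EFin; ring.
Qed.

Lemma sqZ (a : R) f : sq f -> sq (fun x => a * f x).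
Proof.
move=> hf; split; first by apply: measurable_funM => //; case: hf.
have := integrableZl mD (a ^+ 2) hf.2.
by apply: eq_integrable => // x _ /=; congr EFin; ring.
Qed.

Lemma sqN f : sq f -> sq (fun x => - f x).
Proof. by move=> /(sqZ (-1)); congr sq; apply/funext => x; rewrite mulN1r. Qed.

Lemma sqB f g : sq f -> sq g -> sq (fun x => f x - g x).
Proof. by move=> hf /sqN; exact: sqD. Qed.

Lemma sq0 : sq (fun=> 0).
Proof.
split; first exact: measurable_cst.
have := integrable0 mu D.
by apply: eq_integrable => // x _ /=; rewrite expr0n.
Qed.

Lemma sq_sum (I : Type) (s : seq I) (F : I -> T -> R) :
  (forall i, sq (F i)) -> sq (fun x => \sum_(i <- s) F i x).
Proof.
move=> h; elim: s => [|i s ih].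
  by have := sq0; congr sq; apply/funext => x; rewrite big_nil.
have := sqD (h i) ih; congr sq; apply/funext => x; by rewrite big_cons.
Qed.

Lemma sq_bounded f (M : R) : (mu D < +oo)%E -> measurable_fun D f ->
  (forall x, D x -> `|f x| <= M) -> sq f.
Proof.
move=> D_fin mf fM; split=> //.
apply: measurable_bounded_integrable => //; first exact: measurable_funX.
exists (M ^+ 2); split; first exact: num_real.
move=> N MN x Dx /=; apply: le_trans (ltW MN); rewrite normrX.
by have := fM x Dx; have := normr_ge0 (f x); nra.
Qed.

Lemma sq_indic (A : set T) : (mu D < +oo)%E -> measurable A -> sq (\1_A).
Proof.
move=> D_fin mA; apply: (@sq_bounded _ 1) => //.
by move=> x _; rewrite indicE; case: (_ \in _); rewrite /= ?normr0 ?normr1 ?ler01.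
Qed.

Lemma ipC f g : ip f g = ip g f.
Proof. by apply: eq_Rintegral => x _; rewrite mulrC. Qed.

Lemma ipDl f g h : sq f -> sq g -> sq h ->
  ip (fun x => f x + g x) h = ip f h + ip g h.
Proof.
move=> hf hg hh; rewrite /ip -RintegralD//; [|exact: sqM|exact: sqM].
by apply: eq_Rintegral => x _; rewrite mulrDl.
Qed.

Lemma ipZl (a : R) f g : sq f -> sq g -> ip (fun x => a * f x) g = a * ip f g.
Proof.
move=> hf hg; rewrite /ip -RintegralZl//; last exact: sqM.
by apply: eq_Rintegral => x _; rewrite mulrA.
Qed.

Lemma ipBl f g h : sq f -> sq g -> sq h ->
  ip (fun x => f x - g x) h = ip f h - ip g h.
Proof.
move=> hf hg hh; rewrite /ip -RintegralB//; [|exact: sqM|exact: sqM].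
by apply: eq_Rintegral => x _; rewrite mulrBl.
Qed.

Lemma ipDr f g h : sq f -> sq g -> sq h ->
  ip h (fun x => f x + g x) = ip h f + ip h g.
Proof. by move=> hf hg hh; rewrite ipC ipDl// !(ipC h). Qed.

Lemma ipBr f g h : sq f -> sq g -> sq h ->
  ip h (fun x => f x - g x) = ip h f - ip h g.
Proof. by move=> hf hg hh; rewrite ipC ipBl// !(ipC h). Qed.

Lemma ipZr (a : R) f g : sq f -> sq g -> ip g (fun x => a * f x) = a * ip g f.
Proof. by move=> hf hg; rewrite ipC ipZl// ipC. Qed.

Lemma ip0l f : ip (fun=> 0) f = 0.
Proof.
rewrite /ip (_ : (fun x => _) = cst 0) ?Rintegral_cst ?mul0r//.
by apply/funext => x; rewrite mul0r.
Qed.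

Lemma ip_suml (I : Type) (s : seq I) (F : I -> T -> R) g :
  (forall i, sq (F i)) -> sq g ->
  ip (fun x => \sum_(i <- s) F i x) g = \sum_(i <- s) ip (F i) g.
Proof.
move=> hF hg; elim: s => [|i s ih].
  rewrite big_nil -[RHS](ip0l g); congr ip; by apply/funext => x; rewrite big_nil.
rewrite big_cons -ih -ipDl//; last exact: sq_sum.
congr ip; by apply/funext => x; rewrite big_cons.
Qed.

Lemma ip_ge0 f : 0 <= ip f f.
Proof. by apply: Rintegral_ge0 => x _; rewrite -expr2 sqr_ge0. Qed.

Lemma eq_ae_ip f f' g g' : sq f -> sq f' -> sq g -> sq g' ->
  f = f' %[ae mu in D] -> g = g' %[ae mu in D] -> ip f g = ip f' g'.
Proof.
move=> hf hf' hg hg' ff' gg'; congr fine; apply: ae_eq_integral => //.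
- exact: (measurable_int mu (sqM hf hg)).
- exact: (measurable_int mu (sqM hf' hg')).
- move: ff' gg'; apply: filterS2 => x e1 e2 Dx; rewrite e1// e2//.
Qed.

Lemma ip_sqrD f g : sq f -> sq g ->
  ip (fun x => f x + g x) (fun x => f x + g x) = ip f f + 2 * ip f g + ip g g.
Proof.
move=> hf hg; have hfg := sqD hf hg.
rewrite ipDl// !ipDr// (ipC g f); ring.
Qed.

Lemma ip_sqrB f g : sq f -> sq g ->
  ip (fun x => f x - g x) (fun x => f x - g x) = ip f f - 2 * ip f g + ip g g.
Proof.
move=> hf hg; have hfg := sqB hf hg.
rewrite ipBl// !ipBr// (ipC g f); ring.
Qed.

Lemma ip_sqrZ (a : R) f : sq f ->
  ip (fun x => a * f x) (fun x => a * f x) = a ^+ 2 * ip f f.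
Proof. by move=> hf; rewrite ipZl ?ipZr//; [ring|exact: sqZ]. Qed.

Lemma ip_sqrD_le f g : sq f -> sq g ->
  ip (fun x => f x + g x) (fun x => f x + g x) <= 2 * ip f f + 2 * ip g g.
Proof.
move=> hf hg; have := ip_ge0 (fun x => f x - g x).
by rewrite ip_sqrB// ip_sqrD//; lra.
Qed.

Lemma ip_sqr_sym f g : ip (fun x => f x - g x) (fun x => f x - g x) =
  ip (fun x => g x - f x) (fun x => g x - f x).
Proof. by apply: eq_Rintegral => x _; ring. Qed.

(** Weighted Young inequality; the weight is free, so that estimates can be
    made without taking square roots. *)
Lemma ip_young (t : R) f g : 0 < t -> sq f -> sq g ->
  2 * `|ip f g| <= t * ip f f + t^-1 * ip g g.
Proof.
move=> t0 hf hg.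
have tf := sqZ t hf.
have p : 0 <= t ^+ 2 * ip f f + 2 * t * ip f g + ip g g.
  have := ip_ge0 (fun x => t * f x + g x).
  by rewrite ip_sqrD// ip_sqrZ// ipZl// mulrA.
have m : 0 <= t ^+ 2 * ip f f - 2 * t * ip f g + ip g g.
  have := ip_ge0 (fun x => t * f x - g x).
  by rewrite ip_sqrB// ip_sqrZ// ipZl// mulrA.
rewrite -(ler_pM2l t0) mulrDr (mulrA t t^-1) divff ?gt_eqF// mul1r.
have [h|h] := lerP 0 (ip f g); [rewrite ger0_norm|rewrite ltr0_norm]; lra.
Qed.

Lemma ip_CS f g : sq f -> sq g -> ip f g ^+ 2 <= ip f f * ip g g.
Proof.
move=> hf hg; have a0 := ip_ge0 f; have b0 := ip_ge0 g.
have p t : 0 <= t ^+ 2 * ip f f + 2 * t * ip f g + ip g g.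
  have := ip_ge0 (fun x => t * f x + g x).
  by rewrite ip_sqrD// ?ip_sqrZ// ?ipZl// ?mulrA//; exact: sqZ.
have [a_eq0|a_neq0] := eqVneq (ip f f) 0.
  have [->|c0] := eqVneq (ip f g) 0; first by rewrite expr0n/= mulr_ge0.
  have := p (- (ip g g + 1) / (2 * ip f g)).
  rewrite a_eq0 mulr0 add0r.
  suff -> : 2 * (- (ip g g + 1) / (2 * ip f g)) * ip f g = - (ip g g + 1) by lra.
  by field.
have a_gt0 : 0 < ip f f by rewrite lt_neqAle eq_sym a_neq0.
have := p (- ip f g / ip f f).
suff -> : (- ip f g / ip f f) ^+ 2 * ip f f + 2 * (- ip f g / ip f f) * ip f g +
  ip g g = (ip f f * ip g g - ip f g ^+ 2) / ip f f.
  by rewrite pmulr_lge0 ?invr_gt0// subr_ge0.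
by field.
Qed.

Lemma ip_eq0_ae f : sq f -> ip f f = 0 -> f = (fun=> 0) %[ae mu in D].
Proof.
move=> hf f0.
have : (\int[mu]_(x in D) `|(f x ^+ 2)%:E| = 0)%E.
  transitivity (\int[mu]_(x in D) (f x * f x)%:E)%E.
    by apply: eq_integral => x _; rewrite gee0_abs ?lee_fin ?sqr_ge0// expr2.
  rewrite -[LHS]fineK; first by rewrite [fine _]f0.
  by apply: integrable_fin_num => //; exact: sqM.
move/(ae_eq_integral_abs mu mD (measurable_int mu hf.2)).
apply: filterS => x h Dx; have [] := h Dx.
by move/eqP; rewrite sqrf_eq0 => /eqP.
Qed.

Lemma sq_L1 (f : T -> R) : (mu D < +oo)%E -> sq f ->
  mu.-integrable D (EFin \o f).
Proof.
move=> D_fin hf.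
have h1 : sq (fun=> 1).
  by apply: (@sq_bounded _ 1) => // x _; rewrite normr1.
have := sqM hf h1; by apply: eq_integrable => // x _ /=; rewrite mulr1.
Qed.

Section Convergence.
Hypothesis D_fin : (mu D < +oo)%E.
Variables (fn : nat -> T -> R) (f : T -> R).
Hypothesis sqfn : forall n, sq (fn n).
Hypothesis sqf : sq f.
Hypothesis fnf : ip (fun x => fn n x - f x) (fun x => fn n x - f x)
  @[n --> \oo] --> (0 : R).

Lemma cvg_ipr g : sq g -> ip (fn n) g @[n --> \oo] --> ip f g.
Proof.
move=> hg; apply/cvgrPdist_le => e e0.
set c := ip g g; have c0 : 0 <= c by exact: ip_ge0.
have e2 : 0 < e ^+ 2 / (c + 1).
  by apply: divr_gt0; [exact: exprn_gt0|lra].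
move/cvgrPdist_le : fnf => /(_ _ e2); apply: filterS => n.
rewrite sub0r normrN ger0_norm ?ip_ge0// => h.
rewrite distrC -ipBl// -ler_sqr ?nnegrE ?(ltW e0)//.
rewrite real_normK ?num_real//.
apply: (le_trans (ip_CS (sqB (sqfn n) sqf) hg)).
rewrite -/c; apply: (le_trans (ler_wpM2r c0 h)).
rewrite -mulrA ger_pMr ?exprn_gt0// mulrC ler_pdivrMr; lra.
Qed.

Lemma cvg_ip_sqr : ip (fn n) (fn n) @[n --> \oo] --> ip f f.
Proof.
have -> : (fun n => ip (fn n) (fn n)) = (fun n =>
   ip (fun x => fn n x - f x) (fun x => fn n x - f x) + 2 * ip (fn n) f - ip f f).
  by apply/funext => n; rewrite ip_sqrB//; ring.
rewrite [X in _ --> X](_ : _ = 0 + 2 * ip f f - ip f f); last by ring.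
apply: cvgB; last exact: cvg_cst.
apply: cvgD => //; apply: cvgM; first exact: cvg_cst.
exact: cvg_ipr.
Qed.

End Convergence.

End SquareIntegrable.


(** * Completeness of $L^2$ *)

Lemma limn_einf_le (R : realType) (u : nat -> \bar R) (e : \bar R) :
  (\forall n \near \oo, (u n <= e)%E) -> (limn_einf u <= e)%E.
Proof.
move=> ue; rewrite limn_einf_lim; apply: lime_le; first exact: is_cvg_einfs.
apply: filterS ue => n; apply: le_trans.
by apply: ereal_inf_lbound; exists n => //=.
Qed.

Lemma cvg_EFinS (R : realType) (u : nat -> R) (l : R) :
  u n @[n --> \oo] --> l -> (u n)%:E @[n --> \oo] --> l%:E.
Proof. by move=> h; apply: cvg_EFin; [exact: nearW|exact: h]. Qed.

Lemma cvg_sqr (R : realType) (u : nat -> R) (l : R) :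
  u n @[n --> \oo] --> l -> u n ^+ 2 @[n --> \oo] --> l ^+ 2.
Proof. by move=> h; rewrite expr2; under eq_fun do rewrite expr2; exact: cvgM. Qed.

Lemma cvgn_le (R : realType) (u : nat -> R) (l M : R) :
  u n @[n --> \oo] --> l -> (forall n, u n <= M) -> l <= M.
Proof.
move=> ul uM; rewrite -(cvg_lim (@norm_hausdorff _ _) ul).
apply: limr_le; first by apply/cvg_ex; exists l.
exact: nearW.
Qed.

Lemma geometric_half_sum (R : realType) (n : nat) :
  \sum_(0 <= k < n) (2^-1 : R) ^+ k <= 2.
Proof.
suff -> : \sum_(0 <= k < n) (2^-1 : R) ^+ k = 2 - 2 * 2^-1 ^+ n.
  have h : 0 <= (2^-1 : R) ^+ n by apply: exprn_ge0; lra.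
  by lra.
elim: n => [|n ih]; first by rewrite big_nil expr0; lra.
by rewrite big_nat_recr//= ih exprS; lra.
Qed.

Section Completeness.
Context d (T : measurableType d) (R : realType).
Variables (mu : {measure set T -> \bar R}) (D : set T).
Hypothesis mD : measurable D.
Hypothesis D_fin : (mu D < +oo)%E.
Local Notation sq := (sq mu D).
Local Notation ip := (ip mu D).
Implicit Types f g h : T -> R.

Lemma int_sqrE f g : sq f -> sq g ->
  (\int[mu]_(x in D) ((f x - g x) ^+ 2)%:E =
   (ip (fun x => f x - g x) (fun x => f x - g x))%:E)%E.
Proof.
move=> hf hg; rewrite /ip /Rintegral fineK; last first.
  apply: integrable_fin_num => //.
  exact: sqM (sqB mD hf hg) (sqB mD hf hg).
by apply: eq_integral => x _; rewrite expr2.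
Qed.

(** Cauchy--Schwarz against the constant $1$, in its weighted additive form. *)
Lemma L1_le_L2 f (t : R) : 0 < t -> sq f ->
  (\int[mu]_(x in D) `|f x|%:E <= (t * ip f f + t^-1 * fine (mu D))%:E)%E.
Proof.
move=> t0 hf.
have h1 : sq (fun=> 1) by apply: (@sq_bounded _ _ _ _ _ _ _ 1) => // x _; rewrite normr1.
have af : sq (fun x => `|f x|).
  split; first by apply: measurableT_comp => //; case: hf.
  by have := hf.2; apply: eq_integrable => // x _ /=; rewrite real_normK ?num_real.
have -> : (\int[mu]_(x in D) `|f x|%:E = (ip (fun x => `|f x|)%R (fun=> 1%R))%:E)%E.
  rewrite /ip /Rintegral fineK; first by apply: eq_integral => x _; rewrite mulr1.
  by apply: integrable_fin_num => //; exact: sqM.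
rewrite lee_fin; have := ip_young mD t0 af h1.
have -> : ip (fun x => `|f x|) (fun x => `|f x|) = ip f f.
  by apply: eq_Rintegral => x _; rewrite -expr2 real_normK ?num_real// expr2.
have -> : ip (fun=> 1) (fun=> 1) = fine (mu D).
  by rewrite /ip (_ : (fun x => _) = cst 1) ?Rintegral_cst ?mul1r//; apply/funext => x; rewrite mul1r.
have c0 : 0 <= ip (fun x => `|f x|) (fun=> 1).
  by apply: Rintegral_ge0 => x _; rewrite mulr1.
rewrite ger0_norm//; lra.
Qed.

(** Riesz--Fischer: a rapidly Cauchy subsequence converges almost everywhere
    because its increments are summable in $L^1$, and Fatou's lemma turns the
    pointwise limit into an $L^2$ limit. *)
Lemma sq_complete (fn : nat -> T -> R) : (forall n, sq (fn n)) ->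
  (forall e, 0 < e -> exists n0, forall n m, (n0 <= n)%N -> (n0 <= m)%N ->
     ip (fun x => fn n x - fn m x) (fun x => fn n x - fn m x) <= e) ->
  exists2 f, sq f & ip (fun x => fn n x - f x) (fun x => fn n x - f x)
    @[n --> \oo] --> (0 : R).
Proof.
move=> hfn hC.
have p4 k : 0 < (4^-1 : R) ^+ k by apply: exprn_gt0; rewrite invr_gt0.
have [phi hphi] := choice (fun k => hC _ (p4 k)).
(* Adding all earlier indices and [k] makes the subsequence nondecreasing and
   keeps its [k]-th index at least [k]. *)
pose psi k := (\sum_(i < k.+1) phi i + k)%N.
have phi_psi k : (phi k <= psi k)%N by rewrite /psi big_ord_recr/= -addnA addnCA leq_addr.
have psiS k : (psi k <= psi k.+1)%N by rewrite /psi (big_ord_recr k.+1)/= addnS leqW// leq_add2r leq_addr.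
pose dk k x := fn (psi k.+1) x - fn (psi k) x.
have sdk k : sq (dk k) by exact: sqB.
have dkL2 k : ip (dk k) (dk k) <= 4^-1 ^+ k.
  by apply: hphi => //; apply: leq_trans (psiS k).
pose C := 1 + fine (mu D).
have muD0 : 0 <= fine (mu D) by exact: fine_ge0.
(* The weight $2^k$ balances the bound $4^{-k}$ on the squares. *)
have dkL1 k : (\int[mu]_(x in D) `|dk k x|%:E <= (C * 2^-1 ^+ k)%:E)%E.
  have p2 : 0 < (2 : R) ^+ k by exact: exprn_gt0.
  apply: (le_trans (L1_le_L2 p2 (sdk k))); rewrite lee_fin /C mulrDl mul1r.
  apply: lerD; last by rewrite mulrC exprVn.
  apply: (le_trans (ler_wpM2l (ltW p2) (dkL2 k))).
  by rewrite -exprMn (_ : 2 * 4^-1 = 2^-1 :> R)//; lra.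
have mdk k : measurable_fun D (fun x => `|dk k x|%:E).
  by apply/measurable_EFinP; apply: measurableT_comp => //; case: (sdk k).
have sumfin : (\int[mu]_(x in D) (\sum_(k <oo) `|dk k x|%:E) < +oo)%E.
  rewrite integral_nneseries//.
  apply: (@le_lt_trans _ _ (C * 2)%:E); last exact: ltry.
  apply: lime_le.
    by apply: is_cvg_nneseries => n _ _; apply: integral_ge0.
  apply: nearW => n.
  apply: (@le_trans _ _ (\sum_(0 <= k < n) (C * 2^-1 ^+ k)%:E)%E).
    by apply: lee_sum => k _; exact: dkL1.
  rewrite sumEFin lee_fin -mulr_sumr ler_wpM2l//; first by rewrite /C; lra.
  exact: geometric_half_sum.
have aecvg : {ae mu, forall x, D x -> cvgn (fun k => fn (psi k) x)}.
  have intS : mu.-integrable D (fun x => (\sum_(k <oo) `|dk k x|%:E)%E).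
    apply/integrableP; split.
      by apply: ge0_emeasurable_sum.
    rewrite (eq_integral (fun x => (\sum_(k <oo) `|dk k x|%:E)%E))// => x _.
    by rewrite gee0_abs// nneseries_ge0.
  have := integrable_ae mD intS; apply: filterS => x h Dx; have {}h := h Dx.
  have cS : cvgn (series (fun k => dk k x)).
    apply: normed_cvg.
    suff : cvgn (series (fun k => `|dk k x|)) by [].
    apply: nondecreasing_is_cvgn.
      apply/nondecreasing_seqP => n; rewrite !seriesEnat/= big_nat_recr//=.
      by rewrite lerDl.
    exists (fine (\sum_(k <oo) `|dk k x|%:E)%E) => _ [n _ <-].
    rewrite -lee_fin fineK// seriesEnat/= -sumEFin.
    exact: nneseries_lim_ge.
  have -> : (fun k => fn (psi k) x) =
      (fun k => fn (psi 0%N) x + series (fun k => dk k x) k).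
    apply/funext => k; rewrite (eq_sum_telescope (fun k => fn (psi k) x)).
    by congr (_ + _).
  by apply: is_cvgD => //; exact: is_cvg_cst.
(* The upper limit is measurable on all of [D], and it is the limit wherever there
   is one. *)
pose f x := fine (limn_esup (fun k => (fn (psi k) x)%:E)).
have mf : measurable_fun D f.
  apply: measurableT_comp => //; apply: measurable_fun_limn_esup => k.
  by apply/measurable_EFinP; case: (hfn (psi k)).
have cvf : {ae mu, forall x, D x -> fn (psi k) x @[k --> \oo] --> f x}.
  apply: filterS aecvg => x h Dx; have {}h := h Dx.
  have hE := cvg_EFinS h.
  by rewrite /f is_cvg_limn_esupE; [rewrite (cvg_lim _ hE)|apply/cvg_ex; eexists; exact: hE].
have key n e : (forall k, (n <= k)%N ->
     ip (fun x => fn k x - fn n x) (fun x => fn k x - fn n x) <= e) ->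
  (\int[mu]_(x in D) ((f x - fn n x) ^+ 2)%:E <= e%:E)%E.
  move=> he.
  have mF k : measurable_fun D (fun x => ((fn (psi k) x - fn n x) ^+ 2)%:E).
    apply/measurable_EFinP; apply: measurable_funX; apply: measurable_funB.
      by case: (hfn (psi k)).
    by case: (hfn n).
  have := fatou mu mD mF (fun k x _ => sqr_ge0 _).
  rewrite (ae_eq_integral (fun x => ((f x - fn n x) ^+ 2)%:E)) //; first last.
  - apply: filterS cvf => x h Dx; have {}h := h Dx.
    rewrite is_cvg_limn_einfE.
      apply/cvg_lim => //; apply: cvg_EFinS.
      by apply: cvg_sqr; apply: cvgB => //; exact: cvg_cst.
    apply/cvg_ex; eexists; apply: cvg_EFinS.
    by apply: cvg_sqr; apply: cvgB; [exact: h|exact: cvg_cst].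
  - apply/measurable_EFinP; apply: measurable_funX; apply: measurable_funB => //.
    by case: (hfn n).
  - rewrite /limn_einf; apply: measurableT_comp => //.
    by apply: measurable_fun_limn_esup => k; apply: measurableT_comp.
  move/le_trans; apply; apply: limn_einf_le.
  exists n => // k /= nk.
  rewrite int_sqrE// lee_fin; apply: he; apply: (leq_trans nk).
  exact: leq_addl.
have sqf : sq f.
  have [n hn] := hC 1 ltr01.
  have kn := key n 1 (fun k nk => hn k n nk (leqnn n)).
  have sfn : sq (fun x => f x - fn n x).
    split; first by apply: measurable_funB => //; case: (hfn n).
    apply/integrableP; split.
      by apply/measurable_EFinP; apply: measurable_funX; apply: measurable_funB => //; case: (hfn n).
    apply: le_lt_trans (ltry 1); apply: le_trans kn.
    rewrite le_eqVlt; apply/orP; left; apply/eqP; apply: eq_integral => x _ /=.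
    by rewrite ger0_norm// sqr_ge0.
  have := sqD mD sfn (hfn n).
  suff -> : (fun x => f x - fn n x + fn n x) = f by [].
  by apply/funext => x; rewrite subrK.
exists f => //; apply/cvgrPdist_le => e e0.
have [n hn] := hC e e0; exists n => // m /= nm.
rewrite sub0r normrN ger0_norm ?ip_ge0// -lee_fin ip_sqr_sym -int_sqrE//.
by apply: key => k mk; apply: hn => //; exact: leq_trans mk.
Qed.

End Completeness.


(** * Boxes and Borel sets in space *)

Section Boxes.
Context {R : realType}.
Local Notation leb := (@lebesgue_measure R).
Local Notation vol := (@vol R).
Local Notation T := (R * R * R)%type.
(* The measurable structure on which [vol] lives. *)
Local Notation T3 := (measurableTypeR R * measurableTypeR R * measurableTypeR R)%type.
Implicit Types (lo hi : 'I_3 -> R) (x y : T).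

Definition crd (j : 'I_3) x : R :=
  if val j is 0%N then x.1.1 else if val j is 1%N then x.1.2 else x.2.

Definition j0 : 'I_3 := ord0.
Definition j1 : 'I_3 := lift ord0 ord0.
Definition j2 : 'I_3 := ord_max.

Lemma I3P (P : 'I_3 -> Prop) : P j0 -> P j1 -> P j2 -> forall j, P j.
Proof.
move=> h0 h1 h2 [[|[|[|//]]] h].
- by rewrite (_ : Ordinal h = j0)//; exact: val_inj.
- by rewrite (_ : Ordinal h = j1)//; exact: val_inj.
- by rewrite (_ : Ordinal h = j2)//; exact: val_inj.
Qed.

Lemma prod3 (F : 'I_3 -> R) : \prod_(j < 3) F j = F j0 * F j1 * F j2.
Proof.
rewrite !big_ord_recl big_ord0 mulr1 mulrA.
by congr (_ * _ * _); congr F; apply: val_inj.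
Qed.

Lemma sum3 (F : 'I_3 -> R) : \sum_(j < 3) F j = F j0 + F j1 + F j2.
Proof.
rewrite !big_ord_recl big_ord0 addr0 addrA.
by congr (_ + _ + _); congr F; apply: val_inj.
Qed.

Definition box lo hi : set T :=
  [set x | forall j, lo j < crd j x /\ crd j x <= hi j].
Definition cbox lo hi : set T :=
  [set x | forall j, lo j <= crd j x /\ crd j x <= hi j].

Lemma box_cbox lo hi : box lo hi `<=` cbox lo hi.
Proof. by move=> x h j; have [/ltW ? ?] := h j. Qed.

Lemma boxE lo hi :
  box lo hi = (`]lo j0, hi j0] `*` `]lo j1, hi j1]) `*` `]lo j2, hi j2].
Proof.
apply/seteqP; split=> x /=; rewrite !in_itv/=.
  by move=> h; have [? ?] := h j0; have [? ?] := h j1; have [? ?] := h j2;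
    split; [split|]; apply/andP.
by move=> [[/andP[? ?] /andP[? ?]] /andP[? ?]]; apply: I3P.
Qed.

Lemma measurable_box lo hi : @measurable _ T3 (box lo hi).
Proof.
by rewrite boxE; apply: measurableX; [apply: measurableX|];
  exact: measurable_itv.
Qed.

Lemma vol_box lo hi : (forall j, lo j <= hi j) ->
  vol (box lo hi) = (\prod_(j < 3) (hi j - lo j))%:E.
Proof.
move=> h; rewrite boxE /vol/=.
rewrite product_measure1E; [|by apply: measurableX; exact: measurable_itv|exact: measurable_itv].
rewrite [X in (X * _)%E]product_measure1E; [|exact: measurable_itv|exact: measurable_itv].
have itv j : leb `]lo j, hi j]%classic = (hi j - lo j)%:E.
  rewrite lebesgue_measure_itv/= lte_fin.
  case: ltP => // hl; have := h j; rewrite le_eqVlt => /predU1P[->|].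
    by rewrite subrr.
  by rewrite ltNge hl.
by rewrite prod3 !EFinM; congr (_ * _ * _)%E; exact: itv.
Qed.

Lemma vol_box_fin lo hi : (vol (box lo hi) < +oo)%E.
Proof.
have [h|] := pselect (forall j, lo j <= hi j); first by rewrite vol_box ?ltry.
move=> /existsNP[j h]; rewrite (_ : box lo hi = set0) ?measure0 ?ltry//.
apply/seteqP; split => // x hx; apply: h; have [/ltW h1 h2] := hx j.
exact: le_trans h2.
Qed.

Lemma boxI lo hi lo' hi' : box lo hi `&` box lo' hi' =
  box (fun j => Num.max (lo j) (lo' j)) (fun j => Num.min (hi j) (hi' j)).
Proof.
apply/seteqP; split => x /=.
  move=> [h1 h2] j; have [? ?] := h1 j; have [? ?] := h2 j.
  by rewrite gt_max le_min; split; apply/andP.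
move=> h; split=> j; have := h j; rewrite gt_max le_min => -[/andP[? ?] /andP[? ?]].
  by [].
by [].
Qed.

Lemma ballP x (e : R) y : (ball x e y) <-> (forall j, `|crd j x - crd j y| < e).
Proof.
split; first by move=> [[h0 h1] h2]; apply: I3P.
by move=> h; split; [split|]; [exact: (h j0)|exact: (h j1)|exact: (h j2)].
Qed.

Lemma open_ball (O : set T) x : open O -> O x ->
  exists2 e : R, 0 < e & forall y, (forall j, `|crd j x - crd j y| < e) -> O y.
Proof.
move=> oO Ox; have /nbhs_ballP[e/= e0 he] := open_nbhs_nbhs (conj oO Ox).
by exists e => // y hy; apply: he; apply/ballP.
Qed.

Lemma ratr_between (a b : R) : a < b -> exists q : rat, a < ratr q < b.
Proof. by move=> ab; have [q] := rat_in_itvoo ab; rewrite in_itv/=; exists q. Qed.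

(** Rational boxes form a countable base, which serves instead of Lindelof's
    theorem: a property that holds almost everywhere near each point of an open set
    holds almost everywhere on it. *)
Lemma rational_boxes : exists lo hi : nat -> 'I_3 -> R,
  forall (O : set T) x, open O -> O x ->
    exists n, box (lo n) (hi n) x /\ cbox (lo n) (hi n) `<=` O.
Proof.
pose I := ({ffun 'I_3 -> rat} * {ffun 'I_3 -> rat})%type.
pose L n := if unpickle n is Some i then fun j : 'I_3 => ratr ((i : I).1 j) : R else fun=> 0.
pose H n := if unpickle n is Some i then fun j : 'I_3 => ratr ((i : I).2 j) : R else fun=> 0.
exists L, H => O x oO Ox; have [e epos he] := open_ball oO Ox.
have lq j : exists q : rat, crd j x - e < ratr q < crd j x.
  by apply: ratr_between; lra.
have hq j : exists q : rat, crd j x < ratr q < crd j x + e.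
  by apply: ratr_between; lra.
have [l hl] := choice lq; have [h hh] := choice hq.
exists (pickle (([ffun j => l j], [ffun j => h j]) : I)); rewrite /L /H pickleK; split.
  move=> j; rewrite !ffunE; have /andP[? ?] := hl j; have /andP[? ?] := hh j.
  by split=> //; apply: ltW.
move=> y hy; apply: he => j; have := hy j.
rewrite !ffunE => -[a b]; have /andP[? ?] := hl j; have /andP[? ?] := hh j.
by rewrite ltr_distlC; apply/andP; split; lra.
Qed.

Lemma open_box_cover (O : set T) : open O ->
  exists lo hi : nat -> 'I_3 -> R,
    (forall n, cbox (lo n) (hi n) `<=` O) /\ O = \bigcup_n box (lo n) (hi n).
Proof.
move=> oO; have [lo [hi hb]] := rational_boxes.
pose good n := `[< cbox (lo n) (hi n) `<=` O >].
pose L n := if good n then lo n else fun=> 1.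
pose H n := if good n then hi n else fun=> 0.
have e0 : cbox (fun=> 1) (fun=> 0) `<=` O.
  by move=> x /(_ j0)[h1 h2]; have := le_trans h1 h2; rewrite ler10.
have LH n : cbox (L n) (H n) `<=` O.
  by rewrite /L /H /good; case: asboolP.
exists L, H; split=> //; apply/seteqP; split; last first.
  by move=> x [n _] /box_cbox; exact: LH.
move=> x Ox; have [n [bx cO]] := hb O x oO Ox.
by exists n => //; rewrite /L /H /good asboolT.
Qed.

Lemma open_measurable3 (O : set T) : open O -> @measurable _ T3 O.
Proof.
move=> /open_box_cover[lo [hi [_ ->]]].
by apply: bigcup_measurable => n _; exact: measurable_box.
Qed.

Lemma continuous_measurable3 (D : set T) (phi : T -> R) : continuous phi ->
  @measurable_fun _ _ T3 R D phi.
Proof.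
move=> cphi; apply: (@measurable_funS _ _ T3 R setT) => // mD.
apply: (measurability _ (RGenOInfty.measurableE R)) => //.
move=> _ [_ [a ->] <-]; rewrite setTI; apply: open_measurable3.
by apply: open_comp => [x _|]; [exact: cphi|exact: rray_open].
Qed.

Lemma measurable_boxes : @measurable _ T3 =
  <<s [set box l.1 l.2 | l in [set: ('I_3 -> R) * ('I_3 -> R)]] >>.
Proof.
set G := [set _ | _ in _].
apply/seteqP; split; last first.
  apply: smallest_sub; first exact: sigma_algebra_measurable.
  by move=> _ [l _ <-]; exact: measurable_box.
move=> A mA.
pose TG := g_sigma_algebraType G.
have mcrd j : measurable_fun setT (crd j : TG -> R).
  apply: (@measurability _ _ _ _ setT _ (@ocitv R)) => //.
  move=> _ [_ [[a b] _ <-] <-]; rewrite setTI.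
  rewrite (_ : _ @^-1` _ = \bigcup_n box
    (fun i => if i == j then a else - n%:R) (fun i => if i == j then b else n%:R)).
    by apply: bigcup_measurable => n _; apply: sub_sigma_algebra; eexists (_, _).
  apply/seteqP; split => [x /=|x [n _] /(_ j)]; last first.
    by rewrite eqxx /= in_itv/= => -[? ?]; apply/andP.
  rewrite in_itv/=.
  move=> /andP[ax xb].
  pose M := `|crd j0 x| + `|crd j1 x| + `|crd j2 x|.
  have [n Mn] : exists n : nat, M < n%:R.
    exists (Num.truncn M).+1; exact: truncnS_gt.
  have hM i : `|crd i x| < n%:R.
    apply: le_lt_trans Mn; move: i; apply: I3P; rewrite /M;
    have := normr_ge0 (crd j0 x); have := normr_ge0 (crd j1 x);
    have := normr_ge0 (crd j2 x); lra.
  exists n => // i; case: eqP => [->//|_].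
  by have := hM i; rewrite ltr_norml => /andP[? ?]; split=> //; exact: ltW.
have mid : measurable_fun setT (fun x : TG => (crd j0 x, crd j1 x, crd j2 x)).
  by apply: measurable_fun_pair; [apply: measurable_fun_pair|]; exact: mcrd.
have := mid measurableT A mA; rewrite setTI.
by rewrite (_ : _ @^-1` A = A)//; apply/seteqP; split => -[[x y] z].
Qed.

End Boxes.


(** * Functions determined by their integrals over boxes *)

Section NonnegDensity.
Context d (T : measurableType d) (R : realType) (mu : {measure set T -> \bar R}).
Variable F : T -> \bar R.
Hypotheses (mF : measurable_fun setT F) (F0 : forall x, (0 <= F x)%E).

(** The two hypotheses are arguments so that the measure structure can be attached
    to the function. *)
Definition density_measure (_ : measurable_fun setT F) (_ : forall x, (0 <= F x)%E)
  (A : set T) : \bar R := (\int[mu]_(x in A) F x)%E.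

Local Notation nu := (density_measure mF F0).

Let nu0 : nu set0 = 0%E. Proof. by rewrite /density_measure integral_set0. Qed.
Let nu_ge0 A : (0 <= nu A)%E. Proof. exact: integral_ge0. Qed.
Let nu_sigma : semi_sigma_additive nu.
Proof. exact: semi_sigma_additive_nng_induced. Qed.

HB.instance Definition _ := isMeasure.Build _ _ _ nu nu0 nu_ge0 nu_sigma.

End NonnegDensity.

(** The positive and the negative part of [F] are the densities of two finite
    measures, which agree as soon as they do on a generating pi-system. *)
Lemma integral_generator_eq0 d (T : measurableType d) (R : realType)
    (mu : {measure set T -> \bar R}) (G : set (set T)) (g : (set T)^nat)
    (F : T -> \bar R) :
  @measurable _ T = <<s G >> -> setI_closed G -> (forall i, G (g i)) ->
  \bigcup_k g k = setT -> mu.-integrable setT F ->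
  (forall A, G A -> (\int[mu]_(x in A) F x = 0)%E) ->
  forall A, measurable A -> (\int[mu]_(x in A) F x = 0)%E.
Proof.
move=> mG GI Gg gT iF F0.
have mF : measurable_fun setT F := measurable_int mu iF.
have mP := measurable_funepos mF; have mN := measurable_funeneg mF.
have P0 : forall x, (0 <= F^\+ x)%E by move=> x; exact: funepos_ge0.
have N0 : forall x, (0 <= F^\- x)%E by move=> x; exact: funeneg_ge0.
have mGA A : G A -> measurable A by rewrite mG; exact: sub_sigma_algebra.
have finP A : measurable A -> (\int[mu]_(x in A) F^\+ x)%E \is a fin_num.
  move=> mA; apply: integrable_fin_num => //; apply: (integrableS measurableT) => //.
  exact: integrable_funepos.
have finN A : measurable A -> (\int[mu]_(x in A) F^\- x)%E \is a fin_num.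
  move=> mA; apply: integrable_fin_num => //; apply: (integrableS measurableT) => //.
  exact: integrable_funeneg.
move=> A mA; rewrite integralE.
suff -> : (\int[mu]_(x in A) F^\+ x = \int[mu]_(x in A) F^\- x)%E.
  by rewrite subee// finN.
apply: (measure_unique G g mG GI Gg gT
  (density_measure mu mP P0) (density_measure mu mN N0)) => //.
- move=> B GB; have mB := mGA _ GB; have := F0 B GB; rewrite integralE => /eqP.
  by rewrite sube_eq ?finP// ?add0e ?fin_num_adde_defl ?finN// => /eqP.
- by move=> k; rewrite ltey_eq; apply/orP; left; apply: finP; apply: mGA.
Qed.

#[global] Instance ae_vol_filter (R : realType) :
  Filter (almost_everywhere (@vol R)).
Proof. exact: (@ae_filter_ringOfSetsType _
  (measurableTypeR R * measurableTypeR R * measurableTypeR R)%type). Qed.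

Section BoxUnique.
Context {R : realType}.
Local Notation vol := (@vol R).
Local Notation T := (R * R * R)%type.
Local Notation T3 := (measurableTypeR R * measurableTypeR R * measurableTypeR R)%type.

(** Boxes are stable under intersection and generate the measurable sets. *)
Lemma box_integral_eq0 (lo hi : 'I_3 -> R) (w : T -> R) :
  vol.-integrable (box lo hi) (EFin \o w) ->
  (forall lo' hi', box lo' hi' `<=` box lo hi ->
     \int[vol]_(x in box lo' hi') w x = 0) ->
  w = (fun=> 0) %[ae vol in box lo hi].
Proof.
move=> iw w0; have mK := measurable_box lo hi; set K := box lo hi in iw w0 mK *.
have iF : vol.-integrable setT ((EFin \o w) \_ K).
  by have := (integrable_mkcond (mu := vol) (EFin \o w) mK).1; apply.
have key A : measurable A -> (\int[vol]_(x in A) ((EFin \o w) \_ K) x = 0)%E.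
  apply: (@integral_generator_eq0 _ T3 R vol _
    (fun n => box (fun=> - n%:R) (fun=> n%:R)) _ measurable_boxes) => //.
  - move=> _ _ [[l1 h1] _ <-] [[l2 h2] _ <-]; rewrite boxI.
    by eexists (_, _).
  - by move=> n; eexists (_, _).
  - apply/seteqP; split=> // x _.
    pose M := `|crd j0 x| + `|crd j1 x| + `|crd j2 x|.
    have [n Mn] : exists n : nat, M < n%:R.
      exists (Num.truncn M).+1; exact: truncnS_gt.
    exists n => // i.
    have : `|crd i x| < n%:R.
      apply: le_lt_trans Mn; move: i; apply: I3P; rewrite /M;
      have := normr_ge0 (crd j0 x); have := normr_ge0 (crd j1 x);
      have := normr_ge0 (crd j2 x); lra.
    by rewrite ltr_norml => /andP[? ?]; split=> //; exact: ltW.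
  - move=> _ [[l h] _ <-]; rewrite -integral_mkcondr setIC boxI/=.
    set B := box _ _.
    have BK : B `<=` K by rewrite /B -boxI => x [].
    rewrite -[LHS]fineK; first by congr EFin; exact: w0.
    apply: (@integrable_fin_num _ T3 R vol); first exact: measurable_box.
    exact: (@integrableS _ T3 R vol _ _ _ mK (measurable_box _ _) BK iw).
have := @integral_ae_eq _ _ _ vol K mK (fun=> 0%E) (EFin \o w) iw
  (measurable_cst _).
rewrite /ae_eq => h.
have : {ae vol, forall x, K x -> (EFin \o w) x = 0%E}.
  apply: h => E EK mE; rewrite integral0 -[RHS](key E mE).
  rewrite -integral_mkcondr; congr (integral _ _ _).
  by apply/seteqP; split=> [x Ex|x []]; [split=> //; exact: EK|].
by apply: filterS => x h' Kx; have [] := h' Kx.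
Qed.

End BoxUnique.


(** * Dyadic subdivision of boxes *)

Section FiniteSums.
Context d (T : measurableType d) (R : realType).
Variables (mu : {measure set T -> \bar R}).

Lemma Rintegral_sum (D : set T) (mD : measurable D) (I : eqType) (s : seq I)
    (F : I -> T -> R) :
  (forall i, i \in s -> mu.-integrable D (EFin \o F i)) ->
  mu.-integrable D (EFin \o (fun x => \sum_(i <- s) F i x)) /\
  \int[mu]_(x in D) (\sum_(i <- s) F i x) = \sum_(i <- s) \int[mu]_(x in D) F i x.
Proof.
elim: s => [|i s ih] h.
  split; last by rewrite big_nil; under eq_Rintegral do rewrite big_nil;
    rewrite Rintegral_cst// mul0r.
  have := integrable0 mu D; apply: eq_integrable => // x _ /=.
  by rewrite big_nil.
have [i1 i2] := ih (fun j js => h j (mem_behead (s := i :: s) js)).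
have i3 := h i (mem_head _ _).
split.
  have := integrableD mD i3 i1; apply: eq_integrable => // x _ /=.
  by rewrite big_cons.
rewrite big_cons -i2 -RintegralD//.
by apply: eq_Rintegral => x _; rewrite big_cons.
Qed.

(** The partition is given by a sum of indicator functions: this single equation
    rules out gaps and overlaps, and it is the form in which refinements compose. *)
Lemma Rintegral_parts (B : set T) (I : eqType) (s : seq I) (A : I -> set T)
    (w : T -> R) :
  measurable B -> (forall i, measurable (A i)) ->
  (forall i, i \in s -> A i `<=` B) ->
  (forall x, B x -> \sum_(i <- s) \1_(A i) x = 1 :> R) ->
  mu.-integrable B (EFin \o w) ->
  \int[mu]_(x in B) w x = \sum_(i <- s) \int[mu]_(x in A i) w x.
Proof.
move=> mB mA AB s1 iw.
have iA i : mu.-integrable B (EFin \o (fun x => w x * \1_(A i) x)).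
  have := integrableMl mB iw (measurable_indic (D := B) (mA i)).
  suff h : [bounded (\1_(A i) x : R) | x in B].
    by move=> /(_ h); apply: eq_integrable.
  exists 1; split; first exact: num_real.
  move=> M M1 x _ /=; apply: le_trans (ltW M1); rewrite indicE.
  by case: (_ \in _); rewrite /= ?normr0 ?normr1 ?ler01.
transitivity (\int[mu]_(x in B) \sum_(i <- s) (w x * \1_(A i) x)).
  apply: eq_Rintegral => x; rewrite inE => Bx.
  by rewrite -mulr_sumr s1// mulr1.
rewrite (Rintegral_sum mB (F := fun i x => w x * \1_(A i) x) (s := s) (fun i _ => iA i)).2.
rewrite big_seq [RHS]big_seq; apply: eq_bigr => i /AB AiB.
have {2}-> : A i = B `&` A i by rewrite setIidr.
rewrite Rintegral_mkcondr; apply: eq_Rintegral => x _.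
by rewrite patchE indicE; case: (_ \in _); rewrite ?mulr1 ?mulr0.
Qed.

End FiniteSums.

Lemma pow2_small (R : realType) (H e : R) : 0 < e ->
  \forall m \near \oo, H / 2 ^+ m < e.
Proof.
move=> e0; exists (Num.truncn (H / e)).+1 => // m /= hm.
have p2 : 0 < (2 : R) ^+ m by exact: exprn_gt0.
rewrite ltr_pdivrMr// mulrC -ltr_pdivrMr//.
apply: (lt_le_trans (truncnS_gt _)).
rewrite -natrX ler_nat; apply: (leq_trans hm); exact/ltnW/ltn_expl.
Qed.

Section DyadicBoxes.
Context {R : realType}.
Local Notation vol := (@vol R).
Local Notation T := (R * R * R)%type.
Local Notation T3 := (measurableTypeR R * measurableTypeR R * measurableTypeR R)%type.

(** Corners are finite functions, for which equality is decidable: dyadic families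
    are then sequences of boxes in which membership makes sense. *)
Definition BX : Type := ({ffun 'I_3 -> R} * {ffun 'I_3 -> R})%type.
HB.instance Definition _ := Equality.on BX.
Implicit Types (a b c : BX) (s : seq BX).

Definition bset b : set T := box b.1 b.2.
Definition wf b := forall j, b.1 j < b.2 j.
Definition vb b : R := \prod_(j < 3) (b.2 j - b.1 j).
Definition mid b j : R := (b.1 j + b.2 j) / 2.
Definition upd (g : {ffun 'I_3 -> R}) j v : {ffun 'I_3 -> R} :=
  [ffun i => if i == j then v else g i].
Definition lowh j b : BX := (b.1, upd b.2 j (mid b j)).
Definition uph j b : BX := (upd b.1 j (mid b j), b.2).
Definition halves j b : seq BX := [:: lowh j b; uph j b].
Definition kids b : seq BX :=
  flatten (map (halves j2) (flatten (map (halves j1) (halves j0 b)))).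
(** The $8^m$ boxes obtained from [b] by [m] dyadic subdivisions. *)
Fixpoint leaves m b : seq BX :=
  if m is m'.+1 then flatten (map (leaves m') (kids b)) else [:: b].
(** The half-open boxes of [s] are a partition of [b]. *)
Definition parts s b := forall x, \sum_(c <- s) \1_(bset c) x = \1_(bset b) x :> R.

Lemma leavesS m b : leaves m.+1 b = flatten (map (leaves m) (kids b)).
Proof. by []. Qed.

Lemma bset_lowh j b x : wf b ->
  bset (lowh j b) x <-> bset b x /\ crd j x <= mid b j.
Proof.
move=> wb; have mb : mid b j < b.2 j by rewrite /mid; have := wb j; lra.
split=> [h|[h1 h2] i].
  split; last by have := h j; rewrite /= ffunE eqxx => -[].
  move=> i; have := h i; rewrite /= ffunE; case: eqP => [->|//] [? ?].
  by split=> //; lra.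
by have := h1 i; rewrite /= ffunE; case: eqP => [->|//] [? ?].
Qed.

Lemma bset_uph j b x : wf b ->
  bset (uph j b) x <-> bset b x /\ mid b j < crd j x.
Proof.
move=> wb; have mb : b.1 j < mid b j by rewrite /mid; have := wb j; lra.
split=> [h|[h1 h2] i].
  split; last by have := h j; rewrite /= ffunE eqxx => -[].
  move=> i; have := h i; rewrite /= ffunE; case: eqP => [->|//] [? ?].
  by split=> //; lra.
by have := h1 i; rewrite /= ffunE; case: eqP => [->|//] [? ?].
Qed.

Lemma parts_halves j b : wf b -> parts (halves j b) b.
Proof.
move=> wb x; rewrite /halves !big_cons big_nil addr0 !indicE.
have [bx|nbx] := pselect (bset b x); last first.
  rewrite !memNset ?addr0//; first by move/(bset_uph _ _ wb) => [].
  by move/(bset_lowh _ _ wb) => [].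
rewrite [in RHS]mem_set//; have [h|h] := leP (crd j x) (mid b j).
  rewrite mem_set ?memNset ?addr0//; last exact/bset_lowh.
  by move/(bset_uph _ _ wb) => [_]; rewrite ltNge h.
rewrite memNset ?mem_set ?add0r//; first exact/bset_uph.
by move/(bset_lowh _ _ wb) => [_]; rewrite leNgt h.
Qed.

Lemma wf_halves j b c : wf b -> c \in halves j b -> wf c.
Proof.
move=> wb; rewrite !inE => /orP[] /eqP -> i; rewrite /= ffunE;
  case: eqP => // ->; rewrite /mid; have := wb j; lra.
Qed.

Lemma vb_halves j b c : c \in halves j b -> vb c = vb b / 2.
Proof.
rewrite !inE => /orP[] /eqP ->; rewrite /vb (bigD1 j)//= [in RHS](bigD1 j)//=;
  rewrite ffunE eqxx /mid mulrAC; congr (_ * _).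
- by field.
- by apply: eq_bigr => i /negPf ij; rewrite ffunE ij.
- by field.
- by apply: eq_bigr => i /negPf ij; rewrite ffunE ij.
Qed.

Lemma side_halves j b c i : c \in halves j b ->
  c.2 i - c.1 i = if i == j then (b.2 i - b.1 i) / 2 else b.2 i - b.1 i.
Proof.
rewrite !inE => /orP[] /eqP -> /=; rewrite !ffunE;
  by case: eqP => // ->; rewrite /mid; field.
Qed.

Lemma cbox_halves j b c : wf b -> c \in halves j b ->
  cbox c.1 c.2 `<=` cbox b.1 b.2.
Proof.
move=> wb; rewrite !inE => /orP[] /eqP -> x h i; have := h i;
  rewrite /= ffunE; case: eqP => // ->; rewrite /mid; have := wb j; lra.
Qed.

Lemma parts_flatten s b (rho : BX -> seq BX) : parts s b ->
  (forall a, a \in s -> parts (rho a) a) -> parts (flatten (map rho s)) b.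
Proof.
move=> sb h x; rewrite big_flatten big_map -sb big_seq [RHS]big_seq.
by apply: eq_bigr => a /h; exact.
Qed.

Lemma parts_sub s b c : parts s b -> c \in s -> bset c `<=` bset b.
Proof.
move=> sb cs x cx; apply: contrapT => nbx; have := sb x.
rewrite [RHS]indicE memNset// => /eqP.
rewrite psumr_eq0 => [/allP/(_ _ cs)|a _]; last by rewrite indicE; case: (_ \in _).
by rewrite indicE mem_set// oner_eq0.
Qed.

Lemma parts_ex s b x : parts s b -> bset b x -> exists2 c, c \in s & bset c x.
Proof.
move=> sb bx; apply: contrapT => h; have := sb x.
rewrite [RHS]indicE mem_set// big_seq big1 ?eq_sym => [/eqP|c cs].
  by rewrite eq_sym oner_eq0.
by rewrite indicE memNset// => cx; apply: h; exists c.
Qed.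

Lemma parts_eval s b c x (g : BX -> R) : parts s b -> c \in s -> bset c x ->
  (forall a, a \in s -> ~ bset a x -> g a = 0) -> \sum_(a <- s) g a = g c.
Proof.
move=> /(_ x) sb.
have {sb} : \sum_(a <- s) \1_(bset a) x <= 1 :> R.
  by rewrite sb indicE; case: (_ \in _).
move=> + + cx; elim: s => // a s ih; rewrite !big_cons inE.
have s0 : 0 <= \sum_(a <- s) \1_(bset a) x :> R.
  by apply: sumr_ge0 => i _; rewrite indicE; case: (_ \in _).
have [ax|nax] := pselect (bset a x) => + + g0.
  rewrite indicE mem_set//= => s1.
  have /eqP : \sum_(a <- s) \1_(bset a) x = 0 :> R by move: s0 s1; set S := \sum_(_ <- _) _; lra.
  rewrite psumr_eq0 => [/allP sx|i _]; last by rewrite indicE; case: (_ \in _).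
  have nx i : i \in s -> ~ bset i x.
    by move=> /sx /=; rewrite indicE => + ix; rewrite mem_set// oner_eq0.
  case/orP => [/eqP ->|/nx//].
  rewrite big_seq big1 ?addr0// => i iS; apply: g0; last exact: nx.
  by rewrite inE iS orbT.
rewrite indicE memNset// add0r => s1 /orP[/eqP ca|cs].
  by move: nax; rewrite -ca.
rewrite g0 ?mem_head// add0r; apply: ih => // i iS; apply: g0.
by rewrite inE iS orbT.
Qed.

Lemma kidsP b c : wf b -> c \in kids b ->
  [/\ wf c, (forall j, c.2 j - c.1 j = (b.2 j - b.1 j) / 2) &
     cbox c.1 c.2 `<=` cbox b.1 b.2].
Proof.
move=> wb /flattenP[_ /mapP[a2 /flattenP[_ /mapP[a1 h1 ->] h2] ->] h3].
have w1 := wf_halves wb h1; have w2 := wf_halves w1 h2.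
split; first exact: wf_halves h3.
  by apply: I3P; rewrite (side_halves _ h3) (side_halves _ h2) (side_halves _ h1).
move=> x /(cbox_halves w2 h3)/(cbox_halves w1 h2).
exact: (cbox_halves wb h1).
Qed.

Lemma parts_kids b : wf b -> parts (kids b) b.
Proof.
move=> wb; apply: parts_flatten.
  apply: parts_flatten; first exact: parts_halves.
  by move=> a ha; apply: parts_halves; exact: wf_halves ha.
move=> a /flattenP[_ /mapP[a1 h1 ->] h2]; apply: parts_halves.
exact: wf_halves (wf_halves wb h1) h2.
Qed.

Lemma parts_leaves m b : wf b -> parts (leaves m b) b.
Proof.
elim: m b => [|m ih] b wb; first by move=> x /=; rewrite big_seq1.
rewrite leavesS; apply: parts_flatten; first exact: parts_kids.
by move=> a ha; apply: ih; case: (kidsP wb ha).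
Qed.

Lemma leavesP m b c : wf b -> c \in leaves m b ->
  [/\ wf c, (forall j, c.2 j - c.1 j = (b.2 j - b.1 j) / 2 ^+ m) &
     cbox c.1 c.2 `<=` cbox b.1 b.2].
Proof.
elim: m b => [|m ih] b wb.
  by rewrite inE => /eqP ->; split => // j; rewrite expr0 divr1.
rewrite leavesS => /flattenP[_ /mapP[a ha ->] hc]; have [wa sa ca] := kidsP wb ha.
have [wc sc cc] := ih _ wa hc; split=> //; last exact: subset_trans ca.
by move=> j; rewrite sc sa exprS invfM mulrA.
Qed.

Lemma measurable_bset b : @measurable _ T3 (bset b).
Proof. exact: measurable_box. Qed.

Lemma vol_bset b : wf b -> vol (bset b) = (vb b)%:E.
Proof. by move=> wb; rewrite vol_box// => j; exact: ltW. Qed.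

Lemma vb_gt0 b : wf b -> 0 < vb b.
Proof. by move=> wb; apply: prodr_gt0 => j _; rewrite subr_gt0. Qed.

Lemma int_parts s b (w : T -> R) : parts s b ->
  vol.-integrable (bset b) (EFin \o w) ->
  \int[vol]_(x in bset b) w x = \sum_(c <- s) \int[vol]_(x in bset c) w x.
Proof.
move=> sb iw; apply: (@Rintegral_parts _ T3) => //.
- exact: measurable_bset.
- by move=> c; exact: measurable_bset.
- by move=> c; exact: parts_sub.
- by move=> x bx; rewrite sb indicE mem_set.
Qed.

End DyadicBoxes.


(** * Dyadic conditional expectations *)

Section SqSubset.
Context d (T : measurableType d) (R : realType).
Variables (mu : {measure set T -> \bar R}).

Lemma sqS (A B : set T) (u : T -> R) : measurable A -> measurable B ->
  A `<=` B -> sq mu B u -> sq mu A u.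
Proof.
move=> mA mB AB [mu_ u2]; split; first exact: measurable_funS mu_.
exact: integrableS u2.
Qed.

Lemma Rdominated_cvg (D : set T) (mD : measurable D) (fn : nat -> T -> R)
    (f g : T -> R) :
  (forall n, measurable_fun D (fn n)) -> measurable_fun D f ->
  {ae mu, forall x, D x -> fn n x @[n --> \oo] --> f x} ->
  mu.-integrable D (EFin \o g) ->
  (forall n x, D x -> `|fn n x| <= g x) ->
  \int[mu]_(x in D) fn n x @[n --> \oo] --> \int[mu]_(x in D) f x.
Proof.
move=> mfn mf cv ig fg.
have cvE : {ae mu, forall x, D x -> (fn n x)%:E @[n --> \oo] --> (f x)%:E}.
  by apply: filterS cv => x h Dx; apply: cvg_EFinS; exact: h.
have [iF _ h] := @dominated_convergence _ T R mu D mD (fun n x => (fn n x)%:E)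
  (fun x => (f x)%:E) (EFin \o g)
  (fun n => proj2 (measurable_EFinP _ _) (mfn n)) (proj2 (measurable_EFinP _ _) mf)
  cvE ig
  (aeW _ (fun x n Dx => fg n x Dx)).
apply: fine_cvg; rewrite fineK; first exact: h.
exact: integrable_fin_num.
Qed.

End SqSubset.

Section DyadicDensity.
Context {R : realType}.
Local Notation vol := (@vol R).
Local Notation T := (R * R * R)%type.
Local Notation T3 := (measurableTypeR R * measurableTypeR R * measurableTypeR R)%type.
Local Notation BX := (@BX R).
Implicit Types (a b c : BX) (s : seq BX) (u v w : T -> R).
Local Notation sqb b := (@sq _ T3 R vol (bset b)).
Local Notation ipb b := (@ip _ T3 R vol (bset b)).

Let mb b := measurable_bset b.

Lemma bset_fin b : (vol (bset b) < +oo)%E.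
Proof. exact: vol_box_fin. Qed.

Lemma sqb_sub b c u : bset c `<=` bset b -> sqb b u -> sqb c u.
Proof. by move=> cb; exact: (sqS (mb c) (mb b) cb). Qed.

Lemma sqb_int b u : sqb b u -> vol.-integrable (bset b) (EFin \o u).
Proof. exact: (sq_L1 (mb b) (bset_fin b)). Qed.

Lemma sqb_indic b c : sqb b (\1_(bset c)).
Proof. exact: (sq_indic (mb b) (bset_fin b) (mb c)). Qed.

Lemma ipb_indic b c u : bset c `<=` bset b ->
  ipb b u (\1_(bset c)) = \int[vol]_(x in bset c) u x.
Proof.
move=> cb; have {2}-> : bset c = bset b `&` bset c by rewrite setIidr.
rewrite Rintegral_mkcondr; apply: eq_Rintegral => x _.
by rewrite patchE indicE; case: (_ \in _); rewrite ?mulr1 ?mulr0.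
Qed.

Definition pt (g : {ffun 'I_3 -> R}) : T := (g j0, g j1, g j2).

Lemma crd_pt g j : crd j (pt g) = g j.
Proof. by move: j; apply: I3P. Qed.

(** The lower corners of the dyadic boxes around a point increase to the point,
    so the indicator function of any box, being left-continuous in each
    variable, is a bounded pointwise limit of dyadic step functions. *)
Lemma leaves_eq0 b w : wf b -> sqb b w ->
  (forall m c, c \in leaves m b -> \int[vol]_(x in bset c) w x = 0) ->
  w = (fun=> 0) %[ae vol in bset b].
Proof.
move=> wb sw w0; apply: box_integral_eq0; first exact: sqb_int.
move=> lo' hi' Bb; set B := box lo' hi'.
(* The indicator function of [B], sampled at the lower corners of dyadic boxes. *)
pose sm m x := \sum_(c <- leaves m b) (\1_B (pt c.1) * \1_(bset c) x) : R.
have iw := sqb_int sw.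
have mB : @measurable _ T3 B by exact: measurable_box.
have smE m x c : bset b x -> c \in leaves m b -> bset c x -> sm m x = \1_B (pt c.1).
  move=> bx cl cx; rewrite /sm (parts_eval (parts_leaves m wb) cl cx) //=.
    by rewrite [X in _ * X]indicE mem_set// mulr1.
  by move=> a al nax; rewrite [X in _ * X]indicE memNset// mulr0.
have msm m : @measurable_fun _ _ T3 R (bset b) (sm m).
  have := @sq_sum _ T3 R vol _ (mb b) _ (leaves m b)
    (fun c x => \1_B (pt c.1) * \1_(bset c) x : R).
  by move=> h; apply: (proj1 (h _)) => c; apply: sqZ => //; exact: sqb_indic.
have int0 m : \int[vol]_(x in bset b) (w x * sm m x) = 0.
  transitivity (ipb b w (sm m)) => //.
  rewrite ipC /sm ip_suml//; last first.
    by move=> c; apply: sqZ => //; exact: sqb_indic.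
  rewrite big_seq big1// => c cl; rewrite ipZl//; last exact: sqb_indic.
  rewrite ipC ipb_indic; last exact: parts_sub (parts_leaves m wb) cl.
  by rewrite (w0 m)// mulr0.
have lim x : bset b x -> \forall m \near \oo, sm m x = \1_B x.
  move=> bx.
  have leafx m := parts_ex (parts_leaves m wb) bx.
  have [Bx|nBx] := pselect (B x).
    have nr j : \forall m \near \oo, (b.2 j - b.1 j) / 2 ^+ m < crd j x - lo' j.
      by apply: pow2_small; have := Bx j; lra.
    near=> m; have [c cl cx] := leafx m; rewrite (smE m x c)//.
    rewrite !indicE !mem_set// => j; rewrite crd_pt.
    have [_ sc _] := leavesP wb cl.
    have := sc j; have := cx j; have := Bx j.
    have : (b.2 j - b.1 j) / 2 ^+ m < crd j x - lo' j.
      by move: j; apply: I3P; near: m; exact: nr.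
    lra.
  have [j nj] : exists j, ~ (lo' j < crd j x /\ crd j x <= hi' j).
    by apply/existsNP.
  have [h|h] := leP (crd j x) (lo' j).
    near=> m; have [c cl cx] := leafx m; rewrite (smE m x c)//.
    rewrite !indicE !memNset// => /(_ j); rewrite crd_pt => -[l _].
    by have := cx j; lra.
  have {}h : hi' j < crd j x by rewrite ltNge; apply/negP => ?; apply: nj.
  have nr : \forall m \near \oo, (b.2 j - b.1 j) / 2 ^+ m < crd j x - hi' j.
    by apply: pow2_small; lra.
  near=> m; have [c cl cx] := leafx m; rewrite (smE m x c)//.
  rewrite !indicE !memNset// => /(_ j); rewrite crd_pt => -[l hh].
  have [_ sc _] := leavesP wb cl.
  have := sc j; have := cx j.
  have : (b.2 j - b.1 j) / 2 ^+ m < crd j x - hi' j by near: m.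
  lra.
have dc : \int[vol]_(x in bset b) (w x * sm m x) @[m --> \oo] -->
    \int[vol]_(x in bset b) (w x * \1_B x).
  apply: (@Rdominated_cvg _ T3 R vol _ (mb b) _ _ (fun x => `|w x|)).
  - by move=> m; apply: measurable_funM; [exact: sw.1|exact: msm].
  - by apply: measurable_funM; [exact: sw.1|exact: measurable_indic].
  - apply: aeW => x bx; apply: cvgM; first exact: cvg_cst.
    by apply: cvg_near_cst; exact: lim.
  - exact: integrable_norm.
  - move=> m x bx; have [c cl cx] := parts_ex (parts_leaves m wb) bx.
    rewrite (smE m x c)// normrM indicE.
    by case: (_ \in _); rewrite /= ?normr1 ?mulr1 ?normr0 ?mulr0.
have <- : \int[vol]_(x in bset b) (w x * \1_B x) = \int[vol]_(x in B) w x.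
  have {2}-> : B = bset b `&` B by rewrite setIidr.
  rewrite Rintegral_mkcondr; apply: eq_Rintegral => x _.
  by rewrite patchE indicE; case: (_ \in _); rewrite ?mulr1 ?mulr0.
move: dc; rewrite (_ : (fun m => \int[vol]_(x in bset b) (w x * sm m x)) = (fun=> 0)).
  by move=> dc; apply: (cvg_unique _ dc); [exact: norm_hausdorff|exact: cvg_cst].
exact/funext.
Unshelve. all: by end_near. Qed.

Definition avg b u : R := (\int[vol]_(x in bset b) u x) / vb b.

(** Conditional expectation of [u] on the [m]-th dyadic partition of [b]. *)
Definition Edy m b u x : R := \sum_(c <- leaves m b) avg c u * \1_(bset c) x.

Lemma Edy_sq m a b u : sqb b (Edy m a u).
Proof.
by apply: sq_sum => // c; apply: sqZ => //; exact: sqb_indic.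
Qed.

Lemma Edy_kid m b c u x : wf b -> c \in kids b -> bset c x ->
  Edy m.+1 b u x = Edy m c u x.
Proof.
move=> wb ck cx; rewrite /Edy leavesS big_flatten big_map.
rewrite (parts_eval (parts_kids wb) ck cx)// => a ak nax.
have [wa _ _] := kidsP wb ak.
rewrite big_seq big1// => i il; rewrite indicE memNset ?mulr0// => ix; apply: nax.
exact: (parts_sub (parts_leaves m wa) il).
Qed.

Lemma int_leaf_Edy m b c u : wf b -> sqb b u -> c \in leaves m b ->
  forall n, (m <= n)%N ->
  \int[vol]_(x in bset c) Edy n b u x = \int[vol]_(x in bset c) u x.
Proof.
elim: m b => [|m ih] b wb sb.
  rewrite inE => /eqP -> n _; have wp := parts_leaves n wb.
  rewrite (int_parts wp (sqb_int sb)).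
  transitivity (ipb b (Edy n b u) (\1_(bset b))).
    by rewrite ipb_indic.
  rewrite ip_suml//; [|by move=> a; apply: sqZ => //; exact: sqb_indic|exact: sqb_indic].
  rewrite big_seq [RHS]big_seq; apply: eq_bigr => a al.
  have ab := parts_sub wp al; have [wa _ _] := leavesP wb al.
  rewrite ipZl//; [|exact: sqb_indic|exact: sqb_indic].
  rewrite ipb_indic// (_ : \int[vol]_(x in bset b) \1_(bset a) x = vb a); last first.
    rewrite /Rintegral integral_indic; [|exact: mb|exact: mb].
    rewrite setIidl; last exact: ab.
    by rewrite vol_bset.
  by rewrite /avg divfK// gt_eqF// vb_gt0.
rewrite leavesS => /flattenP[_ /mapP[a ak ->] ca] [//|n]; rewrite ltnS => mn.
have [wa _ _] := kidsP wb ak.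
have ab := parts_sub (parts_kids wb) ak.
rewrite -(ih a wa (sqb_sub ab sb) ca n mn).
apply: eq_Rintegral => x; rewrite inE => cx; apply: Edy_kid => //.
exact: (parts_sub (parts_leaves m wa) ca).
Qed.

Lemma ip_Edy m k b u : wf b -> sqb b u ->
  ipb b (Edy (m + k) b u) (Edy m b u) = ipb b u (Edy m b u).
Proof.
move=> wb sb; rewrite ![ipb b _ (Edy m b u)]ipC.
have sE c : sqb b (fun x => avg c u * \1_(bset c) x).
  by apply: sqZ => //; exact: sqb_indic.
have sI c := sqb_indic b c; have sEk := Edy_sq (m + k) b b u.
rewrite !ip_suml//.
rewrite big_seq [RHS]big_seq; apply: eq_bigr => c cl.
have cb := parts_sub (parts_leaves m wb) cl.
rewrite !ipZl//.
rewrite [ipb b _ (Edy (m + k) b u)]ipC [ipb b _ u]ipC !ipb_indic// (int_leaf_Edy wb sb cl)//.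
exact: leq_addr.
Qed.

(** The squared norm of the conditional expectation, by orthogonality of projection. *)
Definition Sdy m b u : R := ipb b u (Edy m b u).

Lemma Sdy_sqr m k b u : wf b -> sqb b u ->
  ipb b (fun x => Edy (m + k) b u x - Edy m b u x)
        (fun x => Edy (m + k) b u x - Edy m b u x) =
  Sdy (m + k) b u - Sdy m b u.
Proof.
move=> wb sb; rewrite ip_sqrB//; [|exact: Edy_sq|exact: Edy_sq].
have e1 := ip_Edy (m + k) 0 wb sb; rewrite addn0 in e1.
have e2 := ip_Edy m 0 wb sb; rewrite addn0 in e2.
rewrite e1 e2 ip_Edy// /Sdy; ring.
Qed.

Lemma Sdy_le m b u : wf b -> sqb b u -> Sdy m b u <= ipb b u u.
Proof.
move=> wb sb.
have := ip_ge0 vol (bset b) (fun x => u x - Edy m b u x).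
rewrite ip_sqrB//; last exact: Edy_sq.
have e2 := ip_Edy m 0 wb sb; rewrite addn0 in e2.
by rewrite e2 /Sdy; lra.
Qed.

(** $L^2$ martingale convergence: the conditional expectations are Cauchy by
    orthogonality of increments, and their limit has the same integral as [u]
    over each dyadic box. *)
Lemma Sdy_cvg b u : wf b -> sqb b u -> Sdy m b u @[m --> \oo] --> ipb b u u.
Proof.
move=> wb sb.
have ndS : {homo (fun m => Sdy m b u) : m n / (m <= n)%N >-> m <= n}.
  move=> m n mn; rewrite -subr_ge0 -(subnKC mn) -Sdy_sqr//.
  exact: (ip_ge0 vol (bset b)).
have ubS : has_ubound (range (fun m => Sdy m b u)).
  by exists (ipb b u u) => _ [m _ <-]; exact: Sdy_le.
have cS := nondecreasing_is_cvgn ndS ubS.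
have [v sv hv] : exists2 v, sqb b v &
    ipb b (fun x => Edy m b u x - v x) (fun x => Edy m b u x - v x)
    @[m --> \oo] --> (0 : R).
  apply: sq_complete; [exact: mb|exact: bset_fin|by move=> m; exact: Edy_sq|].
  move=> e e0.
  have [m0 _ hm0] : \forall m \near \oo, `|limn (fun m => Sdy m b u) - Sdy m b u| <= e / 2.
    by move/cvgrPdist_le : cS; apply; lra.
  have key m n : (m0 <= m)%N -> (m <= n)%N ->
      ipb b (fun x => Edy n b u x - Edy m b u x)
            (fun x => Edy n b u x - Edy m b u x) <= e.
    move=> m0m mn; rewrite -(subnKC mn) Sdy_sqr// (subnKC mn).
    have := hm0 m m0m; have := hm0 n (leq_trans m0m mn).
    by rewrite /= !ler_norml => /andP[? ?] /andP[? ?]; lra.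
  exists m0 => n m m0n m0m; have [mn|/ltnW nm] := leqP m n; first exact: key.
  by rewrite ip_sqr_sym; exact: key.
have uv : (fun x => u x - v x) = (fun=> 0) %[ae vol in bset b].
  apply: leaves_eq0 => //; first exact: sqB.
  move=> m c cl; have cb := parts_sub (parts_leaves m wb) cl.
  rewrite RintegralB; [|exact: mb|exact/sqb_int/(sqb_sub cb)|exact/sqb_int/(sqb_sub cb)].
  apply/eqP; rewrite subr_eq0; apply/eqP.
  have h := cvg_ipr (mb b) (fun m => Edy_sq m b b u) sv hv (sqb_indic b c).
  rewrite ipb_indic// in h.
  apply: (cvg_unique _ _ h); first exact: norm_hausdorff.
  apply: cvg_near_cst; exists m => // n /= mn.
  by rewrite ipb_indic//; exact: int_leaf_Edy wb sb cl n mn.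
have h := cvg_ipr (mb b) (fun m => Edy_sq m b b u) sv hv sb.
have -> : ipb b u u = ipb b v u.
  apply: eq_ae_ip => //; last exact: aeW.
  by move: uv; apply: filterS => x h' bx; have /eqP := h' bx; rewrite subr_eq0 => /eqP.
rewrite (_ : (fun m => Sdy m b u) = (fun m => ipb b (Edy m b u) u)) //.
by apply/funext => m; rewrite /Sdy ipC.
Qed.

End DyadicDensity.


(** * Smooth functions of one variable *)

Section Smooth1D.
Context {R : realType}.
Implicit Types (a b : R -> R) (t : R).

(** Class $C^k$ in one variable. The derivative is a witness instead of the total
    derivative operator, so that closure properties only combine derivation rules. *)
Fixpoint Sm (k : nat) a : Prop :=
  if k is k'.+1 then
    exists2 a', (forall t, is_derive t (1 : R) a (a' t)) & Sm k' a'
  else continuous a.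

Lemma is_derive_continuous a (a' : R -> R) :
  (forall t, is_derive t (1 : R) a (a' t)) -> continuous a.
Proof.
move=> h t; apply: differentiable_continuous; apply/derivable1_diffP.
by case: (h t).
Qed.

Lemma SmS k a : Sm k.+1 a -> Sm k a.
Proof.
elim: k a => [|k ih] a [a' ha' sa']; first exact: is_derive_continuous ha'.
by exists a' => //; exact: ih.
Qed.

Lemma Sm_continuous k a : Sm k a -> continuous a.
Proof. by elim: k => // k ih /SmS. Qed.

Lemma SmD k a b : Sm k a -> Sm k b -> Sm k (fun t => a t + b t).
Proof.
elim: k a b => [|k ih] a b.
  by move=> ca cb t; apply: cvgD; [exact: ca|exact: cb].
move=> [a' da sa] [b' db sb]; exists (fun t => a' t + b' t); last exact: ih.
by move=> t; apply: is_deriveD.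
Qed.

Lemma SmZ k (c : R) a : Sm k a -> Sm k (fun t => c * a t).
Proof.
elim: k a => [|k ih] a.
  by move=> ca t; apply: cvgM; [exact: cvg_cst|exact: ca].
move=> [a' da sa]; exists (fun t => c * a' t); last exact: ih.
by move=> t; apply: is_deriveZ.
Qed.

Lemma SmM k a b : Sm k a -> Sm k b -> Sm k (fun t => a t * b t).
Proof.
elim: k a b => [|k ih] a b.
  by move=> ca cb t; apply: cvgM; [exact: ca|exact: cb].
move=> ha hb; have sa0 := SmS ha; have sb0 := SmS hb.
case: ha hb => [a' da sa] [b' db sb].
exists (fun t => a t * b' t + b t * a' t); last by apply: SmD; exact: ih.
by move=> t; exact: is_deriveM.
Qed.

Lemma Sm_aff k (c e : R) a : Sm k a -> Sm k (fun t => a (c * t + e)).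
Proof.
elim: k a => [|k ih] a.
  move=> ca t; apply: continuous_comp; last exact: ca.
  by apply: cvgD; [apply: cvgM; [exact: cvg_cst|exact: cvg_id]|exact: cvg_cst].
move=> [a' da sa]; exists (fun t => c * a' (c * t + e)).
  move=> t; rewrite mulrC.
  have haff : is_derive t (1 : R) (fun t => c * t + e) c.
    rewrite -[X in is_derive _ _ _ X]addr0 -[X in X + _]mulr1.
    apply: is_deriveD; exact: is_deriveZ.
  exact: (is_derive1_comp (da _)).
by apply: SmZ; exact: ih.
Qed.

(** The functions $t^{-n}e^{-1/t}$ on the positive half-line: this family is
    closed under differentiation up to linear combinations. *)
Definition gexp (n : nat) t : R := if 0 < t then t^-1 ^+ n * expR (- t^-1) else 0.

(** Because $e^s \ge s^{n+2}/(n+2)!$ at $s = 1/t$. The quadratic decay makes every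
    member of the family differentiable at $0$, with derivative $0$. *)
Lemma gexp_le n t : `|gexp n t| <= (n.+2)`!%:R * t ^+ 2.
Proof.
rewrite /gexp; case: ltP => t0; last first.
  by rewrite normr0 mulr_ge0 ?sqr_ge0.
have s0 : 0 < t^-1 by rewrite invr_gt0.
rewrite ger0_norm ?mulr_ge0 ?exprn_ge0 ?expR_ge0 ?(ltW s0)//.
have h : t^-1 ^+ n.+2 / (n.+2)`!%:R <= expR t^-1.
  by apply: le_trans (expR_ge1Dxn n.+1 (ltW s0)); rewrite lerDr.
have f0 : 0 < (n.+2)`!%:R :> R by rewrite ltr0n fact_gt0.
rewrite expRN ler_pdivrMr ?expR_gt0//.
rewrite ler_pdivrMr// in h.
have -> : t^-1 ^+ n = t^-1 ^+ n.+2 * t ^+ 2.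
  by rewrite -addn2 exprD -mulrA -exprMn mulVf ?gt_eqF// expr1n mulr1.
apply: (le_trans (ler_wpM2r (sqr_ge0 t) h)).
by rewrite le_eqVlt; apply/orP; left; apply/eqP; ring.
Qed.

Lemma gexp_derive n t :
  is_derive t (1 : R) (gexp n) (- n%:R * gexp n.+1 t + gexp n.+2 t).
Proof.
have [t0|t0|->] := ltgtP t 0.
- have -> : - n%:R * gexp n.+1 t + gexp n.+2 t = 0.
    by rewrite /gexp ltNge (ltW t0)/= mulr0 add0r.
  apply: (@near_eq_is_derive _ _ _ (fun=> 0)).
  near=> s; rewrite /gexp ifN// -leNgt; near: s.
  exact: lt_le_nbhsl.
- have -> : - n%:R * gexp n.+1 t + gexp n.+2 t =
    t^-1 ^+ n * (expR (- t^-1) * t ^- 2) + expR (- t^-1) * (n%:R * t^-1 ^+ n.-1 * (- t ^- 2)).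
    rewrite /gexp t0 -!exprVn; set u := t^-1; set E := expR _.
    by case: n => [|n] /=; rewrite !exprS ?expr0; ring.
  have near_eq : \near t, t^-1 ^+ n * expR (- t^-1) = gexp n t.
    near=> s; rewrite /gexp ifT//; near: s; exact: lt_nbhsr.
  have tn0 : t != 0 by rewrite gt_eqF.
  have dV : is_derive t (1 : R) (fun s => s^-1) (- t ^- 2).
    have dt : derivable (fun s : R => s) t 1 by exact: derivable_id.
    apply: DeriveDef; first exact: derivableV.
    rewrite (@deriveV _ _ (fun s : R => s))// derive_id.
    by rewrite /GRing.scale/= mulr1.
  have dX : is_derive t (1 : R) (fun s => s^-1 ^+ n) (n%:R * t^-1 ^+ n.-1 * (- t ^- 2)).
    have -> : (fun s : R => s^-1 ^+ n) = (fun s : R => s^-1) ^+ n.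
      by apply/funext => s; rewrite exprfctE.
    exact: (is_deriveX n dV).
  have dE : is_derive t (1 : R) (fun s => expR (- s^-1)) (expR (- t^-1) * t ^- 2).
    have dN : is_derive t (1 : R) (fun s => - s^-1) (t ^- 2).
      by rewrite -[t ^- 2]opprK; exact: is_deriveN.
    exact: (is_derive1_comp (is_derive_expR _) dN).
  apply: (near_eq_is_derive near_eq).
  exact: (is_deriveM dX dE).
- have -> : - n%:R * gexp n.+1 0 + gexp n.+2 0 = 0 by rewrite /gexp ltxx mulr0 addr0.
  have h : h^-1 *: (gexp n (h *: 1 + 0) - gexp n 0) @[h --> (0:R)^'] --> (0:R).
    rewrite {2}/gexp ltxx; apply/cvgrPdist_le => e e0.
    near=> h.
    have h0 : h != 0 by near: h; exact: nbhs_dnbhs_neq.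
    rewrite sub0r normrN subr0 addr0 /GRing.scale/= mulr1 normrM normfV.
    rewrite ler_pdivrMl ?normr_gt0//.
    apply: (le_trans (gexp_le n h)).
    rewrite -[h ^+ 2]real_normK ?num_real// expr2 mulrCA ler_wpM2l//.
    have f0 : 0 < (n.+2)`!%:R :> R by rewrite ltr0n fact_gt0.
    rewrite mulrC -ler_pdivlMr//.
    near: h; apply: dnbhs0_le; exact: divr_gt0.
  apply: DeriveDef; first by apply/cvg_ex; exists 0.
  by apply/cvg_lim => //; exact: norm_hausdorff.
Unshelve. all: by end_near. Qed.

Lemma Sm_gexp k n : Sm k (gexp n).
Proof.
elim: k n => [|k ih] n; first exact: is_derive_continuous (gexp_derive n).
by exists (fun t => - n%:R * gexp n.+1 t + gexp n.+2 t);
  [exact: gexp_derive|apply: SmD => //; exact: SmZ].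
Qed.

(** Supported in $[l, r]$, and tending to the indicator function of $]l, r[$ as
    $n$ grows. *)
Definition bump (l r : R) (n : nat) t : R :=
  gexp 0 (n.+1%:R * (t - l)) * gexp 0 (n.+1%:R * (r - t)).

Lemma gexp0_itv t : 0 <= gexp 0 t <= 1.
Proof.
rewrite /gexp; case: ltP => t0; last by rewrite lexx ler01.
by rewrite expr0 mul1r expR_ge0/= -expR0 ler_expR oppr_le0 invr_ge0 ltW.
Qed.

Lemma bump_itv l r n t : 0 <= bump l r n t <= 1.
Proof.
rewrite /bump; have /andP[a0 a1] := gexp0_itv (n.+1%:R * (t - l)).
have /andP[b0 b1] := gexp0_itv (n.+1%:R * (r - t)).
by rewrite mulr_ge0//= mulr_ile1.
Qed.

Lemma bump_out l r n t : t <= l \/ r <= t -> bump l r n t = 0.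
Proof.
have g0 s : s <= 0 -> gexp 0 s = 0 by rewrite /gexp leNgt => /negbTE ->.
move=> [h|h]; rewrite /bump.
  by rewrite [X in X * _]g0 ?mul0r// mulr_ge0_le0// subr_le0.
by rewrite [X in _ * X]g0 ?mulr0// mulr_ge0_le0// subr_le0.
Qed.

Lemma Sm_bump k l r n : Sm k (bump l r n).
Proof.
apply: SmM.
  have := Sm_aff (n.+1%:R) (- (n.+1%:R * l)) (Sm_gexp k 0).
  by congr Sm; apply/funext => t; congr gexp; ring.
have := Sm_aff (- n.+1%:R) (n.+1%:R * r) (Sm_gexp k 0).
by congr Sm; apply/funext => t; congr gexp; ring.
Qed.

Lemma gexp0_cvg t : 0 < t -> gexp 0 (n.+1%:R * t) @[n --> \oo] --> (1 : R).
Proof.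
move=> t0.
have -> : (fun n => gexp 0 (n.+1%:R * t)) = (fun n : nat => expR (- (n.+1%:R^-1 * t^-1))).
  apply/funext => n; rewrite /gexp mulr_gt0// expr0 mul1r invfM//.
rewrite -[X in _ --> X]expR0; apply: continuous_cvg; first exact: continuous_expR.
rewrite -[X in _ --> X]oppr0; apply: cvgN.
rewrite -[X in _ --> X](mul0r t^-1); apply: cvgM; last exact: cvg_cst.
exact: cvg_harmonic.
Qed.

Lemma bump_cvg l r t : bump l r n t @[n --> \oo] --> (((l < t) && (t < r))%:R : R).
Proof.
have [/andP[lt tr]|] := boolP ((l < t) && (t < r)).
  rewrite -[X in _ --> X](mulr1 1); apply: cvgM; apply: gexp0_cvg; lra.
rewrite negb_and -!leNgt => /orP h.
apply: cvg_near_cst; apply: nearW => n; exact: bump_out.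
Qed.

Lemma MVT_le (A A' : R -> R) (s t M : R) : s <= t ->
  (forall u, is_derive u (1 : R) A (A' u)) -> (forall u, s < u < t -> `|A' u| <= M) ->
  `|A t - A s| <= M * (t - s).
Proof.
rewrite le_eqVlt => /predU1P[->|st] dA AM; first by rewrite !subrr normr0 mulr0.
have cA := is_derive_continuous dA.
have [u] := MVT st (fun u _ => dA u) (continuous_subspaceT cA).
rewrite in_itv/= => ust ->; rewrite normrM [`|t - s|]ger0_norm ?subr_ge0 ?(ltW st)//.
by rewrite ler_wpM2r ?subr_ge0 ?(ltW st)//; exact: AM.
Qed.

(** The fundamental theorem of calculus, with the constant fixed on the left of the
    support; smooth cut-offs are built as antiderivatives of bumps. *)
Lemma antiderivative (a : R -> R) (l r : R) : continuous a ->
  (forall t, t <= l \/ r <= t -> a t = 0) ->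
  exists B : R -> R, [/\ forall t, is_derive t (1 : R) B (a t),
    forall t, t <= l -> B t = 0 & forall t, r <= t -> B t = B r].
Proof.
move=> ca a0.
have ia : (@lebesgue_measure R).-integrable setT (EFin \o a).
  have h : (@lebesgue_measure R).-integrable `[l, r] (EFin \o a).
    apply: continuous_compact_integrable; first exact: segment_compact.
    exact: continuous_subspaceT.
  have := (integrable_mkcond (mu := @lebesgue_measure R) (EFin \o a) (measurable_itv `[l, r])).1 h.
  apply: eq_integrable => // t _; rewrite patchE; case: ifPn => //.
  rewrite notin_setE /= in_itv/= => /negP; rewrite negb_and -!ltNge => /orP.
  by case=> /ltW ?; rewrite /= a0//; [left|right].
have iS (D : set R) : measurable D -> (@lebesgue_measure R).-integrable D (EFin \o a).
  by move=> mD; exact: integrableS ia.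
pose B t := \int[@lebesgue_measure R]_(s in `]-oo, t]) a s.
have dB t : is_derive t (1 : R) B (a t).
  have [d1 d2] := @continuous_FTC1 R a -oo%O t (t + 1) ltac:(by rewrite ltrDl)
    (iS _ (measurable_itv _)) ltac:(by rewrite ltNyr) (ca t).
  by apply: DeriveDef => //; rewrite -d2 derive1E.
exists B; split=> // t tl.
  transitivity (\int[@lebesgue_measure R]_(s in `]-oo, t]) cst 0 s).
    apply: eq_Rintegral => s; rewrite inE/= in_itv/= => st.
    by apply: a0; left; exact: le_trans tl.
  by rewrite Rintegral_cst ?mul0r//; exact: measurable_itv.
have := MVT_le (M := 0) tl dB; rewrite mul0r normr_le0 subr_eq0 => h.
apply/eqP/h => u /andP[ru _]; rewrite a0 ?normr0//; right; exact: ltW.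
Qed.

(** Smooth approximations of the tent function on $[l, r]$, whose derivatives
    tend to $1$ on the left half and to $-1$ on the right half. *)
Lemma smooth_tents (l r : R) : l < r ->
  exists A A' : nat -> R -> R,
  [/\ forall n k, Sm k (A n), forall n t, is_derive t (1 : R) (A n) (A' n t),
      forall n t, t <= l \/ r <= t -> A n t = 0,
      forall n t, `|A n t| <= r - l &
      [/\ forall n t, `|A' n t| <= 1, forall n t, t <= l \/ r <= t -> A' n t = 0 &
      forall t, A' n t @[n --> \oo] -->
       (((l < t) && (t < (l + r) / 2))%:R - (((l + r) / 2 < t) && (t < r))%:R : R)]].
Proof.
move=> lr; set m := (l + r) / 2.
have bc n : continuous (bump l m n) by exact: Sm_continuous (Sm_bump 0 l m n).
have [B hB] := choice (fun n => antiderivative (bc n) (@bump_out l m n)).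
(* The bump on the right half is a translate of the one on the left half, so the
   difference of an antiderivative and its translate vanishes on both sides. *)
have bE n t : bump l m n (t - (m - l)) = bump m r n t.
  by rewrite /bump /m; congr (gexp 0 (_ * _) * gexp 0 (_ * _)); field.
pose A n t := B n t - B n (t - (m - l)).
pose A' n t := bump l m n t - bump m r n t.
have dA n t : is_derive t (1 : R) (A n) (A' n t).
  have [dB _ _] := hB n.
  have daff : is_derive t (1 : R) (fun t => t - (m - l)) 1.
    rewrite -[X in is_derive _ _ _ X]subr0.
    exact: (is_deriveB (is_derive_id _ _) (is_derive_cst _ _ _)).
  have d2 : is_derive t (1 : R) (fun t => B n (t - (m - l))) (bump m r n t).
    rewrite -bE -[X in is_derive _ _ _ X]mulr1.
    exact: (is_derive1_comp (dB _) daff).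
  exact: (is_deriveB (dB t) d2).
have A'1 n t : `|A' n t| <= 1.
  have := bump_itv l m n t; have := bump_itv m r n t.
  by rewrite /A' ler_norml => /andP[? ?] /andP[? ?]; apply/andP; split; lra.
have A0 n t : t <= l \/ r <= t -> A n t = 0.
  have [_ B0 Bc] := hB n.
  move=> [tl|rt]; rewrite /A.
    rewrite !B0 ?subrr//; rewrite /m; lra.
  by rewrite !Bc ?subrr//; rewrite /m; lra.
exists A, A'; split => //.
- move=> n [|k]; first exact: is_derive_continuous (dA n).
  exists (A' n) => //.
  apply: SmD; first exact: Sm_bump.
  have := SmZ (-1) (Sm_bump k m r n).
  by congr Sm; apply/funext => t; rewrite mulN1r.
- move=> n t; have [h|] := pselect (t <= l \/ r <= t).
    by rewrite A0// normr0 subr_ge0 ltW.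
  move=> /not_orP[/negP + /negP]; rewrite -!ltNge => lt tr.
  have := MVT_le (M := 1) (ltW lt) (dA n) (fun u _ => A'1 n u).
  rewrite (A0 n l) ?subr0; last by left.
  by move=> h; apply: (le_trans h); lra.
- split=> // [n t h|t]; last by apply: cvgB; exact: bump_cvg.
  by rewrite /A' !bump_out ?subrr//; rewrite /m; case: h => h; [left|right|left|right]; lra.
Qed.

End Smooth1D.


(** * Tensor products of smooth functions *)

Section Tensors.
Context {R : realType}.
Local Notation vol := (@vol R).
Local Notation T := (R * R * R)%type.
Local Notation T3 := (measurableTypeR R * measurableTypeR R * measurableTypeR R)%type.
Implicit Types (a : 'I_3 -> R -> R) (x y : T) (Om : set T).

Lemma continuous_crd j : continuous (@crd R j).
Proof.
move: j; apply: I3P => x.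
- apply: (@continuous_comp _ _ _ fst fst); exact: cvg_fst.
- apply: (@continuous_comp _ _ _ fst snd); [exact: cvg_fst|exact: cvg_snd].
- exact: cvg_snd.
Qed.

Lemma crdD j x y : crd j (x + y) = crd j x + crd j y.
Proof. by move: j; apply: I3P. Qed.

Lemma crdZ j (c : R) x : crd j (c *: x) = c * crd j x.
Proof. by move: j; apply: I3P. Qed.

Lemma crd_basis i j : crd i (basis3 j : T) = (i == j)%:R.
Proof. by move: i j; apply: I3P; apply: I3P. Qed.

Lemma crd_shift i j (h : R) x : crd i (h *: (basis3 j : T) + x) = h * (i == j)%:R + crd i x.
Proof. by rewrite crdD crdZ crd_basis. Qed.

Lemma is_derive_crd i j (al al' : R -> R) x :
  (forall t, is_derive t (1 : R) al (al' t)) ->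
  is_derive x (basis3 j : T) (fun y => al (crd i y)) ((i == j)%:R * al' (crd i x)).
Proof.
move=> dal.
have h : h^-1 *: (al (crd i (h *: (basis3 j : T) + x)) - al (crd i x)) @[h --> (0:R)^'] -->
    (i == j)%:R * al' (crd i x).
  case: (eqVneq i j) => [<-|ij].
    have [dd vd] := dal (crd i x); rewrite mul1r -vd.
    rewrite (_ : (fun h : R => _) = (fun h : R => h^-1 *: (al (h *: 1 + crd i x) - al (crd i x)))).
      exact: dd.
    by apply/funext => h; rewrite crd_shift eqxx.
  rewrite mul0r (_ : (fun h : R => _) = (fun=> 0)); first exact: cvg_cst.
  by apply/funext => h; rewrite crd_shift (negbTE ij) mulr0 add0r subrr scaler0.
apply: DeriveDef; first by apply/cvg_ex; eexists; exact: h.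
by apply/cvg_lim => //; exact: norm_hausdorff.
Qed.

Definition tens a x : R := a j0 (crd j0 x) * a j1 (crd j1 x) * a j2 (crd j2 x).

Definition subst1 a j (b : R -> R) i : R -> R := if i == j then b else a i.

Lemma is_derive_tens a (a' : R -> R) j x :
  (forall i t, exists d, is_derive t (1 : R) (a i) d) ->
  (forall t, is_derive t (1 : R) (a j) (a' t)) ->
  is_derive x (basis3 j : T) (tens a) (tens (subst1 a j a') x).
Proof.
move=> da daj.
have [b hb] : exists b : 'I_3 -> R -> R, (forall i t, is_derive t (1 : R) (a i) (b i t)) /\ b j = a'.
  have e i : exists b : R -> R, forall t, is_derive t (1 : R) (a i) (b t).
    by have [b hb] := choice (da i); exists b.
  have [b hb] := choice e.
  exists (subst1 b j a'); split; last by rewrite /subst1 eqxx.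
  by move=> i t; rewrite /subst1; case: eqP => [->|_]; [exact: daj|exact: hb].
case: hb => hb bj.
have d i := is_derive_crd i j x (hb i).
have := is_deriveM (is_deriveM (d j0) (d j1)) (d j2).
set D := (X in is_derive _ _ _ X); suff -> : D = tens (subst1 a j a') x by [].
rewrite /D /GRing.scale/= -bj /tens /subst1.
by clear daj d bj D; move: j; apply: I3P => /=; rewrite mulrfctE; ring.
Qed.

Lemma tens_continuous a : (forall i, continuous (a i)) -> continuous (tens a).
Proof.
move=> ca x; have h i : {for x, continuous (fun y => a i (crd i y))}.
  by apply: continuous_comp; [exact: continuous_crd|exact: ca].
by apply: cvgM; [apply: cvgM|]; exact: h.
Qed.

(** A partial derivative of a tensor product is the tensor product in which one
    factor is differentiated, so an induction on [k] over all factors closes. *)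
Lemma tens_Ck k a : (forall i, Sm k (a i)) -> Ck k setT (tens a).
Proof.
elim: k a => [|k ih] a ha.
  by split=> // x _; apply: tens_continuous => i; exact: ha.
have da i t : exists d, is_derive t (1 : R) (a i) d.
  by have [b hb _] := ha i; exists (b t).
split=> [x _|j].
  by apply: tens_continuous => i; exact: Sm_continuous (ha i).
have [a' da' sa'] := ha j.
have dt x := is_derive_tens x da da'.
split=> [x _|]; first by case: (dt x).
have -> : (fun x => 'D_(basis3 j) (tens a) x) = tens (subst1 a j a').
  by apply/funext => x; case: (dt x).
apply: ih => i; rewrite /subst1; case: eqP => // _; exact: SmS.
Qed.

Lemma cboxE (lo hi : 'I_3 -> R) :
  cbox lo hi = (`[lo j0, hi j0] `*` `[lo j1, hi j1]) `*` `[lo j2, hi j2].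
Proof.
apply/seteqP; split=> x /=; rewrite !in_itv/=.
  by move=> h; have [? ?] := h j0; have [? ?] := h j1; have [? ?] := h j2;
    split; [split|]; apply/andP.
by move=> [[/andP[? ?] /andP[? ?]] /andP[? ?]]; apply: I3P.
Qed.

Lemma compact_cbox (lo hi : 'I_3 -> R) : compact (cbox lo hi : set T).
Proof.
by rewrite cboxE; apply: compact_setX; [apply: compact_setX|]; exact: segment_compact.
Qed.

Lemma closed_cbox (lo hi : 'I_3 -> R) : closed (cbox lo hi : set T).
Proof.
by apply: compact_closed; [exact: norm_hausdorff|exact: compact_cbox].
Qed.

Lemma tens_out a (lo hi : 'I_3 -> R) x :
  (forall i t, t <= lo i \/ hi i <= t -> a i t = 0) ->
  ~ box lo hi x -> tens a x = 0.
Proof.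
move=> a0 /existsNP[i nb].
have : a i (crd i x) = 0.
  apply: a0; apply: contrapT => /not_orP[/negP + /negP]; rewrite -!ltNge => h1 h2.
  by apply: nb; split=> //; exact: ltW.
by rewrite /tens; move: i {nb}; apply: I3P => ->; rewrite ?mul0r ?mulr0 ?mul0r.
Qed.

Lemma tens_test Om a (lo hi : 'I_3 -> R) : cbox lo hi `<=` Om ->
  (forall i k, Sm k (a i)) ->
  (forall i t, t <= lo i \/ hi i <= t -> a i t = 0) ->
  test_function Om (tens a).
Proof.
move=> cO sa a0.
have sub : closure [set x | tens a x != 0] `<=` cbox lo hi.
  rewrite [X in _ `<=` X](closure_id _).1; last exact: closed_cbox.
  apply: closure_subset => x /= tx; apply: box_cbox; apply: contrapT => nb.
  by move: tx; rewrite (tens_out a0 nb) eqxx.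
split.
- by move=> k; apply: tens_Ck => i; exact: sa.
- apply: (subclosed_compact _ (@compact_cbox lo hi)) => //; exact: closed_closure.
- exact: subset_trans cO.
Qed.

End Tensors.


(** * Weak partial derivatives *)

Section WeakGradient.
Context {R : realType}.
Local Notation vol := (@vol R).
Local Notation T := (R * R * R)%type.
Local Notation T3 := (measurableTypeR R * measurableTypeR R * measurableTypeR R)%type.
Implicit Types (u v w : T -> R) (x y : T).

(** Bumps converge to the indicator function of an open box, which differs from the
    half-open one on faces. *)
Lemma hyperplane_null (j : 'I_3) (c : R) : {ae vol, forall x : T, crd j x != c}.
Proof.
pose side i : set (measurableTypeR R) := if i == j then [set c] else setT.
have ms i : measurable (side i).
  by rewrite /side; case: eqP => _; [exact: measurable_set1|exact: measurableT].
pose H : set T3 := (side j0 `*` side j1) `*` side j2.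
have mH : measurable H by apply: measurableX; [apply: measurableX|]; exact: ms.
exists H; split=> //.
  have s0 : (@lebesgue_measure R) (side j) = 0%E.
    by rewrite /side eqxx; exact: lebesgue_measure_set1.
  rewrite /H /vol/= product_measure1E; [|by apply: measurableX; exact: ms|exact: ms].
  rewrite [X in (X * _)%E]product_measure1E; [|exact: ms|exact: ms].
  move: j @side ms @H mH s0; apply: I3P => side ms H mH s0.
  - by rewrite [X in (X * _ * _)%E]s0 !mul0e.
  - by rewrite [X in (_ * X * _)%E]s0 mule0 mul0e.
  - by rewrite [X in (_ * X)%E]s0 mule0.
move=> x /= /negP; rewrite negbK => /eqP xc.
have hs i : side i (crd i x) by rewrite /side; case: eqP => [->|].
by split; [split; [exact: (hs j0)|exact: (hs j1)]|exact: (hs j2)].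
Qed.

Lemma int_supp (B D : set T) (F : T -> R) : B `<=` D ->
  (forall x, ~ B x -> F x = 0) ->
  \int[vol]_(x in D) F x = \int[vol]_(x in B) F x.
Proof.
move=> BD F0; rewrite -[in RHS](setIidr BD) Rintegral_mkcondr; apply: eq_Rintegral => x _.
by rewrite patchE; case: ifPn => //; rewrite notin_setE => /F0.
Qed.

Variable Om : set T.
Hypotheses (oO : open Om) (O_fin : (vol Om < +oo)%E).
Local Notation sqO := (@sq _ T3 R vol Om).
Local Notation ipO := (@ip _ T3 R vol Om).
Local Notation sqb b := (@sq _ T3 R vol (bset b)).
Local Notation ipb b := (@ip _ T3 R vol (bset b)).

Let mO : @measurable _ T3 Om. Proof. exact: open_measurable3. Qed.

Lemma sqO_sub b u : bset b `<=` Om -> sqO u -> sqb b u.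
Proof. by move=> cb; exact: (sqS (measurable_bset b) mO cb). Qed.

Lemma bounded_of_support (phi : T -> R) (K : set T) : continuous phi -> compact K ->
  (forall x, ~ K x -> phi x = 0) -> exists M : R, forall x, `|phi x| <= M.
Proof.
move=> cphi cK p0.
have : compact (phi @` K).
  by apply: continuous_compact => //; exact: continuous_subspaceT.
move/compact_bounded => [M [_ hM]]; exists (Num.max 0 (M + 1)) => x.
have [Kx|/p0 ->] := pselect (K x); last by rewrite normr0 le_max lexx.
by rewrite le_max; apply/orP; right; apply: hM; [lra|exists x].
Qed.

Lemma test_sq phi j : test_function Om phi ->
  sqO phi /\ sqO (fun x => 'D_(basis3 j) phi x).
Proof.
move=> [smooth cK KO]; set K := closure _ in cK KO.
have [c0 d0] := smooth 1%N; have [_ [c1 _]] := d0 j.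
have p0 x : ~ K x -> phi x = 0.
  by move=> nK; apply: contrapT => /eqP h; apply: nK; exact: subset_closure.
have p1 x : ~ K x -> 'D_(basis3 j) phi x = 0.
  move=> nK; rewrite (_ : 'D_(basis3 j) phi x = 'D_(basis3 j) (cst 0 : T -> R) x).
    exact: derive_cst.
  apply: near_eq_derive.
  have : nbhs x (~` K).
    by apply: open_nbhs_nbhs; split=> //; apply: closed_openC; exact: closed_closure.
  by apply: filterS => y /p0 ->.
have cphi : continuous phi by move=> x; exact: c0.
have cD : continuous (fun x => 'D_(basis3 j) phi x) by move=> x; exact: c1.
have [M hM] := bounded_of_support cphi cK p0.
have [M' hM'] := bounded_of_support cD cK p1.
split.
  apply: (@sq_bounded _ T3 R vol Om mO phi M) => //.
  exact: continuous_measurable3.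
apply: (@sq_bounded _ T3 R vol Om mO (fun x => 'D_(basis3 j) phi x) M') => //.
exact: continuous_measurable3.
Qed.

Definition wpart j u g := forall phi, test_function Om phi ->
  ipO u (fun x => 'D_(basis3 j) phi x) = - ipO g phi.

Definition isgrad u (G : 'I_3 -> T -> R) := forall j, sqO (G j) /\ wpart j u (G j).

(** The fundamental lemma of the calculus of variations. Tensor products of bumps
    tend boundedly to indicator functions of boxes, so the integral of [w] over
    every box vanishes. *)
Lemma test_eq0 w : sqO w -> (forall phi, test_function Om phi -> ipO w phi = 0) ->
  w = (fun=> 0) %[ae vol in Om].
Proof.
move=> sw w0; have [lo [hi [cO OE]]] := open_box_cover oO.
have boxw n : w = (fun=> 0) %[ae vol in box (lo n) (hi n)].
  have iw : vol.-integrable (box (lo n) (hi n)) (EFin \o w).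
    apply: (@integrableS _ T3 R vol _ _ _ mO (measurable_box _ _)).
      by move=> x /box_cbox; exact: cO.
    exact: (sq_L1 mO O_fin sw).
  apply: box_integral_eq0 => // lo1 hi1 B1.
  (* The given half-open box may be empty with corners far away; cutting its corners
     to the large box keeps the closed box inside the open set. *)
  set lo' := fun j => Num.max (lo1 j) (lo n j).
  set hi' := fun j => Num.min (hi1 j) (hi n j).
  have BE : box lo1 hi1 = box lo' hi' by rewrite /lo' /hi' -boxI setIidl.
  have cB : cbox lo' hi' `<=` Om.
    move=> x hx; apply: (cO n) => j; have := hx j; rewrite /lo' /hi' ge_max le_min.
    by move=> [/andP[_ ?] /andP[_ ?]].
  have bB : box lo' hi' `<=` Om by move=> x /box_cbox; exact: cB.
  rewrite BE; set B := box lo' hi' in bB *.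
  pose a k (i : 'I_3) := bump (lo' i) (hi' i) k.
  have a0 k i t : t <= lo' i \/ hi' i <= t -> a k i t = 0 by exact: bump_out.
  have ta k : test_function Om (tens (a k)).
    by apply: tens_test cB _ (a0 k) => i m; exact: Sm_bump.
  have ab k x : `|tens (a k) x| <= 1.
    have h i : 0 <= a k i (crd i x) <= 1 by exact: bump_itv.
    rewrite /tens; have /andP[? ?] := h j0; have /andP[? ?] := h j1.
    have /andP[? ?] := h j2.
    rewrite ger0_norm; last by apply: mulr_ge0 => //; exact: mulr_ge0.
    by apply: mulr_ile1 => //; [exact: mulr_ge0|exact: mulr_ile1].
  have int0 k : \int[vol]_(x in B) (w x * tens (a k) x) = 0.
    rewrite -(w0 _ (ta k)); apply/esym/int_supp => // x nB.
    by rewrite (tens_out (a0 k) nB) mulr0.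
  have mB : @measurable _ T3 B by exact: measurable_box.
  have iwB : vol.-integrable B (EFin \o w).
    exact: (@integrableS _ T3 R vol _ _ _ mO mB bB (sq_L1 mO O_fin sw)).
  have mw : @measurable_fun _ _ T3 R B w by exact: measurable_funS sw.1.
  have cv : \int[vol]_(x in B) (w x * tens (a k) x) @[k --> \oo] -->
      \int[vol]_(x in B) w x.
    apply: (@Rdominated_cvg _ T3 R vol B mB _ _ (fun x => `|w x|)) => //.
    - move=> k; apply: measurable_funM => //.
      apply: continuous_measurable3; apply: tens_continuous => i.
      exact: Sm_continuous (Sm_bump 0 _ _ _).
    - have h j := hyperplane_null j (hi' j).
      move: (h j0) (h j1) (h j2); apply: filterS3 => x h0 h1 h2 Bx.
      have ne j : crd j x != hi' j by move: j; apply: I3P.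
      rewrite -[X in _ --> X]mulr1; apply: cvgM; first exact: cvg_cst.
      have hk i : a k i (crd i x) @[k --> \oo] --> (1 : R).
        have := @bump_cvg R (lo' i) (hi' i) (crd i x).
        have [l r] := Bx i.
        by rewrite l lt_neqAle (ne i) r.
      have e1 : (1 : R) = 1 * 1 * 1 by rewrite !mulr1.
      rewrite [X in _ --> X]e1.
      by apply: cvgM; [apply: cvgM|]; exact: hk.
    - exact: integrable_norm.
    - by move=> k x Bx; rewrite normrM ler_piMr.
  move: cv; rewrite (_ : (fun k => _) = (fun=> 0)); last exact/funext.
  move=> h; apply: (cvg_unique _ h); [exact: norm_hausdorff|exact: cvg_cst].
have : {ae vol, forall x, forall n, box (lo n) (hi n) x -> w x = 0}.
  apply/ae_foralln => n; exact: boxw.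
by apply: filterS => x h; rewrite OE => -[n _]; exact: h.
Qed.

End WeakGradient.


(** * Poincare's inequality on boxes *)

Section Poincare.
Context {R : realType}.
Local Notation vol := (@vol R).
Local Notation T := (R * R * R)%type.
Local Notation T3 := (measurableTypeR R * measurableTypeR R * measurableTypeR R)%type.
Local Notation BX := (@BX R).
Implicit Types (u v w g : T -> R) (x y : T) (b c : BX).
Variable Om : set T.
Hypotheses (oO : open Om) (O_fin : (vol Om < +oo)%E).
Local Notation sqO := (@sq _ T3 R vol Om).
Local Notation ipO := (@ip _ T3 R vol Om).
Local Notation sqb b := (@sq _ T3 R vol (bset b)).
Local Notation ipb b := (@ip _ T3 R vol (bset b)).

Let mb b := measurable_bset b.

Lemma int_abs_le b g : wf b -> sqb b g ->
  (\int[vol]_(x in bset b) `|g x|) ^+ 2 <= ipb b g g * vb b.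
Proof.
move=> wb sg.
have s1 : sqb b (fun=> 1).
  by apply: (@sq_bounded _ T3 R vol _ (mb b) _ 1); [exact: bset_fin|exact: measurable_cst|move=> x _; rewrite normr1].
have sa : sqb b (fun x => `|g x|).
  split; first by apply: measurableT_comp => //; case: sg.
  by have := sg.2; apply: eq_integrable => // x _ /=; rewrite real_normK ?num_real.
have := ip_CS (mb b) sa s1.
have -> : ipb b (fun x => `|g x|) (fun=> 1) = \int[vol]_(x in bset b) `|g x|.
  by apply: eq_Rintegral => x _; rewrite mulr1.
have -> : ipb b (fun x => `|g x|) (fun x => `|g x|) = ipb b g g.
  by apply: eq_Rintegral => x _; rewrite -expr2 real_normK ?num_real// expr2.
suff -> : ipb b (fun=> 1) (fun=> 1) = vb b by [].
transitivity (\int[vol]_(x in bset b) (cst 1 x : R)).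
  by apply: eq_Rintegral => x _; rewrite /= mulr1.
by rewrite Rintegral_cst ?mul1r; [rewrite vol_bset|exact: mb].
Qed.

(** Integrating the weak derivative against smooth approximations of a tent
    function controls the Haar coefficient of [u], that is, the difference of
    its integrals over the two halves of a box. *)
Lemma haar_coeff b j u g : wf b -> cbox b.1 b.2 `<=` Om ->
  sqO u -> sqO g -> wpart Om j u g ->
  `|\int[vol]_(x in bset (lowh j b)) u x - \int[vol]_(x in bset (uph j b)) u x|
  <= (b.2 j - b.1 j) * \int[vol]_(x in bset b) `|g x|.
Proof.
move=> wb cO su sg ug.
have bO : bset b `<=` Om by move=> x /box_cbox; exact: cO.
have sub := sqO_sub oO bO su; have sgb := sqO_sub oO bO sg.
have [A [A' [SA dA A0 AM [A'1 A'0 A'c]]]] := smooth_tents (wb j).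
set l := b.1 j in A A' SA dA A0 AM A'1 A'0 A'c *; set r := b.2 j in A A' SA dA A0 AM A'1 A'0 A'c *.
(* A tent in direction [j] and bumps in the other two directions. *)
pose a k (i : 'I_3) := if i == j then A k else bump (b.1 i) (b.2 i) k.
have a0 k i t : t <= b.1 i \/ b.2 i <= t -> a k i t = 0.
  by rewrite /a; case: eqP => [->|_]; [exact: A0|exact: bump_out].
have sa k i m : Sm m (a k i).
  by rewrite /a; case: eqP => _; [exact: SA|exact: Sm_bump].
have ta k : test_function Om (tens (a k)) by apply: tens_test cO _ (a0 k) => i m.
have da k i t : exists d, is_derive t (1 : R) (a k i) d.
  by have [a' ha' _] := sa k i 1%N; exists (a' t).
have dj k t : is_derive t (1 : R) (a k j) (A' k t).
  by rewrite /a eqxx; exact: dA.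
pose psi k := tens (subst1 (a k) j (A' k)).
have DE k : (fun x => 'D_(basis3 j) (tens (a k)) x) = psi k.
  by apply/funext => x; case: (is_derive_tens x (da k) (dj k)).
have psi0 k x : ~ bset b x -> psi k x = 0.
  move=> nb; apply: (tens_out (lo := b.1) (hi := b.2)) nb => i t h.
  by rewrite /subst1; case: eqP h => [->|_] h; [exact: A'0|exact: a0].
have psi1 k x : `|psi k x| <= 1.
  have h i : `|subst1 (a k) j (A' k) i (crd i x)| <= 1.
    rewrite /subst1 /a; case: eqP => _; first exact: A'1.
    by have /andP[? ?] := bump_itv (b.1 i) (b.2 i) k (crd i x); rewrite ger0_norm.
  rewrite /psi /tens !normrM; apply: mulr_ile1 => //.
  exact: mulr_ile1.
have phiM k x : `|tens (a k) x| <= r - l.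
  have rl : 0 <= r - l by rewrite subr_ge0 ltW// wb.
  have h i : `|a k i (crd i x)| <= if i == j then r - l else 1.
    rewrite /a; case: eqP => _; first exact: AM.
    by have /andP[? ?] := bump_itv (b.1 i) (b.2 i) k (crd i x); rewrite ger0_norm.
  rewrite /tens !normrM.
  apply: (@le_trans _ _ (\prod_(i < 3) if i == j then r - l else 1)).
    by rewrite prod3; apply: ler_pM => //; apply: ler_pM.
  by rewrite -big_mkcond/= big_pred1_eq.
(* The pointwise limit of the derivatives of the test functions. *)
pose s x : R := \1_(bset (lowh j b)) x - \1_(bset (uph j b)) x.
have mpsi k : @measurable_fun _ _ T3 R (bset b) (psi k).
  apply: continuous_measurable3; apply: tens_continuous => i.
  rewrite /subst1; case: eqP => _; last exact: Sm_continuous (sa k i 0%N).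
  have [a' da' ca'] := SA k 1%N.
  have -> : A' k = a'.
    by apply/funext => t; have [_ <-] := dA k t; have [_ <-] := da' t.
  exact: ca'.
have cv : \int[vol]_(x in bset b) (u x * psi k x) @[k --> \oo] -->
    \int[vol]_(x in bset b) (u x * s x).
  apply: (@Rdominated_cvg _ T3 R vol _ (mb b) _ _ (fun x => `|u x|)) => //.
  - by move=> k; apply: measurable_funM => //; case: sub.
  - apply: measurable_funM => //; first by case: sub.
    by apply: measurable_funB; apply: measurable_indic; exact: mb.
  - have h i := hyperplane_null i (b.2 i).
    have hm := hyperplane_null j (mid b j).
    have h012 : {ae vol, forall x, [/\ crd j0 x != b.2 j0, crd j1 x != b.2 j1 & crd j2 x != b.2 j2]}.
      by move: (h j0) (h j1) (h j2); apply: filterS3 => x.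
    move: h012 hm; apply: filterS2 => x [h0 h1 h2] hj bx.
    have ne i : crd i x != b.2 i by move: i {a0 sa ta}; apply: I3P.
    have lr i : (b.1 i < crd i x) && (crd i x < b.2 i).
      by have [l1 r1] := bx i; rewrite l1 lt_neqAle ne r1.
    apply: cvgM; first exact: cvg_cst.
    pose e i := if i == j then s x else 1.
    have ck i : subst1 (a k) j (A' k) i (crd i x) @[k --> \oo] --> e i.
      rewrite /subst1 /e /a; case: eqP => [->|_].
        have -> : s x = (((l < crd j x) && (crd j x < (l + r) / 2))%:R -
            (((l + r) / 2 < crd j x) && (crd j x < r))%:R : R).
          rewrite -/(mid b j); have /andP[lj rj] := lr j.
          rewrite /l /r lj rj andbT/= /s !indicE.
          have [m1|m1] := ltP (crd j x) (mid b j).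
            have xl : bset (lowh j b) x.
              by apply: (bset_lowh _ _ wb).2; split => //; exact: ltW.
            have xu : ~ bset (uph j b) x.
              by move/(bset_uph _ _ wb) => [_]; rewrite ltNge ltW.
            by rewrite (mem_set xl) (memNset xu) ltNge (ltW m1).
          have {}m1 : mid b j < crd j x by rewrite lt_neqAle eq_sym hj.
          have xu : bset (uph j b) x by apply: (bset_uph _ _ wb).2.
          have xl : ~ bset (lowh j b) x.
            by move/(bset_lowh _ _ wb) => [_]; rewrite leNgt m1.
          by rewrite (memNset xl) (mem_set xu) m1.
        exact: A'c.
      by have := @bump_cvg R (b.1 i) (b.2 i) (crd i x); rewrite lr.
    have -> : s x = e j0 * e j1 * e j2.
      by rewrite -prod3 /e -big_mkcond/= big_pred1_eq.
    by apply: cvgM; [apply: cvgM|]; exact: ck.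
  - by apply: integrable_norm; exact: sqb_int.
  - by move=> k x Bx; rewrite normrM ler_piMr.
have -> : \int[vol]_(x in bset (lowh j b)) u x - \int[vol]_(x in bset (uph j b)) u x =
    \int[vol]_(x in bset b) (u x * s x).
  have sl : sqb b (\1_(bset (lowh j b))) by exact: sqb_indic.
  have sh : sqb b (\1_(bset (uph j b))) by exact: sqb_indic.
  rewrite -[RHS]/(ipb b u s) /s ipBr//.
  by rewrite !ipb_indic// => x; [move/(bset_uph _ _ wb) => []|move/(bset_lowh _ _ wb) => []].
apply: (cvgn_le (cvg_norm cv)) => k.
have -> : \int[vol]_(x in bset b) (u x * psi k x) = ipO u (psi k).
  by apply/esym/int_supp => // x /psi0 ->; rewrite mulr0.
rewrite -DE ug// normrN.
have -> : ipO g (tens (a k)) = \int[vol]_(x in bset b) (g x * tens (a k) x).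
  by apply: int_supp => // x nb; rewrite (tens_out (a0 k) nb) mulr0.
have mt : @measurable_fun _ _ T3 R (bset b) (tens (a k)).
  apply: continuous_measurable3; apply: tens_continuous => i.
  exact: Sm_continuous (sa k i 0%N).
have ig : vol.-integrable (bset b) (EFin \o g) by exact: sqb_int.
have igt : vol.-integrable (bset b) (EFin \o (fun x => g x * tens (a k) x)).
  have := @integrableMl _ T3 R vol _ (mb b) (EFin \o g) (tens (a k)) ig mt.
  apply; exists (r - l); split; first exact: num_real.
  by move=> M hM x _ /=; apply: le_trans (ltW hM).
apply: (le_trans (le_normr_Rintegral (mb b) igt)).
have ign : vol.-integrable (bset b) (EFin \o (fun x => `|g x|)).
  exact: integrable_norm.
rewrite -RintegralZl; [|exact: mb|exact: ign].
apply: le_Rintegral; [exact: mb|exact: integrable_norm| |].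
  exact: (@integrableZl _ T3 R vol _ (mb b) (r - l) _ ign).
by move=> x bx; rewrite normrM mulrC ler_wpM2r.
Qed.

(** If $p, q$ are the integrals over two halves of volume $v/2$, then
    $2p^2/v + 2q^2/v = (p+q)^2/v + (p-q)^2/v$, and the last term is a squared Haar
    coefficient. *)
Lemma int_half_sqr b j u g (h : R) : wf b -> cbox b.1 b.2 `<=` Om ->
  b.2 j - b.1 j <= h -> sqO u -> sqO g -> wpart Om j u g ->
  \sum_(c <- halves j b) (\int[vol]_(x in bset c) u x) ^+ 2 / vb c <=
  (\int[vol]_(x in bset b) u x) ^+ 2 / vb b + h ^+ 2 * ipb b g g.
Proof.
move=> wb cO bh su sg ug; have V0 := vb_gt0 wb.
have bO : bset b `<=` Om by move=> x /box_cbox; exact: cO.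
have hc := haar_coeff wb cO su sg ug.
have := int_abs_le wb (sqO_sub oO bO sg).
rewrite (int_parts (parts_halves j wb) (sqb_int (sqO_sub oO bO su))).
rewrite /halves !big_cons !big_nil !addr0 in hc *.
have vl : vb (lowh j b) = vb b / 2 by apply: (@vb_halves _ j); rewrite inE eqxx.
have vu : vb (uph j b) = vb b / 2 by apply: (@vb_halves _ j); rewrite !inE eqxx orbT.
rewrite vl vu.
have := @Rintegral_ge0 _ T3 R vol (bset b) (fun x => `|g x|) (fun x _ => normr_ge0 (g x)).
move: hc; set p := \int[vol]_(x in bset (lowh j b)) u x.
set q := \int[vol]_(x in bset (uph j b)) u x.
set I := \int[vol]_(x in bset b) `|g x|.
set V := vb b in V0 *; set J := ipb b g g => hc I0 IJ.
have s0 : 0 < b.2 j - b.1 j by rewrite subr_gt0.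
have pq : (p - q) ^+ 2 <= h ^+ 2 * (J * V).
  rewrite -[(p - q) ^+ 2]real_normK ?num_real//.
  apply: (@le_trans _ _ ((h * I) ^+ 2)).
    rewrite ler_sqr ?nnegrE ?mulr_ge0//; last lra.
    by apply: (le_trans hc); rewrite ler_wpM2r.
  by rewrite exprMn ler_wpM2l// sqr_ge0.
have -> : p ^+ 2 / (V / 2) + q ^+ 2 / (V / 2) = (p + q) ^+ 2 / V + (p - q) ^+ 2 / V.
  by field; rewrite gt_eqF.
by rewrite lerD2l ler_pdivrMr// -mulrA.
Qed.

Definition dir2 b (G : 'I_3 -> T -> R) : R := \sum_(j < 3) ipb b (G j) (G j).

Lemma ip_parts (s : seq BX) b v w : parts s b -> sqb b v -> sqb b w ->
  ipb b v w = \sum_(c <- s) ipb c v w.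
Proof.
by move=> sb sv sw; apply: int_parts => //; exact: (sqM (mb b)).
Qed.

(** The squared norm of the projection of [u] on the constants of [b]. *)
Definition mean_sqr u b : R := (\int[vol]_(x in bset b) u x) ^+ 2 / vb b.

Lemma mean_sqr_halves (s : seq BX) b j u g (h : R) : parts s b ->
  (forall c, c \in s -> [/\ wf c, cbox c.1 c.2 `<=` Om & c.2 j - c.1 j <= h]) ->
  cbox b.1 b.2 `<=` Om -> sqO u -> sqO g -> wpart Om j u g ->
  \sum_(c <- flatten (map (halves j) s)) mean_sqr u c <=
  \sum_(c <- s) mean_sqr u c + h ^+ 2 * ipb b g g.
Proof.
move=> sb hs cO su sg ug.
have bO : bset b `<=` Om by move=> x /box_cbox; exact: cO.
have sgb := sqO_sub oO bO sg.
rewrite (ip_parts sb sgb sgb) mulr_sumr -big_split/= big_flatten big_map.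
rewrite big_seq [leRHS]big_seq; apply: ler_sum => c /hs[wc cc ch].
exact: int_half_sqr.
Qed.

Lemma mean_sqr_kids b u (G : 'I_3 -> T -> R) (h : R) : wf b ->
  cbox b.1 b.2 `<=` Om -> (forall j, b.2 j - b.1 j <= h) ->
  sqO u -> isgrad Om u G ->
  \sum_(c <- kids b) mean_sqr u c <= mean_sqr u b + h ^+ 2 * dir2 b G.
Proof.
move=> wb cO bh su hG.
have p0 := parts_halves j0 wb.
have w0 c : c \in halves j0 b -> wf c by exact: wf_halves.
have p1 : parts (flatten (map (halves j1) (halves j0 b))) b.
  by apply: parts_flatten => // c /w0; exact: parts_halves.
have sub0 c : c \in halves j0 b -> cbox c.1 c.2 `<=` Om.
  by move=> hc x /(cbox_halves wb hc); exact: cO.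
have s0 c j : c \in halves j0 b -> c.2 j - c.1 j <= h.
  move=> hc; rewrite (side_halves _ hc); case: eqP => // _.
  by have := bh j; have := wb j; lra.
have h0 := int_half_sqr wb cO (bh j0) su (hG j0).1 (hG j0).2.
have h1 : \sum_(c <- flatten (map (halves j1) (halves j0 b))) mean_sqr u c <=
  \sum_(c <- halves j0 b) mean_sqr u c + h ^+ 2 * ipb b (G j1) (G j1).
  apply: mean_sqr_halves => //; [|exact: (hG j1).1|exact: (hG j1).2].
  by move=> c hc; split; [exact: w0|exact: sub0|exact: s0].
have h2 : \sum_(c <- kids b) mean_sqr u c <=
  \sum_(c <- flatten (map (halves j1) (halves j0 b))) mean_sqr u c
   + h ^+ 2 * ipb b (G j2) (G j2).
  apply: mean_sqr_halves => //; [|exact: (hG j2).1|exact: (hG j2).2].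
  move=> c /flattenP[_ /mapP[a ha ->] hc]; split.
  - exact: wf_halves (w0 _ ha) hc.
  - by move=> x /(cbox_halves (w0 _ ha) hc); exact: sub0.
  - by rewrite (side_halves _ hc) /=; exact: s0.
rewrite /dir2 sum3 !mulrDr; rewrite -/(mean_sqr u b) in h0.
move: h0 h1 h2; rewrite /mean_sqr; lra.
Qed.

Lemma dir2_parts (s : seq BX) b (G : 'I_3 -> T -> R) : parts s b ->
  (forall j, sqb b (G j)) -> dir2 b G = \sum_(c <- s) dir2 c G.
Proof.
move=> sb hG; rewrite /dir2 exchange_big/=; apply: eq_bigr => j _.
exact: ip_parts.
Qed.

Lemma dir2_ge0 b (G : 'I_3 -> T -> R) : 0 <= dir2 b G.
Proof. by apply: sumr_ge0 => j _; exact: (ip_ge0 vol (bset b)). Qed.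

Lemma Sdy_mean_sqr m b u : wf b -> sqb b u ->
  Sdy m b u = \sum_(c <- leaves m b) mean_sqr u c.
Proof.
move=> wb su; rewrite /Sdy ipC ip_suml//; last first.
  by move=> c; apply: sqZ => //; exact: sqb_indic.
rewrite big_seq [RHS]big_seq; apply: eq_bigr => c cl.
rewrite ipZl//; last exact: sqb_indic.
rewrite ipC ipb_indic; last exact: (parts_sub (parts_leaves m wb) cl).
by rewrite /mean_sqr /avg expr2 mulrAC.
Qed.

Lemma Sdy_le_mean m b u (G : 'I_3 -> T -> R) (h : R) : wf b ->
  cbox b.1 b.2 `<=` Om -> (forall j, b.2 j - b.1 j <= h) ->
  sqO u -> isgrad Om u G ->
  \sum_(c <- leaves m b) mean_sqr u c <= mean_sqr u b + 2 * h ^+ 2 * dir2 b G.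
Proof.
elim: m b h => [|m ih] b h wb cO bh su hG.
  rewrite /= big_seq1 lerDl; apply: mulr_ge0; last exact: dir2_ge0.
  by rewrite mulr_ge0 ?sqr_ge0.
have bO : bset b `<=` Om by move=> x /box_cbox; exact: cO.
have D0 := dir2_ge0 b G.
rewrite leavesS big_flatten big_map.
apply: (@le_trans _ _ (\sum_(c <- kids b) (mean_sqr u c + 2 * (h / 2) ^+ 2 * dir2 c G))).
  rewrite big_seq [leRHS]big_seq; apply: ler_sum => c ck.
  have [wc sc cc] := kidsP wb ck.
  apply: ih => //; first by move=> x /cc; exact: cO.
  by move=> j; rewrite sc; have := bh j; lra.
rewrite big_split/= -mulr_sumr -(dir2_parts (parts_kids wb)); last first.
  by move=> j; exact: (sqO_sub oO bO (hG j).1).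
(* The constant $2$ absorbs the geometric series: $1 + 2/4 \le 2$. *)
have := mean_sqr_kids wb cO bh su hG.
have -> : (h / 2) ^+ 2 = h ^+ 2 / 4 by field.
have : 0 <= h ^+ 2 * dir2 b G by rewrite mulr_ge0 ?sqr_ge0.
set Z := h ^+ 2 * dir2 b G.
have -> : 2 * (h ^+ 2 / 4) * dir2 b G = Z / 2 by rewrite /Z; field.
have -> : 2 * h ^+ 2 * dir2 b G = 2 * Z by rewrite /Z; ring.
lra.
Qed.

(** Poincare's inequality on a box, as the sum of the Haar coefficients of all
    scales, which decay geometrically. *)
Lemma poincare b u (G : 'I_3 -> T -> R) (h : R) : wf b ->
  cbox b.1 b.2 `<=` Om -> (forall j, b.2 j - b.1 j <= h) ->
  sqO u -> isgrad Om u G ->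
  ipb b u u <= mean_sqr u b + 2 * h ^+ 2 * dir2 b G.
Proof.
move=> wb cO bh su hG.
have bO : bset b `<=` Om by move=> x /box_cbox; exact: cO.
have sub := sqO_sub oO bO su.
apply: (cvgn_le (Sdy_cvg wb sub)) => m.
by rewrite Sdy_mean_sqr//; exact: Sdy_le_mean.
Qed.

(** Poincare's inequality summed over the leaves, whose sides are $2^m$ times
    shorter: finitely many means control the $L^2$ norm up to a small multiple of the
    energy. This is the source of compactness. *)
Lemma poincare_leaves m b u (G : 'I_3 -> T -> R) (h : R) : wf b ->
  cbox b.1 b.2 `<=` Om -> (forall j, b.2 j - b.1 j <= h) ->
  sqO u -> isgrad Om u G ->
  ipb b u u <= \sum_(c <- leaves m b) mean_sqr u c
    + 2 * (h / 2 ^+ m) ^+ 2 * dir2 b G.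
Proof.
move=> wb cO bh su hG.
have bO : bset b `<=` Om by move=> x /box_cbox; exact: cO.
have sub := sqO_sub oO bO su.
rewrite (ip_parts (parts_leaves m wb) sub sub).
rewrite (dir2_parts (parts_leaves m wb)); last first.
  by move=> j; exact: (sqO_sub oO bO (hG j).1).
rewrite mulr_sumr -big_split/= big_seq [leRHS]big_seq; apply: ler_sum => c cl.
have [wc sc cc] := leavesP wb cl.
apply: poincare => //; first by move=> x /cc; exact: cO.
by move=> j; rewrite sc ler_pM2r ?invr_gt0 ?exprn_gt0.
Qed.

End Poincare.


(** * Ultrafilters and coverings *)

Lemma filter_all (T : Type) (F : set_system T) {FF : Filter F} (I : eqType) (s : seq I) (P : I -> set T) :
  (forall i, i \in s -> F (P i)) -> F [set n | forall i, i \in s -> P i n].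
Proof.
elim: s => [|i s ih] h; first by apply: filterS filterT.
have h1 := h i (mem_head _ _).
have h2 := ih (fun j js => h j (mem_behead (s := i :: s) js)).
apply: filterS (filterI h1 h2) => n [a b] j.
by rewrite inE => /orP[/eqP ->//|]; exact: b.
Qed.

Section UltraCauchy.
Context {R : realType} (F : set_system nat) (FU : UltraFilter F).

Let FF : ProperFilter F. Proof. exact: ultra_proper. Qed.

(** A bounded real sequence converges along an ultrafilter. One ultrafilter serves
    for all means over all boxes at once, where sequences would need a diagonal
    extraction. *)
Lemma ultra_cauchy (a : nat -> R) (C e : R) : (forall n, `|a n| <= C) -> 0 < e ->
  exists2 A, F A & forall n m, A n -> A m -> `|a n - a m| <= e.
Proof.
move=> aC e0.
have key k : forall l r, r - l <= e * 2 ^+ k -> F [set n | l <= a n <= r] ->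
    exists2 A, F A & forall n m, A n -> A m -> `|a n - a m| <= e.
  elim: k => [|k ih] l r lr Flr.
    rewrite expr0 mulr1 in lr; exists [set n | l <= a n <= r] => // n m /= /andP[? ?] /andP[? ?].
    by rewrite ler_norml; apply/andP; split; lra.
  pose m := (l + r) / 2.
  have pe : 0 < e * 2 ^+ k by rewrite mulr_gt0// exprn_gt0.
  have {}lr : r - l <= 2 * (e * 2 ^+ k) by rewrite mulrCA -exprS.
  have [h|h] := in_ultra_setVsetC [set n : nat | a n <= m] FU.
    apply: (ih l m); first by rewrite /m; lra.
    by apply: filterS (filterI Flr h) => n [/= /andP[-> _] ->].
  apply: (ih m r); first by rewrite /m; lra.
  apply: filterS (filterI Flr h) => n [/= /andP[_ ->] /negP].
  by rewrite -ltNge => /ltW ->.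
have [k _ hk] := pow2_small (2 * C) e0.
apply: (key k (- C) C).
  have := hk k (leqnn k); rewrite /= ltr_pdivrMr ?exprn_gt0// => /ltW.
  by set Z := e * _; lra.
apply: filterS filterT => n _ /=; have := aC n.
by rewrite ler_norml.
Qed.

End UltraCauchy.

Section AeBounds.
Context d (T : measurableType d) (R : realType).
Variables (mu : {measure set T -> \bar R}) (D : set T).
Hypotheses (mD : measurable D) (D_fin : (mu D < +oo)%E).

Lemma ae_bounded_ip (w : T -> R) (C : R) : sq mu D w ->
  {ae mu, forall x, D x -> `|w x| <= C} -> ip mu D w w <= C ^+ 2 * fine (mu D).
Proof.
move=> sw wC.
have E : (\int[mu]_(x in D) (w x * w x)%:E <= \int[mu]_(x in D) (C ^+ 2)%:E)%E.
  apply: ae_ge0_le_integral => //.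
  - by move=> x _; rewrite lee_fin -expr2 sqr_ge0.
  - by apply/measurable_EFinP; apply: measurable_funM; case: sw.
  - by move=> x _; rewrite lee_fin sqr_ge0.
  - apply: filterS wC => x h Dx; rewrite lee_fin.
    rewrite -expr2 -(real_normK (num_real (w x))) ler_sqr ?nnegrE//; first exact: h.
    by apply: le_trans (h Dx).
have fD : mu D \is a fin_num by rewrite ge0_fin_numE.
rewrite integral_cst// in E; rewrite -lee_fin EFinM (fineK fD).
apply: le_trans E.
by rewrite /ip /Rintegral fineK//; apply: integrable_fin_num => //; exact: sqM.
Qed.

(** The pieces are boxes of a cover, which overlap; hence an inequality. *)
Lemma ip_cover (w : T -> R) (p : nat) (A : nat -> set T) (E : set T) :
  (forall i, measurable (A i)) -> measurable E ->
  (forall i, A i `<=` D) -> E `<=` D ->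
  (forall x, D x -> (exists2 i, (i < p)%N & A i x) \/ E x) -> sq mu D w ->
  ip mu D w w <= \sum_(i < p) ip mu (A i) w w + ip mu E w w.
Proof.
move=> mA mE AD ED cov sw.
have restr (B : set T) : measurable B -> B `<=` D ->
    mu.-integrable D (EFin \o (fun x => w x * w x * \1_B x)) /\
    ip mu B w w = \int[mu]_(x in D) (w x * w x * \1_B x).
  move=> mB BD; split; last first.
    rewrite /ip -[in LHS](setIidr BD) Rintegral_mkcondr; apply: eq_Rintegral => x _.
    by rewrite patchE indicE; case: (_ \in _); rewrite ?mulr1 ?mulr0.
  have := integrableMl mD (sqM mD sw sw) (measurable_indic (D := D) mB).
  apply; exists 1; split; first exact: num_real.
  move=> M M1 x _ /=; apply: le_trans (ltW M1); rewrite indicE.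
  by case: (_ \in _); rewrite /= ?normr0 ?normr1 ?ler01.
have [iE eE] := restr _ mE ED.
have iA i := (restr _ (mA i) (AD i)).1.
have [iS eS] := Rintegral_sum mD (s := index_enum 'I_p)
  (F := fun (i : 'I_p) x => w x * w x * \1_(A i) x) (fun i _ => iA i).
rewrite eE (eq_bigr (fun i : 'I_p => \int[mu]_(x in D) (w x * w x * \1_(A i) x))); last first.
  by move=> i _; exact: (restr _ (mA i) (AD i)).2.
rewrite -eS -RintegralD//.
apply: le_Rintegral => //; first exact: sqM.
  by have := integrableD mD iS iE; apply: eq_integrable.
move=> x Dx; have w0 : 0 <= w x * w x by rewrite -expr2 sqr_ge0.
have S0 (s : seq 'I_p) : 0 <= \sum_(i <- s) w x * w x * \1_(A i) x.
  by apply: sumr_ge0 => i _; rewrite mulr_ge0// indicE ler0n.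
case: (cov x Dx) => [[i ip Aix]|Ex].
  rewrite (bigD1 (Ordinal ip))//=.
  have -> : \1_(A i) x = 1 :> R by rewrite indicE mem_set.
  rewrite mulr1 -addrA lerDl; apply: addr_ge0.
    by apply: sumr_ge0 => i' _; rewrite mulr_ge0// indicE ler0n.
  by rewrite mulr_ge0// indicE ler0n.
have -> : \1_E x = 1 :> R by rewrite indicE mem_set.
by rewrite mulr1 lerDr.
Qed.

End AeBounds.


(** * Rellich compactness *)

Lemma ip_mono d (T : measurableType d) (R : realType)
    (mu : {measure set T -> \bar R}) (A D : set T) (w : T -> R) :
  measurable A -> measurable D -> A `<=` D -> sq mu D w ->
  ip mu A w w <= ip mu D w w.
Proof.
move=> mA mD AD sw; have sA := sqS mA mD AD sw.
rewrite -lee_fin /ip /Rintegral !fineK; last first.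
- by apply: integrable_fin_num => //; exact: sqM.
- by apply: integrable_fin_num => //; exact: sqM.
apply: ge0_subset_integral => //.
- by apply/measurable_EFinP; apply: measurable_funM; case: sw.
- by move=> x _; rewrite lee_fin -expr2 sqr_ge0.
Qed.

Section Compactness.
Context {R : realType}.
Local Notation vol := (@vol R).
Local Notation T := (R * R * R)%type.
Local Notation T3 := (measurableTypeR R * measurableTypeR R * measurableTypeR R)%type.
Local Notation BX := (@BX R).
Implicit Types (u v w g : T -> R) (x y : T) (b c : BX).
Variable Om : set T.
Hypotheses (oO : open Om) (O_fin : (vol Om < +oo)%E).
Local Notation sqO := (@sq _ T3 R vol Om).
Local Notation ipO := (@ip _ T3 R vol Om).
Local Notation sqb b := (@sq _ T3 R vol (bset b)).
Local Notation ipb b := (@ip _ T3 R vol (bset b)).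
Local Notation isgrad := (isgrad Om).

Let mO : @measurable _ T3 Om. Proof. exact: open_measurable3. Qed.
Let mb b := measurable_bset b.

Lemma isgradD u v G H : sqO u -> sqO v -> isgrad u G -> isgrad v H ->
  isgrad (fun x => u x + v x) (fun j x => G j x + H j x).
Proof.
move=> su sv gu gv j; have [sG wG] := gu j; have [sH wH] := gv j.
split; first exact: sqD.
move=> phi tp; have [sp sD] := test_sq oO O_fin j tp.
by rewrite !ipDl// wG// wH// opprD.
Qed.

Lemma isgradZ (a : R) u G : sqO u -> isgrad u G ->
  isgrad (fun x => a * u x) (fun j x => a * G j x).
Proof.
move=> su gu j; have [sG wG] := gu j; split; first exact: sqZ.
move=> phi tp; have [sp sD] := test_sq oO O_fin j tp.
by rewrite !ipZl// wG// mulrN.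
Qed.

Lemma isgradB u v G H : sqO u -> sqO v -> isgrad u G -> isgrad v H ->
  isgrad (fun x => u x - v x) (fun j x => G j x - H j x).
Proof.
move=> su sv gu gv j; have [sG wG] := gu j; have [sH wH] := gv j.
split; first exact: sqB.
move=> phi tp; have [sp sD] := test_sq oO O_fin j tp.
by rewrite !ipBl// wG// wH// opprB opprK addrC.
Qed.

(** The weak formulation tests [u] and its gradient with fixed functions only, and
    thus passes to $L^2$ limits. *)
Lemma isgrad_cvg (un : nat -> T -> R) u (Gn : nat -> 'I_3 -> T -> R) G :
  (forall n, sqO (un n)) -> sqO u -> (forall n, isgrad (un n) (Gn n)) ->
  (forall j, sqO (G j)) ->
  ipO (fun x => un n x - u x) (fun x => un n x - u x) @[n --> \oo] --> (0 : R) ->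
  (forall j, ipO (fun x => Gn n j x - G j x) (fun x => Gn n j x - G j x)
    @[n --> \oo] --> (0 : R)) ->
  isgrad u G.
Proof.
move=> sun su gn sG cu cG j; split=> // phi tp.
have [sp sD] := test_sq oO O_fin j tp.
have h1 := cvg_ipr mO sun su cu sD.
have h2 := cvg_ipr mO (fun n => (gn n j).1) (sG j) (cG j) sp.
apply: (cvg_unique _ h1); first exact: norm_hausdorff.
rewrite (_ : (fun n => _) = (fun n => - ipO (Gn n j) phi)); first exact: cvgN.
by apply/funext => n; exact: (gn n j).2.
Qed.

Section UltraCompact.
Variables (J : finType) (u : nat -> J -> T -> R) (G : nat -> J -> 'I_3 -> T -> R).
Variables (M : R).
Hypothesis su : forall n j, sqO (u n j).
Hypothesis gu : forall n j, isgrad (u n j) (G n j).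
Hypothesis GM : forall n j, \sum_(i < 3) ipO (G n j i) (G n j i) <= M.
Hypothesis u1 : forall n j, {ae vol, forall x, Om x -> `|u n j x| <= 1}.
Variables (F : set_system nat) (FU : UltraFilter F).

Let FF : ProperFilter F. Proof. exact: ultra_proper. Qed.

Let D n m j x : R := u n j x - u m j x.

Let M0 : J -> 0 <= M.
Proof.
move=> j; apply: le_trans (GM 0 j).
by apply: sumr_ge0 => i _; exact: (ip_ge0 vol Om).
Qed.

Lemma ultra_box b (e : R) : wf b -> cbox b.1 b.2 `<=` Om -> 0 < e ->
  exists2 A, F A & forall n m j, A n -> A m -> ipb b (D n m j) (D n m j) <= e.
Proof.
move=> wb cO e0.
have bO : bset b `<=` Om by move=> x /box_cbox; exact: cO.
pose h := \sum_(j < 3) (b.2 j - b.1 j).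
have hb i : b.2 i - b.1 i <= h.
  rewrite /h (bigD1 i)//= lerDl; apply: sumr_ge0 => k _.
  by rewrite subr_ge0 ltW// wb.
pose M' := `|M|; have M'0 : 0 <= M' by exact: normr_ge0.
(* The energy of a difference of two maps is at most [4 * M'], so at the scale
   [h / 2 ^+ p] the energy term of Poincare's inequality is at most [e / 2]. *)
have [p _ hp] : \forall p \near \oo, (8 * M' * h ^+ 2 + h) / 2 ^+ p < Num.min 1 (e / 2).
  by apply: pow2_small; rewrite lt_min ltr01/= divr_gt0.
have p2 : 0 < (2 : R) ^+ p by exact: exprn_gt0.
have p21 : 1 <= (2 : R) ^+ p by apply: exprn_ege1; lra.
have h0 : 0 <= h by apply: le_trans (hb j0); rewrite subr_ge0 ltW// wb.
have small : 2 * (h / 2 ^+ p) ^+ 2 * (4 * M') <= e / 2.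
  have := hp p (leqnn p); rewrite /= lt_min => /andP[_].
  have -> : 2 * (h / 2 ^+ p) ^+ 2 * (4 * M') = (8 * M' * h ^+ 2) / 2 ^+ p / 2 ^+ p.
    by field; rewrite gt_eqF.
  rewrite mulrDl => he.
  have a0 : 0 <= 8 * M' * h ^+ 2 / 2 ^+ p.
    apply: divr_ge0; last exact: ltW.
    by apply: mulr_ge0; [exact: mulr_ge0|exact: sqr_ge0].
  have b0 : 0 <= h / 2 ^+ p by rewrite divr_ge0 ?(ltW p2).
  apply: (@le_trans _ _ (8 * M' * h ^+ 2 / 2 ^+ p)).
    by rewrite ler_pdivrMr// ler_peMr.
  by lra.
pose L := leaves p b.
pose K := (size L)%:R + 1 : R.
have K0 : 0 < K by rewrite /K ltr_wpDl ?ler0n.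
(* Along the ultrafilter, the mean over each leaf is a Cauchy sequence. *)
have meanc (cj : BX * J) : cj \in [seq (c, j) | c <- L, j <- enum J] ->
    exists2 A, F A & forall n m, A n -> A m -> mean_sqr (D n m cj.2) cj.1 <= e / 2 / K.
  case: cj => c j /allpairsP[[c' j'] [/= cl _ [-> ->]]] {c j}.
  have [wc _ cc] := leavesP wb cl; have V0 := vb_gt0 wc.
  have cO' : bset c' `<=` Om by move=> x /box_cbox/cc; exact: cO.
  have suc n : sqb c' (u n j') by exact: (sqO_sub oO cO' (su n j')).
  pose a n := \int[vol]_(x in bset c') u n j' x.
  have aC n : `|a n| <= vb c'.
    rewrite -ler_sqr ?nnegrE ?(ltW V0)// real_normK ?num_real//.
    have := ip_CS (mb c') (suc n) (sqb_indic c' c').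
    rewrite ipb_indic//.
    have -> : ipb c' (\1_(bset c')) (\1_(bset c')) = vb c'.
      rewrite ipb_indic// /Rintegral integral_indic; [|exact: mb|exact: mb].
      by rewrite setIid vol_bset.
    move=> h1; apply: (le_trans h1); rewrite expr2 ler_wpM2r ?(ltW V0)//.
    have := @ae_bounded_ip _ T3 R vol (bset c') (mb c') (bset_fin c') (u n j') 1 (suc n).
    rewrite expr1n mul1r vol_bset//; apply.
    by apply: filterS (u1 n j') => x hx cx; apply: hx; exact: cO'.
  have dpos : 0 < e / 2 / K by rewrite !divr_gt0.
  (* The bound $1$ is there to have $d^2 \le d$. *)
  pose d := Num.min 1 (e / 2 / K * vb c').
  have d0 : 0 < d by rewrite /d lt_min ltr01 mulr_gt0.
  have [A FA hA] := ultra_cauchy FU aC d0.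
  exists A => // n m An Am; rewrite /mean_sqr /= ler_pdivrMr//.
  have -> : \int[vol]_(x in bset c') D n m j' x = a n - a m.
    exact: (RintegralB (mb c') (sqb_int (suc n)) (sqb_int (suc m))).
  have := hA n m An Am; rewrite /d le_min => /andP[q1 q2].
  rewrite -real_normK ?num_real//; have := normr_ge0 (a n - a m); nra.
have [Aof hAof] := choice (fun cj : {cj : BX * J | cj \in [seq (c, j) | c <- L, j <- enum J]} =>
  let: ex_intro2 A FA hA := meanc (val cj) (valP cj) in ex_intro (fun A => F A /\
    forall n m, A n -> A m -> mean_sqr (D n m (val cj).2) (val cj).1 <= e / 2 / K) A (conj FA hA)).
pose P (cj : BX * J) : set nat := if insub cj is Some z then Aof z else setT.
exists [set n | forall cj, cj \in [seq (c, j) | c <- L, j <- enum J] -> P cj n].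
  apply: filter_all => cj hcj; rewrite /P insubT; exact: (hAof _).1.
move=> n m j hn hm.
have Dgrad : isgrad (D n m j) (fun i x => G n j i x - G m j i x) by exact: isgradB.
have sD : sqO (D n m j) by exact: sqB.
apply: (le_trans (poincare_leaves oO p wb cO hb sD Dgrad)).
have -> : e = e / 2 + e / 2 by field.
apply: lerD.
  apply: (@le_trans _ _ (\sum_(c <- L) e / 2 / K)).
    rewrite big_seq [leRHS]big_seq; apply: ler_sum => c cl.
    have hcj : (c, j) \in [seq (c, j) | c <- L, j <- enum J].
      by apply/allpairsP; exists (c, j); rewrite mem_enum.
    have := hn _ hcj; have := hm _ hcj; rewrite /P insubT => am an.
    exact: (hAof _).2 n m an am.
  rewrite big_const_seq count_predT iter_addr_0 -[_ *+ size L]mulr_natr mulrAC ler_pdivrMr//.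
  by rewrite ler_wpM2l ?divr_ge0 ?(ltW e0)// /K lerDl.
apply: le_trans small; rewrite ler_wpM2l ?mulr_ge0 ?sqr_ge0//.
have sG n' i : sqb b (G n' j i) by exact: (sqO_sub oO bO (gu n' j i).1).
apply: (@le_trans _ _ (\sum_(i < 3) (2 * ipO (G n j i) (G n j i) + 2 * ipO (G m j i) (G m j i)))).
  apply: ler_sum => i _.
  apply: (@le_trans _ _ (2 * ipb b (G n j i) (G n j i) + 2 * ipb b (G m j i) (G m j i))).
    have := ip_sqrD_le (mb b) (sG n i) (sqN (mb b) (sG m i)).
    have -> : ipb b (fun x => - G m j i x) (fun x => - G m j i x) = ipb b (G m j i) (G m j i).
      by apply: eq_Rintegral => x _; rewrite mulrNN.
    by [].
  have := ip_mono (mb b) mO bO (gu n j i).1; have := ip_mono (mb b) mO bO (gu m j i).1.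
  by lra.
rewrite big_split/= -!mulr_sumr; have := GM n j; have := GM m j.
have := ler_norm M; rewrite /M'; lra.
Qed.

(** Finitely many boxes fill the domain up to a part of small volume, where the
    pointwise bound is enough. *)
Lemma ultra_domain (e : R) : 0 < e ->
  exists2 A, F A & forall n m j, A n -> A m -> ipO (D n m j) (D n m j) <= e.
Proof.
move=> e0; have [lo [hi [cO OE]]] := open_box_cover oO.
pose A i := box (lo i) (hi i).
have mA i : @measurable _ T3 (A i) by exact: measurable_box.
have AO i : A i `<=` Om by move=> x /box_cbox; exact: cO.
pose E p := Om `\` \big[setU/set0]_(i < p) A i.
have mE p : @measurable _ T3 (E p).
  by apply: measurableD => //; apply: bigsetU_measurable => i _; exact: mA.
have Ecvg : vol (E p) @[p --> \oo] --> 0%E.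
  have E0 : \bigcap_p E p = set0.
    apply/seteqP; split => // x hx; have [Ox _] := hx 0%N I.
    move: (Ox); rewrite OE => -[i _ Aix]; have [_ +] := hx i.+1 I; apply.
    by rewrite big_ord_recr/=; right.
  rewrite -(@measure0 _ T3 R vol) -E0.
  apply: nonincreasing_cvg_mu => //.
  - by rewrite /E big_ord0 setD0.
  - by rewrite E0; exact: measurable0.
  - apply/nonincreasing_seqP => p; apply/subsetPset => x [Ox nx]; split => // hx.
    by apply: nx; rewrite big_ord_recr/=; left.
(* A difference of two maps is at most $2$, so its square has integral at most
   [4 * (e / 8)] over [E p]. *)
have [p hp] : exists p, fine (vol (E p)) <= e / 8.
  have e8 : 0 < e / 8 by rewrite divr_gt0.
  have Efine : fine (vol (E p)) @[p --> \oo] --> (0 : R) by exact: (fine_cvg Ecvg).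
  move/cvgrPdist_le : Efine => /(_ _ e8)[p _ /(_ p (leqnn p))].
  by rewrite /= sub0r normrN => h; exists p; apply: le_trans (ler_norm _) h.
have EO : E p `<=` Om by move=> x [].
have E_fin : (vol (E p) < +oo)%E by apply: le_lt_trans O_fin; apply: le_measure; rewrite ?inE.
have boxc (i : nat) : exists2 B, F B & forall n m j, B n -> B m ->
    @ip _ T3 R vol (A i) (D n m j) (D n m j) <= e / 2 / (p%:R + 1).
  have d0 : 0 < e / 2 / (p%:R + 1) by rewrite !divr_gt0// ltr_wpDl.
  have [w|nw] := pselect (forall j, lo i j < hi i j).
    pose b : BX := ([ffun j => lo i j], [ffun j => hi i j]).
    have wb : wf b by move=> j; rewrite !ffunE.
    have bE : bset b = A i by congr box; apply/funext => j; rewrite ffunE.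
    have cb : cbox b.1 b.2 `<=` Om.
      by move=> x hx; apply: (cO i) => j; have := hx j; rewrite !ffunE.
    by have := ultra_box wb cb d0; rewrite bE.
  exists setT; first exact: filterT.
  move=> n m j _ _; have -> : A i = set0.
    apply/seteqP; split => // x hx; apply: nw => i'; have [h1 h2] := hx i'.
    exact: lt_le_trans h2.
  by rewrite /ip Rintegral_set0 ltW.
have [B FB hB] : exists2 B : nat -> set nat, forall i, F (B i) &
    forall i n m j, B i n -> B i m ->
    @ip _ T3 R vol (A i) (D n m j) (D n m j) <= e / 2 / (p%:R + 1).
  have [B hB] := choice (fun i => let: ex_intro2 B FB hB := boxc i in
    ex_intro (fun B => F B /\ forall n m j, B n -> B m ->
    @ip _ T3 R vol (A i) (D n m j) (D n m j) <= e / 2 / (p%:R + 1)) B (conj FB hB)).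
  by exists B => i; [exact: (hB i).1|exact: (hB i).2].
exists [set n | forall i, i \in iota 0 p -> B i n].
  by apply: filter_all => i _; exact: FB.
move=> n m j hn hm.
have sD : sqO (D n m j) by exact: sqB.
have cov x : Om x -> (exists2 i, (i < p)%N & A i x) \/ E p x.
  move=> Ox; have [h|h] := pselect ((\big[setU/set0]_(i < p) A i) x); last by right.
  by left; move: h; rewrite -bigcup_mkord => -[i /= ip Ax]; exists i.
apply: (le_trans (ip_cover mO mA (mE p) AO EO cov sD)).
have -> : e = e / 2 + e / 2 by field.
apply: lerD.
  apply: (@le_trans _ _ (\sum_(i < p) e / 2 / (p%:R + 1))).
    by apply: ler_sum => i _; apply: hB; [apply: hn|apply: hm]; rewrite mem_iota/= add0n.
  rewrite sumr_const card_ord -[_ *+ p]mulr_natr mulrAC ler_pdivrMr ?ltr_wpDl//.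
  by rewrite ler_wpM2l ?divr_ge0 ?(ltW e0)// lerDl.
have := @ae_bounded_ip _ T3 R vol (E p) (mE p) E_fin (D n m j) 2 (sqS (mE p) mO EO sD).
move=> h; apply: (le_trans (h _)); last by lra.
move: (u1 n j) (u1 m j); apply: filterS2 => x h1 h2 /EO Ox.
by rewrite /D (le_trans (ler_normB _ _))//; have := h1 Ox; have := h2 Ox; lra.
Qed.

End UltraCompact.

(** The Cauchy property along the ultrafilter is turned into a subsequence by
    picking indices in a decreasing sequence of sets of the ultrafilter. The uniform
    bound on the maps takes the place of any regularity of the boundary. *)
Lemma rellich (J : finType) (u : nat -> J -> T -> R)
    (G : nat -> J -> 'I_3 -> T -> R) (M : R) :
  (forall n j, sqO (u n j)) -> (forall n j, isgrad (u n j) (G n j)) ->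
  (forall n j, \sum_(i < 3) ipO (G n j i) (G n j i) <= M) ->
  (forall n j, {ae vol, forall x, Om x -> `|u n j x| <= 1}) ->
  exists (phi : nat -> nat) (v : J -> T -> R),
    [/\ forall k, (k <= phi k)%N, forall j, sqO (v j) &
       forall j, ipO (fun x => u (phi k) j x - v j x) (fun x => u (phi k) j x - v j x)
         @[k --> \oo] --> (0 : R)].
Proof.
move=> su gu GM u1.
have [F [FU sF]] := @ultraFilterLemma nat \oo _.
have FF : ProperFilter F by exact: ultra_proper.
have ek (k : nat) : 0 < (k.+1%:R : R)^-1 by rewrite invr_gt0.
have [A hA] := choice (fun k => let: ex_intro2 A FA hA :=
    ultra_domain su gu GM u1 FU (ek k) in
  ex_intro (fun A => F A /\ forall n m j, A n -> A m ->
    ipO (fun x => u n j x - u m j x) (fun x => u n j x - u m j x) <= k.+1%:R^-1)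
    A (conj FA hA)).
have FB k : F [set n | (k <= n)%N /\ forall i, i \in iota 0 k.+1 -> A i n].
  apply: filterI; first by apply: sF; exists k.
  by apply: filter_all => i _; exact: (hA i).1.
have [phi hphi] := choice (fun k => filter_ex (FB k)).
have Aphi i k : (i <= k)%N -> A i (phi k).
  by move=> ik; apply: (hphi k).2; rewrite mem_iota/= add0n ltnS.
have cau j : exists2 v, sqO v & ipO (fun x => u (phi k) j x - v x)
    (fun x => u (phi k) j x - v x) @[k --> \oo] --> (0 : R).
  apply: (@sq_complete _ T3 R vol Om mO O_fin (fun k => u (phi k) j)) => // e e0.
  have [K _ hK] := near_infty_natSinv_lt (PosNum e0).
  exists K => n m Kn Km.
  apply: (le_trans _ (ltW (hK K (leqnn K)))).
  by apply: (hA K).2; exact: Aphi.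
have [v hv] := choice (fun j => let: ex_intro2 v sv cv := cau j in
  ex_intro (fun v => sqO v /\ ipO (fun x => u (phi k) j x - v x)
    (fun x => u (phi k) j x - v x) @[k --> \oo] --> (0 : R)) v (conj sv cv)).
exists phi, v; split.
- by move=> k; exact: (hphi k).1.
- by move=> j; exact: (hv j).1.
- by move=> j; exact: (hv j).2.
Qed.


End Compactness.


(** * Lower semicontinuity of the Dirichlet energy *)

Lemma cvg_sumS (R : realType) (I : Type) (s : seq I) (f : nat -> I -> R) (l : I -> R) :
  (forall i, f n i @[n --> \oo] --> l i) ->
  \sum_(i <- s) f n i @[n --> \oo] --> \sum_(i <- s) l i.
Proof.
move=> h; elim: s => [|i s ih].
  by rewrite big_nil; under eq_fun do rewrite big_nil; exact: cvg_cst.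
by rewrite big_cons; under eq_fun do rewrite big_cons; exact: cvgD.
Qed.

Lemma cvg_invS (R : realType) : ((n.+1%:R : R)^-1) @[n --> \oo] --> (0 : R).
Proof. exact: cvg_harmonic. Qed.

Section LowerSemicontinuity.
Context {R : realType}.
Local Notation vol := (@vol R).
Local Notation T := (R * R * R)%type.
Local Notation T3 := (measurableTypeR R * measurableTypeR R * measurableTypeR R)%type.
Variable Om : set T.
Hypotheses (oO : open Om) (O_fin : (vol Om < +oo)%E).
Local Notation sqO := (@sq _ T3 R vol Om).
Local Notation ipO := (@ip _ T3 R vol Om).
Local Notation isgrad := (isgrad Om).
Let mO : @measurable _ T3 Om. Proof. exact: open_measurable3. Qed.

Variable J : finType.
Local Notation cfg := (J -> T -> R).
Local Notation gcfg := (J -> 'I_3 -> T -> R).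
Implicit Types (u v w : cfg) (G H : gcfg).

Definition qform G : R := \sum_j \sum_(i < 3) ipO (G j i) (G j i).

Lemma qform_ge0 G : 0 <= qform G.
Proof.
by apply: sumr_ge0 => j _; apply: sumr_ge0 => i _; exact: (ip_ge0 vol Om).
Qed.

Lemma qform_ge G j i : ipO (G j i) (G j i) <= qform G.
Proof.
rewrite /qform (bigD1 j)//= (bigD1 i)//= -addrA lerDl addr_ge0//.
  by apply: sumr_ge0 => k _; exact: (ip_ge0 vol Om).
by apply: sumr_ge0 => k _; apply: sumr_ge0 => l _; exact: (ip_ge0 vol Om).
Qed.

Lemma qform_para G H : (forall j i, sqO (G j i)) -> (forall j i, sqO (H j i)) ->
  qform (fun j i x => G j i x - H j i x) = 2 * qform G + 2 * qform H -
  4 * qform (fun j i x => 2^-1 * G j i x + 2^-1 * H j i x).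
Proof.
move=> sG sH; rewrite /qform !mulr_sumr -big_split/= -sumrB; apply: eq_bigr => j _.
rewrite !mulr_sumr -big_split/= -sumrB; apply: eq_bigr => i _.
rewrite ip_sqrB// ip_sqrD; [|exact: mO|exact: sqZ|exact: sqZ].
rewrite !ipZl ?ipZr//; [|exact: sqZ|exact: sqZ|exact: sqZ].
by field.
Qed.

(** Weak lower semicontinuity of the energy. Almost minimizers of the energy on
    the convex sets of $H^1$ maps that are $L^2$-close to [v] form a Cauchy
    sequence by the parallelogram law, and its limit is the gradient of [v]. *)
Lemma energy_lsc (un : nat -> cfg) (Gn : nat -> gcfg) v (M : R) :
  (forall n j, sqO (un n j)) -> (forall n j, isgrad (un n j) (Gn n j)) ->
  (forall j, sqO (v j)) ->
  (forall j, ipO (fun x => un n j x - v j x) (fun x => un n j x - v j x)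
     @[n --> \oo] --> (0 : R)) ->
  (forall n, qform (Gn n) <= M) ->
  exists2 H, (forall j, isgrad (v j) (H j)) & qform H <= M.
Proof.
move=> sun gun sv cun qM.
pose e (n : nat) : R := n.+1%:R^-1.
have e0 n : 0 < e n by rewrite invr_gt0.
have ee n m : (n <= m)%N -> e m <= e n.
  by move=> nm; rewrite lef_pV2 ?posrE// ler_nat ltnS.
pose C n (p : cfg * gcfg) := [/\ forall j, sqO (p.1 j),
  forall j, isgrad (p.1 j) (p.2 j) &
  forall j, ipO (fun x => p.1 j x - v j x) (fun x => p.1 j x - v j x) <= e n].
have CS n m p : (n <= m)%N -> C m p -> C n p.
  by move=> nm [h1 h2 h3]; split => // j; apply: le_trans (ee _ _ nm).
have Cun n : exists k, C n (un k, Gn k).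
  have h j : \forall k \near \oo,
      ipO (fun x => un k j x - v j x) (fun x => un k j x - v j x) <= e n.
    move/cvgrPdist_le : (cun j) => /(_ _ (e0 n)); apply: filterS => k.
    by rewrite sub0r normrN; apply: le_trans; exact: ler_norm.
  have [k hk] : exists k, forall j, j \in enum J ->
      ipO (fun x => un k j x - v j x) (fun x => un k j x - v j x) <= e n.
    by apply: (@filter_ex _ \oo); apply: filter_all => j _; exact: h.
  exists k; split => //= j.
  by apply: hk; rewrite mem_enum.
pose S n := [set qform p.2 | p in C n].
have infS n : has_inf (S n).
  split; first by have [k hk] := Cun n; exists (qform (Gn k)), (un k, Gn k).
  by exists 0 => _ [p _ <-]; exact: qform_ge0.
(* The infimum of the energy over the maps that are [e n]-close to [v]. *)
pose d n := inf (S n).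
have d_le n p : C n p -> d n <= qform p.2.
  by move=> hp; apply: ge_inf; [exact: (infS n).2|exists p].
have dM n : d n <= M.
  by have [k hk] := Cun n; apply: le_trans (qM k); exact: (d_le n (un k, Gn k)).
have nd : nondecreasing_seq d.
  move=> n m nm; apply: lb_le_inf; first exact: (infS m).1.
  by move=> _ [p hp <-]; apply: d_le; exact: CS hp.
have dcvg : cvgn d.
  apply: nondecreasing_is_cvgn => //.
  by exists M => _ [n _ <-].
have pk n : exists p, C n p /\ qform p.2 <= d n + e n.
  have [_ [p hp <-] hpe] := inf_adherent (e0 n) (infS n).
  by exists p; split=> //; exact: ltW.
have [p hp] := choice pk.
have sH n j i : sqO ((p n).2 j i) by have [[_ h _] _] := hp n; exact: (h j i).1.
(* The midpoint of two competitors at level [n] is one, so its energy is at least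
   [d n]. *)
have key n m : (n <= m)%N ->
    qform (fun j i x => (p n).2 j i x - (p m).2 j i x) <=
    2 * (d m - d n) + 4 * e n.
  move=> nm; rewrite qform_para//.
  have [[s1 g1 c1] q1] := hp n; have [[s2 g2 c2] q2] := hp m.
  pose q : cfg * gcfg := (fun j x => 2^-1 * (p n).1 j x + 2^-1 * (p m).1 j x,
    fun j i x => 2^-1 * (p n).2 j i x + 2^-1 * (p m).2 j i x).
  have Cq : C n q.
    split => j /=.
    - by apply: sqD => //; exact: sqZ.
    - by apply: isgradD => //; [exact: sqZ|exact: sqZ|exact: isgradZ|exact: isgradZ].
    have sa : sqO (fun x => (p n).1 j x - v j x) by exact: sqB.
    have sb : sqO (fun x => (p m).1 j x - v j x) by exact: sqB.
    have := ip_sqrD_le mO (sqZ mO 2^-1 sa) (sqZ mO 2^-1 sb).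
    rewrite !ip_sqrZ//.
    have -> : (fun x => 2^-1 * ((p n).1 j x - v j x) + 2^-1 * ((p m).1 j x - v j x)) =
        (fun x => 2^-1 * (p n).1 j x + 2^-1 * (p m).1 j x - v j x).
      by apply/funext => x; field.
    move=> h; apply: (le_trans h); have := c1 j; have := c2 j; have := ee _ _ nm; lra.
  have := d_le _ _ Cq; rewrite /=; have := ee _ _ nm; lra.
have cauchy j i : exists2 h, sqO h & ipO (fun x => (p n).2 j i x - h x)
    (fun x => (p n).2 j i x - h x) @[n --> \oo] --> (0 : R).
  apply: (@sq_complete _ T3 R vol Om mO O_fin (fun n => (p n).2 j i)) => // eps eps0.
  have e8 : 0 < eps / 8 by rewrite divr_gt0.
  have [K1 _ h1] : \forall n \near \oo, `|limn d - d n| <= eps / 8.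
    by move/cvgrPdist_le : dcvg; exact.
  have [K2 _ h2] := near_infty_natSinv_lt (PosNum e8).
  have half n m : (maxn K1 K2 <= n)%N -> (n <= m)%N ->
      ipO (fun x => (p n).2 j i x - (p m).2 j i x) (fun x => (p n).2 j i x - (p m).2 j i x) <= eps.
    rewrite geq_max => /andP[k1 k2] nm.
    apply: le_trans (qform_ge (fun j i x => (p n).2 j i x - (p m).2 j i x) j i) _.
    apply: (le_trans (key _ _ nm)).
    have := h1 n k1; have := h1 m (leq_trans k1 nm); have := h2 n k2.
    rewrite /= -/(e n) !ler_norml => ? /andP[? ?] /andP[? ?]; lra.
  exists (maxn K1 K2) => n m Kn Km; have [nm|/ltnW mn] := leqP n m; first exact: half.
  by rewrite ip_sqr_sym; exact: half.
have [H hH] := choice (fun ji : J * 'I_3 => let: ex_intro2 h sh ch := cauchy ji.1 ji.2 in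
  ex_intro (fun h => sqO h /\ ipO (fun x => (p n).2 ji.1 ji.2 x - h x)
    (fun x => (p n).2 ji.1 ji.2 x - h x) @[n --> \oo] --> (0 : R)) h (conj sh ch)).
exists (fun j i => H (j, i)).
  move=> j; apply: (@isgrad_cvg _ _ oO O_fin (fun n => (p n).1 j) (v j) (fun n => (p n).2 j)) => //.
  - by move=> n; have [[h _ _] _] := hp n; exact: h.
  - by move=> n; have [[_ h _] _] := hp n; exact: h.
  - by move=> i; exact: (hH (j, i)).1.
  - apply: (@squeeze_cvgr _ _ _ _ (fun=> 0) e); [|exact: cvg_cst|exact: cvg_invS].
    by apply: nearW => n; rewrite (ip_ge0 vol Om)/=; have [[_ _ h] _] := hp n; exact: h.
  - by move=> i; exact: (hH (j, i)).2.
have cq : qform (p n).2 @[n --> \oo] --> qform (fun j i => H (j, i)).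
  apply: cvg_sumS => j; apply: cvg_sumS => i.
  apply: (cvg_ip_sqr mO) => //; first exact: (hH (j, i)).1.
  exact: (hH (j, i)).2.
have h : qform (p n).2 - e n @[n --> \oo] --> qform (fun j i => H (j, i)).
  by rewrite -[X in _ --> X]subr0; apply: cvgB => //; exact: cvg_invS.
apply: (cvgn_le h) => n /=.
by have [_ q] := hp n; have := dM n; rewrite -/(e n); lra.
Qed.

End LowerSemicontinuity.


(** * Integrals of partial derivatives *)

Lemma int_derivative_eq0 (R : realType) (a a' : R -> R) (l r : R) : l < r ->
  (forall t, is_derive t (1 : R) a (a' t)) -> continuous a' ->
  (forall t, t <= l \/ r <= t -> a t = 0 /\ a' t = 0) ->
  (\int[@lebesgue_measure R]_t (a' t)%:E = 0)%E.
Proof.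
move=> lr da ca' a0.
have ca := is_derive_continuous da.
have h : (\int[@lebesgue_measure R]_(t in `[l, r]) (a' t)%:E = (a r)%:E - (a l)%:E)%E.
  apply: continuous_FTC2 => //; first exact: continuous_subspaceT.
    split.
    - by move=> t _; case: (da t).
    - by apply: cvg_at_right_filter; exact: ca.
    - by apply: cvg_at_left_filter; exact: ca.
  by move=> t _; rewrite derive1E; case: (da t).
rewrite (a0 l (or_introl (lexx l))).1 (a0 r (or_intror (lexx r))).1 subee// in h.
rewrite -[RHS]h [RHS]integral_mkcond; apply: eq_integral => t _.
rewrite patchE; case: ifPn => //; rewrite notin_setE /= in_itv/= => /negP.
rewrite negb_and -!ltNge => /orP ht.
have {}ht : t <= l \/ r <= t by case: ht => /ltW; [left|right].
by rewrite (a0 t ht).2.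
Qed.

Section SigmaFiniteProduct.
Context d1 d2 (T1 : measurableType d1) (T2 : measurableType d2) (R : realType).
Variable m1 : {sigma_finite_measure set T1 -> \bar R}.
Variable m2 : {sigma_finite_measure set T2 -> \bar R}.

(** An alias of the product measure on which $\sigma$-finiteness can be
    declared: on [m1 \x m2] itself, the canonical structure found first is the
    one for products of subprobabilities. *)
Definition prod2 : set (T1 * T2) -> \bar R := (m1 \x m2)%E.

HB.instance Definition _ := Measure.on prod2.

Lemma prod2_sigma_finite : sigma_finite setT prod2.
Proof.
have [F TF hF] := sigma_finiteT m1; have [G TG hG] := sigma_finiteT m2.
exists (fun n => if unpickle n is Some (i, j) then F i `*` G j else set0).
  apply/esym/seteqP; split=> // -[x y] _.
  have [i _ Fix] : (\bigcup_k F k) x by rewrite -TF.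
  have [j _ Gjy] : (\bigcup_k G k) y by rewrite -TG.
  by exists (pickle (i, j)) => //; rewrite pickleK.
move=> k; case: (unpickle k) => [[i j]|]; last by rewrite measure0.
have [mF Fi] := hF i; have [mG Gj] := hG j; split; first exact: measurableX.
by rewrite /prod2 product_measure1E// lte_mul_pinfty// ge0_fin_numE.
Qed.

HB.instance Definition _ :=
  Measure_isSigmaFinite.Build _ _ _ prod2 prod2_sigma_finite.

End SigmaFiniteProduct.

Section Fubini3.
Local Open Scope ereal_scope.
Context d1 d2 d3 (T1 : measurableType d1) (T2 : measurableType d2)
  (T3 : measurableType d3) (R : realType).
Variable m1 : {sigma_finite_measure set T1 -> \bar R}.
Variable m2 : {sigma_finite_measure set T2 -> \bar R}.
Variable m3 : {sigma_finite_measure set T3 -> \bar R}.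
Variable w : T1 * T2 * T3 -> \bar R.
Hypothesis iw : (prod2 m1 m2 \x m3).-integrable setT w.

Lemma fubini3_eq0_3 : (forall p, \int[m3]_z w (p, z) = 0) ->
  \int[prod2 m1 m2 \x m3]_p w p = 0.
Proof.
move=> h; rewrite -(integral12_prod_meas1 iw) -[RHS](integral0 (prod2 m1 m2) setT).
by apply: eq_integral => p _; exact: h.
Qed.

Lemma fubini3_eq0_2 : (forall x z, \int[m2]_y w (x, y, z) = 0) ->
  \int[prod2 m1 m2 \x m3]_p w p = 0.
Proof.
move=> h; rewrite -(integral21_prod_meas1 iw) -[RHS](integral0 m3 setT).
apply: ae_eq_integral => //; first exact: (measurable_fubini_G iw).
have := ae_integrable2 iw; apply: filterS => z iz _.
rewrite /fubini_G -(integral12_prod_meas1 iz) -[RHS](integral0 m1 setT).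
by apply: eq_integral => x _; exact: h.
Qed.

Lemma fubini3_eq0_1 : (forall y z, \int[m1]_x w (x, y, z) = 0) ->
  \int[prod2 m1 m2 \x m3]_p w p = 0.
Proof.
move=> h; rewrite -(integral21_prod_meas1 iw) -[RHS](integral0 m3 setT).
apply: ae_eq_integral => //; first exact: (measurable_fubini_G iw).
have := ae_integrable2 iw; apply: filterS => z iz _.
rewrite /fubini_G -(integral21_prod_meas1 iz) -[RHS](integral0 m2 setT).
by apply: eq_integral => x _; exact: h.
Qed.

End Fubini3.

Section DivergenceFree.
Context {R : realType}.
Local Notation vol := (@vol R).
Local Notation leb := (@lebesgue_measure R).
Local Notation T := (R * R * R)%type.
Local Notation T3 := (measurableTypeR R * measurableTypeR R * measurableTypeR R)%type.
Implicit Types (v w u : T -> R) (x y : T).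

Definition setcrd j (t : R) x : T :=
  (if j == j0 then t else x.1.1, if j == j1 then t else x.1.2, if j == j2 then t else x.2).

Lemma crd_setcrd i j t x : crd i (setcrd j t x) = if j == i then t else crd i x.
Proof. by move: i j; apply: I3P; apply: I3P. Qed.

Lemma crd_inj x y : (forall i, crd i x = crd i y) -> x = y.
Proof.
case: x => -[a b] c; case: y => -[a' b'] c' h.
by move: (h j0) (h j1) (h j2); rewrite /crd/= => -> -> ->.
Qed.

Lemma is_derive_setcrd v w j x : (forall y, is_derive y (basis3 j : T) v (w y)) ->
  forall t, is_derive t (1 : R) (fun s => v (setcrd j s x)) (w (setcrd j t x)).
Proof.
move=> dv t.
have h : h^-1 *: (v (setcrd j (h *: 1 + t) x) - v (setcrd j t x)) @[h --> (0:R)^'] -->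
    w (setcrd j t x).
  have [dd vd] := dv (setcrd j t x); rewrite -vd.
  rewrite (_ : (fun h : R => _) = (fun h : R => h^-1 *: (v (h *: (basis3 j : T) + setcrd j t x) - v (setcrd j t x)))).
    exact: dd.
  apply/funext => h; congr (_ *: (v _ - _)); apply: crd_inj => i.
  rewrite crd_setcrd crd_shift crd_setcrd eq_sym /GRing.scale/= mulr1.
  by case: eqP => _; rewrite ?mulr1 ?mulr0 ?add0r.
apply: DeriveDef; first by apply/cvg_ex; eexists; exact: h.
by apply/cvg_lim => //; exact: norm_hausdorff.
Qed.

Lemma continuous_setcrd j x : continuous (fun t : R => setcrd j t x).
Proof.
move=> t; apply/cvg_ballP => e e0; near=> s; apply/ballP => i.
rewrite !crd_setcrd; case: eqP => _; last by rewrite subrr normr0.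
by near: s; exact: (@cvgr_dist_lt _ _ _ _ _ id t cvg_id).
Unshelve. all: by end_near.
Qed.

(** Fubini's theorem, integrating first in the direction of the derivative. *)
Lemma int_partial_eq0 v w j (n : R) : 0 < n ->
  (forall x, is_derive x (basis3 j : T) v (w x)) -> continuous w ->
  (forall x, (exists i, ~ (- n < crd i x < n)) -> v x = 0 /\ w x = 0) ->
  \int[vol]_x w x = 0.
Proof.
move=> n0 dv cw vw0.
have line x : (\int[leb]_t (w (setcrd j t x))%:E = 0)%E.
  apply: (@int_derivative_eq0 R (fun t => v (setcrd j t x)) _ (- n) n).
  - lra.
  - by move=> t; exact: is_derive_setcrd.
  - move=> t; apply: (@continuous_comp _ _ _ (fun t : R => setcrd j t x) w).
      exact: continuous_setcrd.
    exact: cw.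
  - move=> t ht; apply: vw0; exists j; rewrite crd_setcrd eqxx => /andP[? ?].
    by case: ht; rewrite leNgt => /negP.
have mw : @measurable_fun _ _ T3 _ setT (EFin \o w).
  by apply/measurable_EFinP; exact: continuous_measurable3.
have iw : vol.-integrable setT (EFin \o w).
  set B := box (fun=> - n) (fun=> n) : set T.
  have mB : @measurable _ T3 B by exact: measurable_box.
  have w0 x : ~ B x -> w x = 0.
    move=> /existsNP[i hi]; apply: (vw0 x _).2; exists i => /andP[h1 h2]; apply: hi.
    by split=> //; exact: ltW.
  have cK := @compact_cbox R (fun=> - n) (fun=> n).
  have [M hM] := bounded_of_support cw cK (fun x nK => w0 x (fun h => nK (box_cbox h))).
  have iB : vol.-integrable B (EFin \o w).
    apply: (@measurable_bounded_integrable _ T3 R vol) => //.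
    - exact: vol_box_fin.
    - exact: continuous_measurable3.
    - by exists M; split; [exact: num_real|move=> M' hM' x _; exact: le_trans (hM x) (ltW hM')].
  have := (@integrable_mkcond _ T3 R vol B (EFin \o w) mB).1 iB.
  apply: eq_integrable => // x _; rewrite patchE; case: ifPn => //.
  by rewrite notin_setE => /w0 /= ->.
have zero : (\int[vol]_x (w x)%:E = 0)%E.
  have iw' : (prod2 leb leb \x leb)%E.-integrable setT (EFin \o w) by exact: iw.
  move: j line {dv}; apply: I3P => line.
  - by apply: (fubini3_eq0_1 iw') => y z; exact: (line (0, y, z)).
  - by apply: (fubini3_eq0_2 iw') => x z; exact: (line (x, 0, z)).
  - by apply: (fubini3_eq0_3 iw') => p; have := line (p, 0); case: p.
by rewrite /Rintegral zero.
Qed.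

End DivergenceFree.


(** * Classical and weak derivatives *)

Section Classical.
Context {R : realType}.
Local Notation vol := (@vol R).
Local Notation T := (R * R * R)%type.
Local Notation T3 := (measurableTypeR R * measurableTypeR R * measurableTypeR R)%type.
Variable Om : set T.
Hypotheses (oO : open Om) (O_fin : (vol Om < +oo)%E).
Local Notation sqO := (@sq _ T3 R vol Om).
Local Notation ipO := (@ip _ T3 R vol Om).
Let mO : @measurable _ T3 Om. Proof. exact: open_measurable3. Qed.

Lemma continuous_on_measurable (f : T -> R) : (forall x, Om x -> {for x, continuous f}) ->
  @measurable_fun _ _ T3 R Om f.
Proof.
move=> cf; apply: (measurability _ (RGenOInfty.measurableE R)).
move=> _ [_ [a ->] <-]; apply: open_measurable3.
rewrite openE => x [Ox fx]; apply: filterI; first exact: open_nbhs_nbhs.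
by apply: (cf x Ox); apply: open_nbhs_nbhs; split => //; exact: rray_open.
Qed.

Lemma compact_crd_bounded (K : set T) : compact K ->
  exists2 n : R, 0 < n & forall x, K x -> forall i, - n < crd i x < n.
Proof.
move=> cK.
have h i : exists M : R, forall x, K x -> `|crd i x| <= M.
  have : compact (crd i @` K).
    apply: continuous_compact => //; apply: continuous_subspaceT.
    exact: continuous_crd.
  by move/compact_bounded => [M [_ hM]]; exists (M + 1) => x Kx; apply: hM; [lra|exists x].
have [M hM] := choice h.
exists (1 + `|M j0| + `|M j1| + `|M j2|) => [|x Kx i].
  by have := normr_ge0 (M j0); have := normr_ge0 (M j1); have := normr_ge0 (M j2); lra.
have : `|crd i x| <= `|M j0| + `|M j1| + `|M j2|.
  apply: le_trans (hM i x Kx) _; apply: le_trans (ler_norm _) _.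
  move: i; apply: I3P; have := normr_ge0 (M j0); have := normr_ge0 (M j1);
  have := normr_ge0 (M j2); lra.
by rewrite ler_norml => /andP[? ?]; apply/andP; split; lra.
Qed.

(** The product of [u] with a test function has compact support, so its derivative
    has integral zero. *)
Lemma wpart_classical j (u du : T -> R) :
  (forall x, Om x -> is_derive x (basis3 j : T) u (du x)) ->
  (forall x, Om x -> {for x, continuous u}) ->
  (forall x, Om x -> {for x, continuous du}) ->
  sqO u -> sqO du -> wpart Om j u du.
Proof.
move=> Du cu cdu su sdu phi tphi.
have [sp sD] := test_sq oO O_fin j tphi.
have [smooth cK KO] := tphi; set K := closure _ in cK KO.
have [c0 d0] := smooth 1%N; have [dphi [c1 _]] := d0 j.
pose dp x := 'D_(basis3 j) phi x.
have oK : open (~` K) by apply: closed_openC; exact: closed_closure.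
have p0 x : ~ K x -> phi x = 0.
  by move=> nK; apply: contrapT => /eqP h; apply: nK; exact: subset_closure.
have nearK x : ~ K x -> \forall y \near x, ~ K y.
  by move=> nK; apply: open_nbhs_nbhs; split.
have p1 x : ~ K x -> dp x = 0.
  move=> nK; rewrite /dp (_ : 'D_(basis3 j) phi x = 'D_(basis3 j) (cst 0 : T -> R) x).
    exact: derive_cst.
  apply: near_eq_derive; apply: filterS (nearK x nK) => y /p0 -> //.
pose v x := u x * phi x; pose w x := u x * dp x + phi x * du x.
have dv x : is_derive x (basis3 j : T) v (w x).
  have [Ox|nO] := pselect (Om x).
    have hphi : is_derive x (basis3 j : T) phi (dp x).
      by apply: DeriveDef => //; exact: dphi.
    exact: (is_deriveM (Du x Ox) hphi).
  have nK : ~ K x by move/KO.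
  rewrite /w p0// p1// mulr0 mul0r addr0.
  have ne : \near x, (cst 0 : T -> R) x = v x.
    by apply: filterS (nearK x nK) => y /p0 h; rewrite /v h mulr0.
  by apply: (near_eq_is_derive ne); exact: is_derive_cst.
have cw : continuous w.
  move=> x; have [Ox|nO] := pselect (Om x).
    by apply: cvgD; apply: cvgM; [exact: cu|exact: c1|exact: c0|exact: cdu].
  have nK : ~ K x by move/KO.
  rewrite /continuous_at /w p0// p1// mulr0 mul0r addr0; apply: cvg_near_cst.
  by apply: filterS (nearK x nK) => y nKy; rewrite /w p0// p1// mulr0 mul0r addr0.
have [n n0 Kn] := compact_crd_bounded cK.
have w0 x : ~ K x -> w x = 0 by move=> nK; rewrite /w p0// p1// mulr0 mul0r addr0.
have : \int[vol]_x w x = 0.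
  apply: (int_partial_eq0 n0 dv cw) => x [i ni].
  have nK : ~ K x by move=> Kx; apply: ni; exact: Kn.
  by split; [rewrite /v p0// mulr0|exact: w0].
have -> : \int[vol]_x w x = \int[vol]_(x in Om) w x.
  by apply: int_supp => // x nO; apply: w0 => /KO.
rewrite /w RintegralD//; [|exact: (sqM mO su sD)|exact: (sqM mO sp sdu)].
have -> : \int[vol]_(x in Om) (phi x * du x) = ipO du phi by exact: ipC.
by move/eqP; rewrite addr_eq0 => /eqP.
Qed.

End Classical.

Section Bridge.
Context {R : realType}.
Local Notation vol := (@vol R).
Local Notation T := (R * R * R)%type.
Local Notation T3 := (measurableTypeR R * measurableTypeR R * measurableTypeR R)%type.
Variable Om : set T.
Hypotheses (oO : open Om) (O_fin : (vol Om < +oo)%E).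
Local Notation sqO := (@sq _ T3 R vol Om).
Local Notation ipO := (@ip _ T3 R vol Om).
Local Notation isgrad := (isgrad Om).
Let mO : @measurable _ T3 Om. Proof. exact: open_measurable3. Qed.
Implicit Types (u v g : T -> 'rV[R]_3).

Definition cmp u (k : 'I_3) x : R := u x ord0 k.

Lemma Lfun_sq (f : T -> R) : f \_ Om \in Lfun vol 2%:E <-> sqO f.
Proof.
split=> [hf|[mf f2]].
  have i2 := Lfun2_integrable_sqr hf.
  move: hf; rewrite inE => /andP[]; rewrite inE/= => mf _.
  split; first by apply/(measurable_restrictT f mO).
  apply/(@integrable_mkcond _ T3 R vol Om _ mO).
  move: i2; apply: eq_integrable => // x _; rewrite /= !patchE.
  by case: ifP => //=; rewrite expr0n.
rewrite inE; apply/andP; split; rewrite inE/=.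
  by apply/(measurable_restrictT f mO).
apply: (@lty_poweRy _ _ 2) => //; rewrite poweR_Lnorm//.
have /integrableP[_] := (@integrable_mkcond _ T3 R vol Om _ mO).1 f2.
apply: le_lt_trans; rewrite le_eqVlt; apply/orP; left; apply/eqP.
apply: eq_integral => x _.
rewrite /= !patchE; case: ifP => _ /=.
  by rewrite [in RHS]ger0_norm ?sqr_ge0// powR_mulrn// real_normK ?num_real.
by have -> : (point : R) = 0 by []; rewrite !normr0 powR0.
Qed.

Lemma L2P u : L2 Om u <-> forall k, sqO (cmp u k).
Proof. by split=> h k; apply/Lfun_sq; exact: (h k). Qed.

Lemma is_weak_partialP j u g : is_weak_partial Om j u g <->
  (forall k, sqO (cmp g k)) /\ forall k, wpart Om j (cmp u k) (cmp g k).
Proof.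
split=> -[h1 h2].
  by split; [apply/L2P|move=> k phi tp; exact: (h2 k phi tp)].
by split; [apply/L2P|move=> k phi tp; exact: (h2 k phi tp)].
Qed.

(** Entry [k, j] of the chosen Jacobian matrix: component [k], direction [j]. *)
Definition gr u (k j : 'I_3) : T -> R := cmp (weak_partial Om j u) k.

Lemma H1_sq u k : H1 Om u -> sqO (cmp u k).
Proof. by move=> [/L2P h _]. Qed.

Lemma H1_grad u k : H1 Om u -> isgrad (cmp u k) (gr u k).
Proof.
move=> [_ h] j; have /(xgetPex (cst 0)) hw : exists g, [set g | is_weak_partial Om j u g] g.
  by have [g hg] := h j; exists g.
have /is_weak_partialP[h1 h2] := hw.
by split; [exact: h1|exact: h2].
Qed.

Lemma H1_intro u (G : 'I_3 -> 'I_3 -> T -> R) :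
  (forall k, sqO (cmp u k)) -> (forall k, isgrad (cmp u k) (G k)) -> H1 Om u.
Proof.
move=> su gu; split; first exact/L2P.
move=> j; exists (fun x => \row_k G k j x).
have E k : cmp (fun x => \row_k G k j x) k = G k j.
  by apply/funext => x; rewrite /cmp mxE.
apply/is_weak_partialP; split=> k; rewrite E; first exact: (gu k j).1.
exact: (gu k j).2.
Qed.

(** The difference of two weak gradients is orthogonal to all test functions. *)
Lemma isgrad_ae (f : T -> R) (G H : 'I_3 -> T -> R) j : isgrad f G -> isgrad f H ->
  G j = H j %[ae vol in Om].
Proof.
move=> gG gH; have [sG wG] := gG j; have [sH wH] := gH j.
have : (fun x => G j x - H j x) = (fun=> 0) %[ae vol in Om].
  apply: test_eq0 => //; first exact: sqB.
  move=> phi tp; have [sp _] := test_sq oO O_fin j tp.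
  rewrite ipBl//; apply/eqP; rewrite subr_eq0 -eqr_opp; apply/eqP.
  by rewrite -(wG phi tp) -(wH phi tp).
by apply: filterS => x h Ox; have /eqP := h Ox; rewrite subr_eq0 => /eqP.
Qed.

Lemma isgrad_cong (f g : T -> R) (G : 'I_3 -> T -> R) : sqO f -> sqO g ->
  f = g %[ae vol in Om] -> isgrad f G -> isgrad g G.
Proof.
move=> sf sg fg gf j; have [sG wG] := gf j; split=> // phi tp.
have [_ sD] := test_sq oO O_fin j tp.
by rewrite -(wG phi tp); apply: eq_ae_ip => //; [move: fg; apply: filterS => x h Ox; rewrite h|exact: aeW].
Qed.

Lemma ip_grad (f g : T -> R) (F F' G G' : 'I_3 -> T -> R) j :
  isgrad f F -> isgrad f F' -> isgrad g G -> isgrad g G' ->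
  ipO (F j) (G j) = ipO (F' j) (G' j).
Proof.
move=> h1 h2 h3 h4; apply: eq_ae_ip => //.
- exact: (h1 j).1.
- exact: (h2 j).1.
- exact: (h3 j).1.
- exact: (h4 j).1.
- exact: isgrad_ae h1 h2.
- exact: isgrad_ae h3 h4.
Qed.

Definition dir u : R := qform Om (gr u).

Lemma dir_ge0 u : 0 <= dir u. Proof. exact: qform_ge0. Qed.

Lemma dir_grad u (G : 'I_3 -> 'I_3 -> T -> R) : H1 Om u ->
  (forall k, isgrad (cmp u k) (G k)) -> dir u = qform Om G.
Proof.
move=> hu gu; apply: eq_bigr => k _; apply: eq_bigr => j _.
apply: (ip_grad j (f := cmp u k) (g := cmp u k)) => //; exact: H1_grad.
Qed.

Lemma enorm_sqr (v : 'rV[R]_3) : enorm v ^+ 2 = \sum_(k < 3) v ord0 k ^+ 2.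
Proof. by rewrite /enorm sqr_sqrtr// sumr_ge0// => k _; exact: sqr_ge0. Qed.

Lemma grad_sqrE u x : grad_sqr Om u x = \sum_(k < 3) \sum_(j < 3) gr u k j x * gr u k j x.
Proof.
rewrite /grad_sqr exchange_big/=; apply: eq_bigr => j _.
by rewrite enorm_sqr; apply: eq_bigr => k _; rewrite expr2.
Qed.

Lemma Rint_EFin (f : T -> R) : vol.-integrable Om (EFin \o f) ->
  (\int[vol]_(x in Om) (f x)%:E = (\int[vol]_(x in Om) f x)%:E)%E.
Proof.
by move=> h; rewrite /Rintegral fineK//; apply: (@integrable_fin_num _ T3 R vol).
Qed.

Lemma grad_sqr_int u : H1 Om u ->
  vol.-integrable Om (EFin \o grad_sqr Om u) /\ \int[vol]_(x in Om) grad_sqr Om u x = dir u.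
Proof.
move=> hu.
have i1 k j : vol.-integrable Om (EFin \o (fun x => gr u k j x * gr u k j x)).
  by apply: sqM => //; exact: (H1_grad k hu j).1.
have s1 k := Rintegral_sum mO (s := index_enum 'I_3) (F := fun j x => gr u k j x * gr u k j x) (fun j _ => i1 k j).
have s2 := Rintegral_sum mO (s := index_enum 'I_3) (F := fun k x => \sum_(j < 3) gr u k j x * gr u k j x) (fun k _ => (s1 k).1).
have -> : grad_sqr Om u = (fun x => \sum_(k < 3) \sum_(j < 3) gr u k j x * gr u k j x).
  by apply/funext => x; exact: grad_sqrE.
split; first exact: s2.1.
by rewrite s2.2; apply: eq_bigr => k _; rewrite (s1 k).2.
Qed.

Lemma dirichletE u : H1 Om u -> dirichlet Om u = (dir u)%:E.
Proof.
by move=> /grad_sqr_int[i e]; rewrite /dirichlet Rint_EFin// e.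
Qed.

End Bridge.


(** * Bounded domains and maps smooth up to the boundary *)

Section BoundedDomain.
Context {R : realType}.
Local Notation vol := (@vol R).
Local Notation T := (R * R * R)%type.
Local Notation T3 := (measurableTypeR R * measurableTypeR R * measurableTypeR R)%type.
Variable Om : set T.
Hypotheses (oO : open Om) (bO : bounded_set Om).

Lemma crd_le_norm j (x : T) : `|crd j x| <= `|x|.
Proof.
have h1 (a : R * R) : `|a.1| <= `|a| by rewrite prod_normE le_max lexx.
have h2 (a : R * R) : `|a.2| <= `|a| by rewrite prod_normE le_max lexx orbT.
have h3 : `|x.1| <= `|x| by rewrite [leRHS]prod_normE le_max lexx.
have h4 : `|x.2| <= `|x| by rewrite [leRHS]prod_normE le_max lexx orbT.
by move: j; apply: I3P => //; [apply: le_trans (h1 _) h3|apply: le_trans (h2 _) h3].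
Qed.

Lemma bounded_cbox : exists M : R, Om `<=` cbox (fun=> - M) (fun=> M).
Proof.
have [M0 [_ hM]] := bO; exists (M0 + 1) => x Ox j.
have := hM (M0 + 1) _ x Ox; rewrite ltrDl ltr01 => /(_ isT) h.
by have := le_trans (crd_le_norm j x) h; rewrite ler_norml => /andP[].
Qed.

Lemma bounded_vol : (vol Om < +oo)%E.
Proof.
have [M hM] := bounded_cbox.
have mO := open_measurable3 oO.
apply: (@le_lt_trans _ _ (vol (box (fun=> - M - 1) (fun=> M)))); last exact: vol_box_fin.
apply: le_measure; rewrite ?inE; [exact: mO|exact: measurable_box|].
by move=> x /hM h j; have [? ?] := h j; split=> //; lra.
Qed.

Lemma compact_closure : compact (closure Om).
Proof.
have [M hM] := bounded_cbox.
apply: (subclosed_compact _ (@compact_cbox R (fun=> - M) (fun=> M))).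
  exact: closed_closure.
rewrite [X in _ `<=` X](closure_id _).1; last exact: closed_cbox.
exact: closure_subset.
Qed.

Let O_fin := bounded_vol.
Let mO : @measurable _ T3 Om. Proof. exact: open_measurable3. Qed.
Local Notation sqO := (@sq _ T3 R vol Om).
Local Notation ipO := (@ip _ T3 R vol Om).
Local Notation isgrad := (isgrad Om).
Implicit Types (u v g : T -> 'rV[R]_3).

Lemma enorm_ge0 (v : 'rV[R]_3) : 0 <= enorm v. Proof. exact: sqrtr_ge0. Qed.

Lemma enorm1P (v : 'rV[R]_3) : enorm v = 1 <-> \sum_(k < 3) v ord0 k ^+ 2 = 1.
Proof.
rewrite -enorm_sqr; split=> [->|h]; first by rewrite expr1n.
apply/eqP; rewrite -(@eqrXn2 _ 2)// ?enorm_ge0//; first by rewrite h expr1n.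
Qed.

Lemma enorm1_le (v : 'rV[R]_3) k : enorm v = 1 -> `|v ord0 k| <= 1.
Proof.
move/enorm1P => h; rewrite -(@ler_pXn2r _ 2)// ?nnegrE// expr1n real_normK ?num_real//.
by rewrite -h (bigD1 k)//= lerDl sumr_ge0// => i _; exact: sqr_ge0.
Qed.

Lemma bounded_within (h : T -> R) : {within closure Om, continuous h} ->
  exists M : R, forall x, Om x -> `|h x| <= M.
Proof.
move=> ch; have := continuous_compact ch compact_closure.
move/compact_bounded => [M [_ hM]]; exists (M + 1) => x Ox; apply: hM; first by lra.
by exists x => //; exact: subset_closure.
Qed.

(** On the compact closure the extended derivatives are bounded, hence square
    integrable on a set of finite volume, and they are the weak derivatives. *)
Lemma C1bar_smooth u : C1bar_S2 Om u -> smooth_H1S2 Om u.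
Proof.
move=> [[cu C1] _ Dext u1].
have ccoord k : continuous (fun v : 'rV[R]_3 => v ord0 k) by exact: coord_continuous.
have ck k x : Om x -> {for x, continuous (cmp u k)}.
  by move=> Ox; apply: (@continuous_comp _ _ _ u (fun v : 'rV[R]_3 => v ord0 k));
    [exact: cu|exact: ccoord].
pose Du j x := 'D_(basis3 j) u x.
have cDk j k x : Om x -> {for x, continuous (cmp (Du j) k)}.
  move=> Ox; have [_ [c _]] := C1 j.
  by apply: (@continuous_comp _ _ _ (Du j) (fun v : 'rV[R]_3 => v ord0 k));
    [exact: c|exact: ccoord].
have dk j k x : Om x -> is_derive x (basis3 j : T) (cmp u k) (cmp (Du j) k x).
  move=> Ox; have [d _] := C1 j; have du := d x Ox.
  apply: DeriveDef; first exact: ((derivable_mxP u x (basis3 j)).1 du ord0 k).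
  by rewrite /cmp /Du derive_mx// mxE.
have su k : sqO (cmp u k).
  apply: (@sq_bounded _ T3 R vol Om mO _ 1) => //.
    exact: continuous_on_measurable (ck k).
  by move=> x Ox; apply: enorm1_le; apply: u1; exact: subset_closure.
have sD j k : sqO (cmp (Du j) k).
  have [g cg ge] := Dext j.
  have cgk : {within closure Om, continuous (cmp g k)}.
    by move=> x; exact: (@continuous_comp (subspace (closure Om)) _ _ g (fun v : 'rV[R]_3 => v ord0 k) x (cg x) (ccoord k (g x))).
  have [M hM] := bounded_within cgk.
  apply: (@sq_bounded _ T3 R vol Om mO _ M) => //.
    exact: continuous_on_measurable (cDk j k).
  by move=> x Ox; rewrite /cmp /Du -ge//; exact: hM.
split; last by exists u => //; exact: aeW.
split; last by apply: aeW => x Ox; apply: u1; exact: subset_closure.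
apply: (@H1_intro R Om oO u (fun k j => cmp (Du j) k)) => // k j; split=> //.
apply: wpart_classical => //.
  exact: ck.
exact: cDk.
Qed.

Lemma cst_C1bar (c : 'rV[R]_3) : enorm c = 1 -> C1bar_S2 Om (fun=> c).
Proof.
move=> c1.
have D0 j : (fun x : T => 'D_(basis3 j) (fun=> c) x) = (fun=> 0).
  by apply/funext => x; exact: derive_cst.
split=> //.
- split=> [x _|j]; first exact: cst_continuous.
  split=> [x _|]; first exact: derivable_cst.
  by rewrite D0; split=> // x _; exact: cst_continuous.
- exact: continuous_subspaceT (@cst_continuous _ _ _).
- move=> j; exists (fun=> 0); last by move=> x _; have := congr1 (@^~ x) (D0 j) => /= ->.
  exact: continuous_subspaceT (@cst_continuous _ _ _).
Qed.

Lemma cst_H1S2 (c : 'rV[R]_3) : enorm c = 1 -> H1S2 Om (fun=> c).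
Proof. by move=> /cst_C1bar/C1bar_smooth[]. Qed.

End BoundedDomain.


(** * Vector-valued Sobolev maps *)

Section MapsAndConfigurations.
Context {R : realType}.
Local Notation vol := (@vol R).
Local Notation T := (R * R * R)%type.
Local Notation T3 := (measurableTypeR R * measurableTypeR R * measurableTypeR R)%type.
Variable Om : set T.
Hypotheses (oO : open Om) (O_fin : (vol Om < +oo)%E).
Local Notation sqO := (@sq _ T3 R vol Om).
Local Notation ipO := (@ip _ T3 R vol Om).
Local Notation isgrad := (isgrad Om).
Local Notation gr := (gr Om).
Local Notation dir := (dir Om).
Local Notation H1 := (H1 Om).
Let mO : @measurable _ T3 Om. Proof. exact: open_measurable3. Qed.
Implicit Types (u v g : T -> 'rV[R]_3).

Definition isgr u (G : 'I_3 -> 'I_3 -> T -> R) := forall k, isgrad (cmp u k) (G k).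

Lemma isgr_gr u : H1 u -> isgr u (gr u).
Proof. by move=> hu k; exact: H1_grad. Qed.

Lemma gr_sq u k j : H1 u -> sqO (gr u k j).
Proof. by move=> hu; exact: (isgr_gr hu k j).1. Qed.

Lemma cmp_lin a u v k :
  cmp (fun x => a *: u x + v x) k = (fun x => a * cmp u k x + cmp v k x).
Proof. by apply/funext => x; rewrite /cmp !mxE. Qed.

Lemma cmpB u v k : cmp (fun x => u x - v x) k = (fun x => cmp u k x - cmp v k x).
Proof. by apply/funext => x; rewrite /cmp !mxE. Qed.

Lemma isgr_lin a u v : H1 u -> H1 v ->
  isgr (fun x => a *: u x + v x) (fun k j x => a * gr u k j x + gr v k j x).
Proof.
move=> hu hv k; rewrite cmp_lin.
have su := H1_sq oO k hu; have sv := H1_sq oO k hv.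
apply: isgradD => //; [exact: sqZ|apply: isgradZ => //; exact: isgr_gr|exact: isgr_gr].
Qed.

Lemma H1_lin a u v : H1 u -> H1 v -> H1 (fun x => a *: u x + v x).
Proof.
move=> hu hv; apply: H1_intro (isgr_lin a hu hv) => // k; rewrite cmp_lin.
by apply: sqD => //; [apply: sqZ => //|]; exact: H1_sq.
Qed.

Lemma H1_sub u v : H1 u -> H1 v -> H1 (fun x => u x - v x).
Proof.
move=> hu hv; rewrite (_ : (fun x => _) = (fun x => -1 *: v x + u x)); first exact: H1_lin.
by apply/funext => x; rewrite scaleN1r addrC.
Qed.

Lemma isgrad_sum (I : Type) (s : seq I) (F : I -> T -> R) (G : I -> 'I_3 -> T -> R) :
  (forall i, sqO (F i)) -> (forall i, isgrad (F i) (G i)) ->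
  isgrad (fun x => \sum_(i <- s) F i x) (fun j x => \sum_(i <- s) G i j x).
Proof.
move=> sF gF j; have sG i : sqO (G i j) by exact: (gF i j).1.
split; first exact: sq_sum.
move=> phi tp; have [sp sD] := test_sq oO O_fin j tp.
have e := ip_suml mO s sF sD; have e' := ip_suml mO s sG sp.
apply: (etrans e); rewrite -[in RHS]/(ipO _ _) e' -sumrN; apply: eq_bigr => i _.
exact: ((gF i j).2 phi tp).
Qed.

Definition l2 u : R := \sum_k ipO (cmp u k) (cmp u k).

Lemma l2_ge0 u : 0 <= l2 u.
Proof. by apply: sumr_ge0 => k _; exact: (ip_ge0 vol Om). Qed.

Lemma l2_int u : (forall k, sqO (cmp u k)) ->
  vol.-integrable Om (EFin \o (fun x => enorm (u x) ^+ 2)) /\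
  \int[vol]_(x in Om) (enorm (u x) ^+ 2) = l2 u.
Proof.
move=> su.
have -> : (fun x => enorm (u x) ^+ 2) = (fun x => \sum_(k < 3) cmp u k x * cmp u k x).
  by apply/funext => x; rewrite enorm_sqr; apply: eq_bigr => k _; rewrite expr2.
exact: (Rintegral_sum mO (s := index_enum 'I_3) (F := fun k x => cmp u k x * cmp u k x)
  (fun k _ => sqM mO (su k) (su k))).
Qed.

Lemma H1normE u : H1 u -> H1norm Om u = Num.sqrt (l2 u + dir u).
Proof.
move=> hu; rewrite /H1norm; congr Num.sqrt.
have [i1 e1] := l2_int (fun k => H1_sq oO k hu); have [i2 e2] := grad_sqr_int oO hu.
by rewrite RintegralD// e1 e2.
Qed.

Lemma l2_eq0 u : (forall k, sqO (cmp u k)) -> l2 u = 0 -> u = cst 0 %[ae vol in Om].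
Proof.
move=> su /eqP; rewrite psumr_eq0; last by move=> k _; exact: (ip_ge0 vol Om).
move=> /allP h.
have z k : cmp u k = (fun=> 0) %[ae vol in Om].
  apply: (@ip_eq0_ae _ T3 R vol Om mO) => //; apply/eqP.
  by have := h k; rewrite mem_index_enum => /(_ isT).
have : {ae vol, forall x, forall k, k \in enum 'I_3 -> Om x -> cmp u k x = 0}.
  exact: (@filter_all _ (almost_everywhere vol) _ _ (enum 'I_3)
    (fun k x => Om x -> cmp u k x = 0) (fun k _ => z k)).
apply: filterS => x hx Ox; apply/rowP => k; rewrite mxE.
by apply: hx => //; rewrite mem_enum.
Qed.

(** The integral of $|u_n|^2$ over any measurable part [E] is the volume of [E], and
    it passes to the $L^2$ limit; so $|v|^2$ and $1$ have the same integrals. *)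
Lemma unit_norm_cvg (un : nat -> T -> 'rV[R]_3) v :
  (forall n k, sqO (cmp (un n) k)) -> (forall k, sqO (cmp v k)) ->
  (forall k, ipO (fun x => cmp (un n) k x - cmp v k x)
     (fun x => cmp (un n) k x - cmp v k x) @[n --> \oo] --> (0 : R)) ->
  (forall n, {ae vol, forall x, Om x -> enorm (un n x) = 1}) ->
  {ae vol, forall x, Om x -> enorm (v x) = 1}.
Proof.
move=> su sv cu u1.
have [iv _] := l2_int sv.
have m1 : @measurable_fun _ _ T3 R Om (fun=> 1 : R) by exact: measurable_cst.
have : ae_eq vol Om (EFin \o (fun x => enorm (v x) ^+ 2)) (EFin \o (fun=> 1 : R)).
  apply: integral_ae_eq => //; first exact/measurable_EFinP.
  move=> E EO mE.
  have sub w : sqO w -> @sq _ T3 R vol E w.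
    move=> [mw iw]; split; first exact: measurable_funS mw.
    exact: (@integrableS _ T3 R vol _ _ _ mO mE EO iw).
  have E_fin : (vol E < +oo)%E.
    by apply: le_lt_trans O_fin; apply: le_measure; rewrite ?inE.
  have ce : \sum_k @ip _ T3 R vol E (cmp (un n) k) (cmp (un n) k) @[n --> \oo] -->
      \sum_k @ip _ T3 R vol E (cmp v k) (cmp v k).
    apply: cvg_sumS => k; apply: (cvg_ip_sqr mE) => [n||]; [exact: sub|exact: sub|].
    apply: (@squeeze_cvgr _ _ _ _ (fun=> 0) (fun n => ipO (fun x => cmp (un n) k x - cmp v k x)
     (fun x => cmp (un n) k x - cmp v k x))); [|exact: cvg_cst|exact: cu].
    apply: nearW => n; rewrite (ip_ge0 vol E)/=.
    by apply: ip_mono => //; exact: sqB.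
  have cst_e n : \sum_k @ip _ T3 R vol E (cmp (un n) k) (cmp (un n) k) = fine (vol E).
    have [iE eE] := Rintegral_sum mE (s := index_enum 'I_3)
      (F := fun k x => cmp (un n) k x * cmp (un n) k x)
      (fun k _ => sqM mE (sub _ (su n k)) (sub _ (su n k))).
    rewrite -eE -[RHS]mul1r -Rintegral_cst//; congr fine.
    apply: ae_eq_integral => //; first exact: (@measurable_int _ T3 R vol).
    apply: filterS (u1 n) => x h Ex; congr EFin.
    have /enorm1P <- := h (EO _ Ex).
    by apply: eq_bigr => k _; rewrite expr2.
  have ev : \sum_k @ip _ T3 R vol E (cmp v k) (cmp v k) = fine (vol E).
    apply: (cvg_unique _ ce) => //; rewrite (_ : (fun n => _) = fun=> fine (vol E)).
      exact: cvg_cst.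
    by apply/funext => n; exact: cst_e.
  have [iE eE] := Rintegral_sum mE (s := index_enum 'I_3)
      (F := fun k x => cmp v k x * cmp v k x)
      (fun k _ => sqM mE (sub _ (sv k)) (sub _ (sv k))).
  have -> : EFin \o (fun x => enorm (v x) ^+ 2) =
      EFin \o (fun x => \sum_(k < 3) cmp v k x * cmp v k x).
    by apply/funext => x /=; rewrite enorm_sqr; congr EFin; apply: eq_bigr => k _; rewrite expr2.
  rewrite -[LHS]fineK; last exact: (@integrable_fin_num _ T3 R vol).
  rewrite -/(Rintegral _ _ _) eE ev integral_cst// mul1e fineK//.
  by rewrite ge0_fin_numE.
apply: filterS => x h Ox; have := h Ox; rewrite /= => -[] /eqP.
by rewrite -[X in _ == X](expr1n _ 2) eqrXn2 ?enorm_ge0// => /eqP.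
Qed.

End MapsAndConfigurations.


(** * Configurations *)

(** The values $2 u_n - l$ are those of the tangent at the limit of a quadratic form;
    they bound the form from below. *)
Lemma cvg_tangent (R : realType) (u : nat -> R) (l : R) :
  u n @[n --> \oo] --> l -> 2 * u n - l @[n --> \oo] --> l.
Proof.
move=> ul; have e : l = 2 * l - l by rewrite mulr_natl mulr2n addrK.
rewrite {2}e; apply: cvgB; last exact: cvg_cst.
by apply: cvgM => //; exact: cvg_cst.
Qed.

Lemma sum_square_expand (R : realType) n m (c : R) (A : 'I_m -> 'I_m -> R)
    (B C : 'I_n -> 'I_m -> 'I_m -> R) : (forall k j, \sum_i B i k j = 0) ->
  \sum_i \sum_k \sum_j (c ^+ 2 * A k j + 2 * c * B i k j + C i k j) =
  n%:R * c ^+ 2 * (\sum_k \sum_j A k j) + \sum_i \sum_k \sum_j C i k j.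
Proof.
move=> B0.
have e i : \sum_k \sum_j (c ^+ 2 * A k j + 2 * c * B i k j + C i k j) =
    c ^+ 2 * (\sum_k \sum_j A k j) + 2 * c * (\sum_k \sum_j B i k j) +
    \sum_k \sum_j C i k j.
  rewrite !mulr_sumr -!big_split/=; apply: eq_bigr => k _.
  by rewrite !mulr_sumr -!big_split/=.
have b0 : \sum_i \sum_k \sum_j B i k j = 0.
  by rewrite exchange_big/= big1// => k _; rewrite exchange_big/= big1.
rewrite (eq_bigr _ (fun i _ => e i)) !big_split/= -!mulr_sumr b0 mulr0 addr0.
by rewrite sumr_const card_ord -[_ *+ n]mulr_natl mulrCA mulrA.
Qed.

Section Configurations.
Context {R : realType}.
Local Notation vol := (@vol R).
Local Notation T := (R * R * R)%type.
Local Notation T3 := (measurableTypeR R * measurableTypeR R * measurableTypeR R)%type.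
Variable Om : set T.
Hypotheses (oO : open Om) (O_fin : (vol Om < +oo)%E).
Local Notation sqO := (@sq _ T3 R vol Om).
Local Notation ipO := (@ip _ T3 R vol Om).
Local Notation isgrad := (isgrad Om).
Local Notation gr := (gr Om).
Local Notation dir := (dir Om).
Local Notation H1 := (H1 Om).
Local Notation l2 := (l2 Om).
Let mO : @measurable _ T3 Om. Proof. exact: open_measurable3. Qed.
Variable N : nat.
Local Notation config := ('I_N -> T -> 'rV[R]_3).
Implicit Types (u v g f : T -> 'rV[R]_3) (U V : config).

Lemma calH_H1 U i : calH Om U -> H1 (U i).
Proof. by move=> h; have [] := h i. Qed.

Lemma cmp_sum U k : cmp (fun x => \sum_i U i x) k = (fun x => \sum_i cmp (U i) k x).
Proof. by apply/funext => x; rewrite /cmp summxE. Qed.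

Lemma isgr_sum U : H1N Om U ->
  isgr Om (fun x => \sum_i U i x) (fun k j x => \sum_i gr (U i) k j x).
Proof.
move=> hU k; rewrite cmp_sum; apply: isgrad_sum => // i; first exact: H1_sq.
exact: isgr_gr.
Qed.

Lemma H1_sum U : H1N Om U -> H1 (fun x => \sum_i U i x).
Proof.
move=> hU; apply: H1_intro (isgr_sum hU) => // k; rewrite cmp_sum.
by apply: sq_sum => // i; exact: H1_sq.
Qed.

Definition edir U : R := \sum_i dir (U i).
Definition pen f U : R := l2 (fun x => \sum_i U i x - f x).

Lemma edir_ge0 U : 0 <= edir U.
Proof. by apply: sumr_ge0 => i _; exact: dir_ge0. Qed.

Lemma pen_ge0 f U : 0 <= pen f U. Proof. exact: l2_ge0. Qed.

Lemma FlamE f (lam : R) U : H1N Om U -> H1 f ->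
  Flam Om f lam U = (2^-1 * edir U + lam * pen f U)%:E.
Proof.
move=> hU hf.
have hd := H1_sub oO O_fin (H1_sum hU) hf.
have [i1 e1] := l2_int oO (fun k => H1_sq oO k hd).
have [i2 e2] := Rintegral_sum mO (s := index_enum 'I_N) (F := fun i => grad_sqr Om (U i))
  (fun i _ => (grad_sqr_int oO (hU i)).1).
have iZ (a : R) (h : T -> R) : vol.-integrable Om (EFin \o h) ->
    vol.-integrable Om (EFin \o (fun x => a * h x)).
  move=> ih; exact: (@integrableZl _ T3 R vol Om mO a _ ih).
have j1 := iZ lam _ i1; have j2 := iZ 2^-1 _ i2.
rewrite /Flam Rint_EFin//; last exact: (@integrableD _ T3 R vol Om mO _ _ j2 j1).
rewrite RintegralD// !RintegralZl// e1 e2; congr (_ * _ + _)%:E.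
by apply: eq_bigr => i _; exact: (grad_sqr_int oO (hU i)).2.
Qed.

Lemma half_dirichletE U : H1N Om U -> half_dirichlet Om U = (2^-1 * edir U)%:E.
Proof.
move=> hU; rewrite /half_dirichlet EFinM; congr (_ * _)%E.
by rewrite /edir -sumEFin; apply: eq_bigr => i _; exact: dirichletE.
Qed.

Lemma H1N_norm_sqr U : H1N Om U -> H1N_norm Om U ^+ 2 = \sum_i (l2 (U i) + dir (U i)).
Proof.
move=> hU; rewrite /H1N_norm sqr_sqrtr; last by apply: sumr_ge0 => i _; exact: sqr_ge0.
apply: eq_bigr => i _; rewrite H1normE// sqr_sqrtr// addr_ge0//; first exact: l2_ge0.
exact: dir_ge0.
Qed.

(** Cauchy--Schwarz. Here [L] is to be an entry of the map or of its gradient;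
    linearity holds up to null sets only, because weak derivatives are chosen. *)
Lemma ip_functional (L : config -> T -> R) (g : T -> R) : sqO g ->
  (forall U, H1N Om U -> sqO (L U)) ->
  (forall a U V, H1N Om U -> H1N Om V ->
     L (fun i x => a *: U i x + V i x) = (fun x => a * L U x + L V x) %[ae vol in Om]) ->
  (forall U, H1N Om U -> ipO (L U) (L U) <= \sum_i (l2 (U i) + dir (U i))) ->
  bounded_functional Om (fun U => ipO (L U) g).
Proof.
move=> sg sL lin bd; split=> [a U V hU hV|].
  have hW : H1N Om (fun i x => a *: U i x + V i x).
    by move=> i; exact: H1_lin.
  have sU := sL _ hU; have sV := sL _ hV; have sZ := sqZ mO a sU.
  rewrite (eq_ae_ip mO (sL _ hW) (sqD mO sZ sV) sg sg (lin a U V hU hV)).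
    by rewrite ipDl// ipZl.
  exact: aeW.
exists (Num.sqrt (ipO g g)) => U hU.
rewrite -(@ler_pXn2r _ 2)// ?nnegrE ?mulr_ge0 ?sqrtr_ge0//.
rewrite real_normK ?num_real// exprMn H1N_norm_sqr// sqr_sqrtr; last exact: (ip_ge0 vol Om).
apply: le_trans (ip_CS mO (sL _ hU) sg) _.
by rewrite mulrC ler_wpM2l ?bd//; exact: (ip_ge0 vol Om).
Qed.

Lemma weak_cvg_cmp (Un : nat -> config) U i k (g : T -> R) : sqO g -> weak_cvg Om Un U ->
  ipO (cmp (Un n i) k) g @[n --> \oo] --> ipO (cmp (U i) k) g.
Proof.
move=> sg wc; apply: (wc (fun V => ipO (cmp (V i) k) g)).
apply: (@ip_functional (fun V => cmp (V i) k)) => //.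
- by move=> V hV; exact: H1_sq.
- by move=> a V W hV hW; rewrite cmp_lin; exact: aeW.
- move=> V hV; rewrite (bigD1 i)//= {1}/l2 (bigD1 k)//= -!addrA lerDl.
  rewrite !addr_ge0//; [|exact: dir_ge0|].
    by apply: sumr_ge0 => l _; exact: (ip_ge0 vol Om).
  by apply: sumr_ge0 => l _; rewrite addr_ge0//; [exact: l2_ge0|exact: dir_ge0].
Qed.

Lemma weak_cvg_gr (Un : nat -> config) U i k j (g : T -> R) : sqO g -> weak_cvg Om Un U ->
  ipO (gr (Un n i) k j) g @[n --> \oo] --> ipO (gr (U i) k j) g.
Proof.
move=> sg wc; apply: (wc (fun V => ipO (gr (V i) k j) g)).
apply: (@ip_functional (fun V => gr (V i) k j)) => //.
- by move=> V hV; exact: gr_sq.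
- move=> a V W hV hW; have hl := H1_lin oO O_fin a (hV i) (hW i).
  exact: (isgrad_ae oO O_fin j (H1_grad oO k hl) (isgr_lin oO O_fin a (hV i) (hW i) k)).
- move=> V hV; rewrite (bigD1 i)//=.
  have := qform_ge Om (gr (V i)) k j; rewrite -/(dir _).
  have : 0 <= \sum_(i0 < N | i0 != i) (l2 (V i0) + dir (V i0)).
    by apply: sumr_ge0 => l _; rewrite addr_ge0//; [exact: l2_ge0|exact: dir_ge0].
  have := l2_ge0 Om (V i); lra.
Qed.

Lemma pen_eq0 f U : H1N Om U -> H1 f -> pen f U = 0 ->
  (fun x => \sum_i U i x) = f %[ae vol in Om].
Proof.
move=> hU hf /l2_eq0 h; have := h oO (fun k => H1_sq oO k (H1_sub oO O_fin (H1_sum hU) hf)).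
by apply: filterS => x hx Ox; have /eqP := hx Ox; rewrite subr_eq0 => /eqP.
Qed.

(** Weak lower semicontinuity of the penalization: the lower bounds are the tangents
    of the quadratic form at the limit, which are weakly continuous. *)
Lemma pen_lsc (Un : nat -> config) U f : (forall n, H1N Om (Un n)) -> H1N Om U -> H1 f ->
  (forall i k (g : T -> R), sqO g -> ipO (cmp (Un n i) k) g @[n --> \oo] --> ipO (cmp (U i) k) g) ->
  exists2 c : nat -> R, c n @[n --> \oo] --> pen f U & forall n, c n <= pen f (Un n).
Proof.
move=> hUn hU hf wc.
pose h V k := cmp (fun x => \sum_i V i x - f x) k.
have hE V k : h V k = (fun x => \sum_i cmp (V i) k x - cmp f k x).
  by rewrite /h cmpB cmp_sum.
have sh V k : H1N Om V -> sqO (h V k).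
  by move=> hV; apply: H1_sq => //; apply: H1_sub => //; exact: H1_sum.
exists (fun n => \sum_k (2 * ipO (h (Un n) k) (h U k) - ipO (h U k) (h U k))).
  apply: cvg_sumS => k.
  have sg := sh _ k hU; pose g := h U k.
  suff hg : ipO (h (Un n) k) g @[n --> \oo] --> ipO (h U k) g.
    exact: cvg_tangent.
  have eV V : H1N Om V -> ipO (h V k) g = \sum_i ipO (cmp (V i) k) g - ipO (cmp f k) g.
    move=> hV; have sV i : sqO (cmp (V i) k) by exact: H1_sq.
    have sf : sqO (cmp f k) by exact: H1_sq.
    by rewrite hE ipBl ?ip_suml//; exact: sq_sum.
  rewrite eV// (_ : (fun n => _) = (fun n => \sum_i ipO (cmp (Un n i) k) g - ipO (cmp f k) g)).
    by apply: cvgB; [apply: cvg_sumS => i; exact: wc|exact: cvg_cst].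
  by apply/funext => n; exact: eV.
move=> n; apply: ler_sum => k _; rewrite -/(h (Un n) k).
have := ip_ge0 vol Om (fun x => h (Un n) k x - h U k x).
rewrite ip_sqrB//; [lra|exact: sh|exact: sh].
Qed.

Definition cvgL2 (Un : nat -> config) U := forall i k,
  ipO (fun x => cmp (Un n i) k x - cmp (U i) k x)
      (fun x => cmp (Un n i) k x - cmp (U i) k x) @[n --> \oo] --> (0 : R).

Lemma edirE U (G : 'I_N -> 'I_3 -> 'I_3 -> T -> R) : H1N Om U ->
  (forall i, isgr Om (U i) (G i)) -> edir U = qform Om (fun p : 'I_N * 'I_3 => G p.1 p.2).
Proof.
move=> hU hG; rewrite /qform -(pair_bigA _ (fun i k => \sum_(j < 3) ipO (G i k j) (G i k j)))/=.
by apply: eq_bigr => i _; exact: (dir_grad oO O_fin (hU i) (hG i)).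
Qed.

Lemma edir_lsc (Un : nat -> config) V (M : R) : (forall n, H1N Om (Un n)) ->
  (forall i k, sqO (cmp (V i) k)) -> cvgL2 Un V -> (forall n, edir (Un n) <= M) ->
  H1N Om V /\ edir V <= M.
Proof.
move=> hU sV cU eM.
have qM n : qform Om (fun p : 'I_N * 'I_3 => gr (Un n p.1) p.2) <= M.
  by rewrite -(edirE (G := fun i => gr (Un n i)) (hU n))// => i; exact: (isgr_gr oO (hU n i)).
have [H hH qH] := @energy_lsc R Om oO O_fin ('I_N * 'I_3)%type
  (fun n p => cmp (Un n p.1) p.2) (fun n p => gr (Un n p.1) p.2) (fun p => cmp (V p.1) p.2) M
  (fun n p => H1_sq oO p.2 (hU n p.1)) (fun n p => H1_grad oO p.2 (hU n p.1))
  (fun p => sV p.1 p.2) (fun p => cU p.1 p.2) qM.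
have hV : H1N Om V.
  by move=> i; apply: (H1_intro oO (sV i) (G := fun k => H (i, k))) => k; exact: (hH (i, k)).
split=> //; rewrite (edirE (G := fun i k => H (i, k)) hV); last by move=> i k; exact: (hH (i, k)).
by rewrite (_ : (fun p => _) = H)//; apply/funext => -[].
Qed.

(** The components of unit vectors are at most $1$ in absolute value, which is what
    Rellich compactness asks for; the constraint survives by $L^2$ convergence. *)
Lemma calH_compact (Un : nat -> config) (M : R) : (forall n, calH Om (Un n)) ->
  (forall n, edir (Un n) <= M) ->
  exists (phi : nat -> nat) V, [/\ forall n, (n <= phi n)%N, calH Om V &
    cvgL2 (fun n => Un (phi n)) V].
Proof.
move=> hU eM.
have h1 n i : H1 (Un n i) by exact: calH_H1.
have [||||phi [v [hphi sv cv]]] := @rellich R Om oO O_fin ('I_N * 'I_3)%type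
  (fun n p => cmp (Un n p.1) p.2) (fun n p => gr (Un n p.1) p.2) M.
- by move=> n p; exact: H1_sq.
- by move=> n p; exact: H1_grad.
- move=> n [i k]; apply: le_trans (eM n).
  apply: (@le_trans _ _ (dir (Un n i))).
    rewrite [leRHS](bigD1 k)//= lerDl; apply: sumr_ge0 => l _; apply: sumr_ge0 => m _.
    exact: (ip_ge0 vol Om).
  by rewrite [leRHS](bigD1 i)//= lerDl; apply: sumr_ge0 => l _; exact: dir_ge0.
- move=> n [i k]; have [_] := hU n i; apply: filterS => x hx Ox.
  exact: enorm1_le (hx Ox).
pose V (i : 'I_N) x := \row_k v (i, k) x : 'rV[R]_3.
have VE i k : cmp (V i) k = v (i, k) by apply/funext => x; rewrite /cmp mxE.
have cV : cvgL2 (fun n => Un (phi n)) V by move=> i k; rewrite VE; exact: (cv (i, k)).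
have sV i k : sqO (cmp (V i) k) by rewrite VE; exact: sv.
have [hV _] := @edir_lsc (fun n => Un (phi n)) V M (fun n => h1 (phi n)) sV cV (fun n => eM _).
exists phi, V; split=> // i; split; first exact: hV.
apply: (unit_norm_cvg oO O_fin (un := fun n => Un (phi n) i)) => //.
- by move=> n k; exact: H1_sq.
- by move=> n; exact: (hU (phi n) i).2.
Qed.

Lemma cvgL2_ip (Un : nat -> config) U : (forall n, H1N Om (Un n)) -> H1N Om U -> cvgL2 Un U ->
  forall i k (g : T -> R), sqO g -> ipO (cmp (Un n i) k) g @[n --> \oo] --> ipO (cmp (U i) k) g.
Proof.
move=> hUn hU cU i k g sg; apply: (cvg_ipr mO) => // [n|].
  exact: (H1_sq oO k (hUn n i)).
exact: (H1_sq oO k (hU i)).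
Qed.

(** The cross terms of the expansion add up to the inner product of the gradient of
    [f] with the gradient of a sum that vanishes. *)
Lemma split_energy f (w : config) : (0 < N)%N -> H1 f -> H1N Om w ->
  (fun x => \sum_i w i x) = cst 0 %[ae vol in Om] ->
  edir (fun i x => N%:R^-1 *: f x + w i x) = N%:R^-1 * dir f + edir w.
Proof.
move=> N0 hf hw w0; have N0' : (N%:R : R) != 0 by rewrite pnatr_eq0 -lt0n.
have z k j : (fun x => \sum_i gr (w i) k j x) = (fun=> 0) %[ae vol in Om].
  have s0 : sqO (fun=> 0) by exact: sq0.
  have hg := isgr_sum hw k; have sk := H1_sq oO k (H1_sum hw).
  have w0k : cmp (fun x => \sum_i w i x) k = (fun=> 0) %[ae vol in Om].
    by apply: filterS w0 => x h Ox; rewrite /cmp h// mxE.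
  have g0 := isgrad_cong oO O_fin sk s0 w0k hg.
  apply: (isgrad_ae oO O_fin j g0 (H := fun=> fun=> 0)) => l; split=> // phi tp.
  have zi (h : T -> R) : ipO (fun=> 0) h = 0 by exact: ip0l.
  by move: (zi phi) (zi ('D_(basis3 l) phi)); rewrite /ip => e1 e2; apply: (etrans e2); apply: esym; apply: (etrans (congr1 -%R e1)); rewrite oppr0.
have cross k j : \sum_i ipO (gr f k j) (gr (w i) k j) = 0.
  have sw i : sqO (gr (w i) k j) by exact: gr_sq.
  have sf : sqO (gr f k j) by exact: gr_sq.
  have s0 : sqO (fun=> 0) by exact: sq0.
  under eq_bigr do rewrite ipC.
  rewrite -ip_suml// (eq_ae_ip mO (sq_sum mO _ sw) s0 sf sf (z k j)) ?ip0l//.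
  exact: aeW.
have hi i : dir (fun x => N%:R^-1 *: f x + w i x) = \sum_k \sum_(j < 3)
    (N%:R^-1 ^+ 2 * ipO (gr f k j) (gr f k j) + 2 * N%:R^-1 * ipO (gr f k j) (gr (w i) k j) +
     ipO (gr (w i) k j) (gr (w i) k j)).
  rewrite (dir_grad oO O_fin (H1_lin oO O_fin _ hf (hw i)) (isgr_lin oO O_fin _ hf (hw i))).
  apply: eq_bigr => k _; apply: eq_bigr => j _.
  have sw : sqO (gr (w i) k j) by exact: gr_sq.
  have sf : sqO (gr f k j) by exact: gr_sq.
  have sZ := sqZ mO N%:R^-1 sf.
  by rewrite (ip_sqrD mO sZ sw) (ip_sqrZ mO _ sf) (ipZl mO _ sf sw) mulrA.
have := @sum_square_expand R N 3 N%:R^-1 (fun k j => ipO (gr f k j) (gr f k j))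
  (fun i k j => ipO (gr f k j) (gr (w i) k j))
  (fun i k j => ipO (gr (w i) k j) (gr (w i) k j)) cross.
rewrite expr2 mulrA mulfV// mul1r => h; apply: etrans h.
by apply: eq_bigr => i _; exact: hi.
Qed.

End Configurations.


(** * From local to global regularity *)

Section LocalRegularity.
Context {R : realType}.
Local Notation vol := (@vol R).
Local Notation T := (R * R * R)%type.
Local Notation T3 := (measurableTypeR R * measurableTypeR R * measurableTypeR R)%type.
Implicit Types (O : set T) (u v : T -> 'rV[R]_3).

(** A nonempty open set contains a box of positive volume. *)
Lemma ae_open_meets O (P : set T) y : open O -> O y -> {ae vol, forall x, P x} ->
  exists2 x, O x & P x.
Proof.
move=> oO Oy [A [mA A0 PA]]; apply: contrapT => no.
have [e e0 he] := open_ball oO Oy.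
pose lo j := crd j y - e / 2; pose hi j := crd j y + e / 2.
have boxA : box lo hi `<=` A.
  move=> x hx; apply: PA => Px; apply: no; exists x => //; apply: he => j.
  have [h1 h2] := hx j; rewrite /lo /hi in h1 h2.
  by rewrite ltr_norml; apply/andP; split; lra.
have : (vol (box lo hi) <= 0)%E.
  by rewrite -A0; apply: le_measure; rewrite ?inE; [exact: measurable_box|exact: mA|].
have lh j : hi j - lo j = e by rewrite /lo /hi; lra.
rewrite vol_box => [|j]; last by rewrite -subr_ge0 lh ltW.
by rewrite lee_fin leNgt prodr_gt0// => j _; rewrite lh.
Qed.

Lemma ae_eq_continuous_eq O u v y : open O -> O y ->
  {for y, continuous u} -> {for y, continuous v} -> u = v %[ae vol in O] -> u y = v y.
Proof.
move=> oO Oy cu cv uv; apply: contrapT => /eqP uvy.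
have d0 : u y - v y != 0 by rewrite subr_eq0.
have nd : \forall x \near y, u x - v x != 0.
  have c : (u x - v x) @[x --> y] --> u y - v y by apply: cvgB; [exact: cu|exact: cv].
  exact: (cvgr_neq0 _ c d0).
have nO : \forall x \near y, O x by apply: open_nbhs_nbhs.
have [W [oW Wy] hW] : exists2 W, open_nbhs y W & W `<=` O `&` [set x | u x - v x != 0].
  have : nbhs y (O `&` [set x | u x - v x != 0]) by apply: filterI.
  by rewrite nbhsE.
have [x Wx hx] := ae_open_meets oW Wy uv.
by have [Ox /=] := hW _ Wx; rewrite hx// subrr eqxx.
Qed.

Lemma Ck1_congr O u v : open O -> (forall x, O x -> u x = v x) -> Ck 1 O u -> Ck 1 O v.
Proof.
move=> oO uv [cu du].
have nO x (Ox : O x) : nbhs x O := open_nbhs_nbhs (conj oO Ox).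
have nuv x : O x -> \forall y \near x, u y = v y.
  by move=> Ox; apply: filterS uv _; exact: nO.
have D j x : O x -> 'D_(basis3 j) u x = 'D_(basis3 j) v x.
  by move=> Ox; apply: near_eq_derive; exact: nuv.
have cong (W : normedModType R) (p q : T -> W) x : O x -> (forall y, O y -> p y = q y) ->
    {for x, continuous p} -> {for x, continuous q}.
  move=> Ox pq cp; have : q y @[y --> x] --> p x; last by rewrite (pq x Ox).
  apply: cvg_trans cp.
  by apply: near_eq_cvg; apply: filterS (nO x Ox) => y /pq.
split=> [x Ox|j]; first exact: cong uv (cu x Ox).
have [dj [cj _]] := du j; split=> [x Ox|].
  apply: near_eq_derivable (dj x Ox); exact: nuv.
split; last by [].
move=> x Ox.
exact: (cong _ (fun x => 'D_(basis3 j) u x) (fun x => 'D_(basis3 j) v x) x Ox (D j) (cj x Ox)).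
Qed.

Lemma Ck1_local O u : (forall x, O x -> exists2 B, open_nbhs x B & Ck 1 B u) -> Ck 1 O u.
Proof.
move=> h; split=> [x Ox|j].
  by have [B [oB Bx] [cu _]] := h x Ox; exact: cu.
split=> [x Ox|]; first by have [B [oB Bx] [_ /(_ j)[du _]]] := h x Ox; exact: du.
split; last by [].
by move=> x Ox; have [B [oB Bx] [_ /(_ j)[_ [c _]]]] := h x Ox; exact: c.
Qed.

(** If no point were singular, local $C^1$ representatives would coincide where they
    overlap, because two continuous maps that agree almost everywhere on an open set
    agree; glued together, they would be a global representative. *)
Lemma singularity_of_not_regular O u : open O -> ~ has_C1_repr O u -> admits_singularity O u.
Proof.
move=> oO nreg; apply: contrapT => nsing; apply: nreg.
have loc x : exists p : set T * (T -> 'rV[R]_3), O x ->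
    [/\ open p.1, p.1 x, p.1 `<=` O, Ck 1 p.1 p.2 & u = p.2 %[ae vol in p.1]].
  have [Ox|nO] := pselect (O x); last by exists (set0, u) => /nO.
  apply: contrapT => no; apply: nsing; exists x => // B oB Bx BO [v cv uv].
  by apply: no; exists (B, v) => _; split; [exact: oB|exact: Bx|exact: BO|exact: cv|exact: uv].
have [p hp] := choice loc.
pose v y := (p y).2 y.
have vE x y : O x -> (p x).1 y -> (p x).2 y = v y.
  move=> Ox Bxy; have [oB Bx BO [cx _] ux] := hp x Ox.
  have Oy := BO _ Bxy; have [oB' By _ [cy _] uy] := hp y Oy.
  have uxy : (p x).2 = (p y).2 %[ae vol in (p x).1 `&` (p y).1].
    by move: ux uy; apply: filterS2 => z h1 h2 [z1 z2]; rewrite -(h1 z1) -(h2 z2).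
  exact: (ae_eq_continuous_eq (openI oB oB') (conj Bxy By) (cx y Bxy) (cy y By) uxy).
exists v.
  apply: Ck1_local => x Ox; have [oB Bx BO cx ux] := hp x Ox.
  exists (p x).1; first exact: (conj oB Bx).
  by apply: (Ck1_congr oB _ cx) => y; exact: vE.
have [lo [hi hb]] := @rational_boxes R.
have : forall n, {ae vol, forall x, forall y, O y -> cbox (lo n) (hi n) `<=` (p y).1 ->
    box (lo n) (hi n) x -> u x = v x}.
  move=> n; have [[y [Oy cB]]|no] := pselect (exists y, O y /\ cbox (lo n) (hi n) `<=` (p y).1).
    have [_ _ _ _ uy] := hp y Oy; move: uy; apply: filterS => x h _ _ _ /box_cbox/cB Bx.
    by rewrite (h Bx); exact: vE.
  by apply: aeW => x y Oy cB; case: no; exists y.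
move/ae_foralln; apply: filterS => x h Ox; have [oB Bx _ _ _] := hp x Ox.
by have [n [bx cB]] := hb _ x oB Bx; exact: (h n x Ox cB bx).
Qed.

End LocalRegularity.


(** * Penalization and compactness *)

Lemma cvgn_sub (R : realType) (u : nat -> R) (l : R) (phi : nat -> nat) :
  (forall n, (n <= phi n)%N) -> u n @[n --> \oo] --> l -> u (phi n) @[n --> \oo] --> l.
Proof.
move=> hphi ul; apply: (cvg_comp phi u _ ul) => A [k _ hA]; exists k => // n kn.
by apply: hA; exact: leq_trans kn (hphi n).
Qed.

Lemma limn_einf_ge (R : realType) (u : nat -> \bar R) (e : \bar R) :
  (\forall n \near \oo, (e <= u n)%E) -> (e <= limn_einf u)%E.
Proof.
move=> [k _ eu]; rewrite limn_einf_lim; apply: lime_ge; first exact: is_cvg_einfs.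
exists k => // n kn; apply: le_ereal_inf_tmp => _ [m nm <-].
by apply: eu; exact: leq_trans nm.
Qed.

Section Variational.
Context {R : realType}.
Local Notation vol := (@vol R).
Local Notation T := (R * R * R)%type.
Local Notation T3 := (measurableTypeR R * measurableTypeR R * measurableTypeR R)%type.
Variable Om : set T.
Hypotheses (oO : open Om) (O_fin : (vol Om < +oo)%E).
Local Notation sqO := (@sq _ T3 R vol Om).
Local Notation ipO := (@ip _ T3 R vol Om).
Local Notation gr := (gr Om).
Local Notation dir := (dir Om).
Local Notation H1 := (H1 Om).
Local Notation l2 := (l2 Om).
Let mO : @measurable _ T3 Om. Proof. exact: open_measurable3. Qed.
Variables (N : nat) (f : T -> 'rV[R]_3).
Hypothesis hf : H1 f.
Local Notation config := ('I_N -> T -> 'rV[R]_3).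
Local Notation edir := (edir Om).
Local Notation pen := (pen Om f).
Local Notation calHf := (@calHf R N Om f).
Implicit Types (U V : config).

Lemma calH_H1N U : calH Om U -> H1N Om U.
Proof. by move=> hU i; exact: calH_H1. Qed.

Lemma calHf_pen U : calHf U -> pen U = 0.
Proof.
move=> [hU e]; apply: big1 => k _.
have s1 := H1_sq oO k (H1_sub oO O_fin (H1_sum oO O_fin (calH_H1N hU)) hf).
have s0 : sqO (fun=> 0) by exact: sq0.
have z : cmp (fun x => \sum_i U i x - f x) k = (fun=> 0) %[ae vol in Om].
  by apply: filterS e => x h Ox; rewrite /cmp h// subrr mxE.
by rewrite (eq_ae_ip mO s1 s0 s1 s0 z z) ip0l.
Qed.

Lemma calHf_Flam (lam : R) U : calHf U -> Flam Om f lam U = half_dirichlet Om U.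
Proof.
move=> hU; have h1 := calH_H1N hU.1.
by rewrite FlamE// half_dirichletE// calHf_pen// mulr0 addr0.
Qed.

(** Passing to a subsequence, a bound at arbitrarily large indices is enough. Its
    contrapositive bounds the energies from below for all large indices. *)
Lemma edir_lsc_freq (Un : nat -> config) V (M : R) : (forall n, H1N Om (Un n)) ->
  H1N Om V -> cvgL2 Om Un V ->
  (forall n, exists2 m, (n <= m)%N & edir (Un m) <= M) -> edir V <= M.
Proof.
move=> hU hV cU h.
have [psi hpsi] := choice (fun n => let: ex_intro2 m nm em := h n in
  ex_intro (fun m => (n <= m)%N /\ edir (Un m) <= M) m (conj nm em)).
have [] // := @edir_lsc R Om oO O_fin N (fun n => Un (psi n)) V M.
- by move=> i k; exact: (H1_sq oO k (hV i)).
- by move=> i k; apply: (cvgn_sub (fun n => (hpsi n).1) (cU i k)).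
- by move=> n; exact: (hpsi n).2.
Qed.

(** Since $\lambda_n$ tends to infinity, a bound on the penalized energies forces the
    penalization itself to tend to zero. *)
Lemma penalized_compact (Un : nat -> config) (lam : nat -> R) (M : R) :
  (forall n, calH Om (Un n)) -> (forall n, n.+1%:R <= lam n) ->
  (forall n, 2^-1 * edir (Un n) + lam n * pen (Un n) <= M) ->
  exists (phi : nat -> nat) V, [/\ forall n, (n <= phi n)%N, calHf V &
    cvgL2 Om (fun n => Un (phi n)) V].
Proof.
move=> hU lamn eM.
have lam0 n : 0 < lam n by apply: lt_le_trans (lamn n); rewrite ltr0n.
have p0 n : 0 <= pen (Un n) by exact: pen_ge0.
have d0 n : 0 <= edir (Un n) by exact: edir_ge0.
have lp0 n : 0 <= lam n * pen (Un n) by rewrite mulr_ge0// ltW.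
have dM n : edir (Un n) <= 2 * M by have := eM n; have := lp0 n; lra.
have M0 : 0 <= M by have := eM 0%N; have := lp0 0%N; have := d0 0%N; lra.
have [phi [V [hphi hV cV]]] := calH_compact oO O_fin hU dM.
exists phi, V; split=> //.
have hV1 := calH_H1N hV; have hU1 n := calH_H1N (hU (phi n)).
split=> //; apply: pen_eq0 => //; apply/eqP; rewrite eq_le pen_ge0 andbT.
have [c cl cp] := pen_lsc oO O_fin hU1 hV1 hf (cvgL2_ip oO hU1 hV1 cV).
have hc : c n - M * n.+1%:R^-1 @[n --> \oo] --> pen V - M * 0.
  apply: cvgB => //; apply: cvgM; first exact: cvg_cst.
  exact: cvg_invS.
have := cvgn_le hc (M := 0); rewrite mulr0 subr0; apply=> n; rewrite subr_le0.
apply: le_trans (cp n) _; rewrite ler_pdivlMr ?ltr0n// mulrC.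
apply: (@le_trans _ _ (lam (phi n) * pen (Un (phi n)))).
  apply: ler_wpM2r => //; apply: le_trans (lamn (phi n)).
  by rewrite ler_nat ltnS.
by have := eM (phi n); have := d0 (phi n); lra.
Qed.

Lemma edir_para U V : H1N Om U -> H1N Om V ->
  [/\ H1N Om (fun i x => 2^-1 *: U i x + 2^-1 *: V i x),
      H1N Om (fun i x => U i x - V i x) &
      edir (fun i x => U i x - V i x) = 2 * edir U + 2 * edir V -
        4 * edir (fun i x => 2^-1 *: U i x + 2^-1 *: V i x)].
Proof.
move=> hU hV.
have sU i k : sqO (cmp (U i) k) by exact: (H1_sq oO k (hU i)).
have sV i k : sqO (cmp (V i) k) by exact: (H1_sq oO k (hV i)).
have gU i := isgr_gr oO (hU i); have gV i := isgr_gr oO (hV i).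
have gB i : isgr Om (fun x => U i x - V i x) (fun k j x => gr (U i) k j x - gr (V i) k j x).
  by move=> k; rewrite cmpB; apply: isgradB => //; [exact: gU|exact: gV].
have gM i : isgr Om (fun x => 2^-1 *: U i x + 2^-1 *: V i x)
    (fun k j x => 2^-1 * gr (U i) k j x + 2^-1 * gr (V i) k j x).
  move=> k; rewrite (_ : cmp _ k = (fun x => 2^-1 * cmp (U i) k x + 2^-1 * cmp (V i) k x)).
    have s1 := sqZ mO 2^-1 (sU i k); have s2 := sqZ mO 2^-1 (sV i k).
    apply: isgradD => //; apply: isgradZ => //; [exact: gU|exact: gV].
  by apply/funext => x; rewrite /cmp !mxE.
have hB : H1N Om (fun i x => U i x - V i x) by move=> i; exact: H1_sub.
have hM : H1N Om (fun i x => 2^-1 *: U i x + 2^-1 *: V i x).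
  move=> i; apply: (H1_intro oO _ (gM i)) => k.
  rewrite (_ : cmp _ k = (fun x => 2^-1 * cmp (U i) k x + 2^-1 * cmp (V i) k x)).
    by apply: (sqD mO); exact: sqZ.
  by apply/funext => x; rewrite /cmp !mxE.
split=> //.
rewrite (edirE oO O_fin hB gB) (edirE oO O_fin hM gM) (edirE oO O_fin hU gU) (edirE oO O_fin hV gV).
apply: (@qform_para R Om oO ('I_N * 'I_3)%type (fun p => gr (U p.1) p.2) (fun p => gr (V p.1) p.2)).
  by move=> p j; exact: (gr_sq oO p.2 j (hU p.1)).
by move=> p j; exact: (gr_sq oO p.2 j (hV p.1)).
Qed.

(** Convergence of the energies upgrades $L^2$ convergence to strong $H^1$
    convergence: by lower semicontinuity at the midpoints, the parallelogram
    law leaves no room for the energy of the difference. *)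
Lemma strong_cvg (Un : nat -> config) V (E : R) : (forall n, H1N Om (Un n)) ->
  H1N Om V -> cvgL2 Om Un V -> edir V = E ->
  (forall n, edir (Un n) <= E + n.+1%:R^-1) ->
  forall i, H1norm Om (fun x => Un n i x - V i x) @[n --> \oo] --> (0 : R).
Proof.
move=> hU hV cU eV eU i.
pose mid n : config := fun i x => 2^-1 *: Un n i x + 2^-1 *: V i x.
have hmid n : H1N Om (mid n) by have [] := edir_para (hU n) hV.
have cmid : cvgL2 Om mid V.
  move=> l k.
  apply: (@squeeze_cvgr _ _ _ _ (fun=> 0) (fun n =>
    ipO (fun x => cmp (Un n l) k x - cmp (V l) k x)
        (fun x => cmp (Un n l) k x - cmp (V l) k x))); [|exact: cvg_cst|exact: cU].
  apply: nearW => n; rewrite (ip_ge0 vol Om)/=.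
  have -> : (fun x => cmp (mid n l) k x - cmp (V l) k x) =
      (fun x => 2^-1 * (cmp (Un n l) k x - cmp (V l) k x)).
    by apply/funext => x; rewrite /cmp !mxE; field.
  have sd : sqO (fun x => cmp (Un n l) k x - cmp (V l) k x).
    by apply: (sqB mO); [exact: (H1_sq oO k (hU n l))|exact: (H1_sq oO k (hV l))].
  rewrite (ip_sqrZ mO _ sd); have := ip_ge0 vol Om (fun x => cmp (Un n l) k x - cmp (V l) k x).
  set a := ip _ _ _ _ => a0; lra.
have cd : edir (fun i x => Un n i x - V i x) @[n --> \oo] --> (0 : R).
  apply/cvgrPdist_le => e e0.
  have calc (a b c : R) : a <= E + c -> E - e / 8 < b -> c < e / 8 ->
      2 * a + 2 * E - 4 * b <= e by lra.
  have near_mid : \forall n \near \oo, E - e / 8 < edir (mid n).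
    apply: contrapT => no.
    have : edir V <= E - e / 8.
      apply: (@edir_lsc_freq mid) => // n; apply: contrapT => no2; apply: no.
      exists n => // m nm; rewrite ltNge; apply/negP => le_m; apply: no2.
      by exists m.
    rewrite eV; lra.
  have e8 : 0 < e / 8 by rewrite divr_gt0.
  have inv_le := near_infty_natSinv_lt (PosNum e8).
  apply: filterS2 near_mid inv_le => n h1 h2.
  have [_ _ ep] := edir_para (hU n) hV.
  rewrite sub0r normrN ger0_norm ?edir_ge0// ep eV -/(mid n).
  exact: (calc _ _ _ (eU n) h1 h2).
have h n : H1 (fun x => Un n i x - V i x) by exact: (H1_sub oO O_fin (hU n i) (hV i)).
have hn : (fun n => H1norm Om (fun x => Un n i x - V i x)) =
    (fun n => Num.sqrt (l2 (fun x => Un n i x - V i x) + dir (fun x => Un n i x - V i x))).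
  by apply/funext => n; exact: (H1normE oO (h n)).
rewrite hn.
rewrite -[X in _ --> X]sqrtr0.
apply: continuous_cvg; first exact: sqrt_continuous.
rewrite -[X in _ --> X](addr0 0); apply: cvgD.
  rewrite [X in _ --> X](_ : 0 = \sum_(k < 3) 0 :> R); last by rewrite big1.
  apply: cvg_sumS => k; rewrite (_ : (fun n => _) = fun n =>
    ipO (fun x => cmp (Un n i) k x - cmp (V i) k x)
        (fun x => cmp (Un n i) k x - cmp (V i) k x)); first exact: cU.
  by apply/funext => n; rewrite cmpB.
apply: (@squeeze_cvgr _ _ _ _ (fun=> 0) (fun n => edir (fun i x => Un n i x - V i x)));
  [|exact: cvg_cst|exact: cd].
apply: nearW => n; rewrite dir_ge0/= [leRHS](bigD1 i)//= lerDl.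
by apply: sumr_ge0 => l _; exact: dir_ge0.
Qed.

End Variational.


(** * The penalized and the constrained problems *)

Section UnitVectors.
Context {R : realType}.
Local Notation T := (R * R * R)%type.

Lemma unit_vectors_sum0 m : (2 <= m)%N ->
  exists c : nat -> 'rV[R]_3, (forall i, enorm (c i) = 1) /\ \sum_(i < m) c i = 0.
Proof.
pose e : 'rV[R]_3 := delta_mx 0 0.
have e1 : enorm e = 1.
  by apply/enorm1P; rewrite sum3 !mxE/= expr1n !expr0n/= !addr0.
have en (v : 'rV[R]_3) : enorm v = 1 -> enorm (- v) = 1.
  by move=> <-; congr Num.sqrt; apply: eq_bigr => k _; rewrite !mxE sqrrN.
pose vec (a b : R) : 'rV[R]_3 := \row_k (if k == j0 then a else if k == j1 then b else 0).
pose s : R := Num.sqrt 3 / 2.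
have s2 : s ^+ 2 = 3 / 4.
  by rewrite /s expr_div_n sqr_sqrtr//; field.
have vec1 b : b ^+ 2 = 3 / 4 -> enorm (vec (- 2^-1) b) = 1.
  by move=> hb; apply/enorm1P; rewrite sum3 !mxE/= hb expr0n/=; field.
(* Two opposite vectors, or three at angles $2\pi/3$, to which pairs of opposite
   vectors are added. *)
have P2 : exists c : nat -> 'rV[R]_3, (forall i, enorm (c i) = 1) /\ \sum_(i < 2) c i = 0.
  exists (fun i => if i == 0%N then e else - e); split=> [i|]; first by case: ifP => _ //; exact: en.
  by rewrite !big_ord_recr big_ord0/= add0r subrr.
have P3 : exists c : nat -> 'rV[R]_3, (forall i, enorm (c i) = 1) /\ \sum_(i < 3) c i = 0.
  exists (fun i => if i == 0%N then vec 1 0 else if i == 1%N then vec (- 2^-1) s else vec (- 2^-1) (- s)).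
  split=> [i|].
    case: ifP => _; first by apply/enorm1P; rewrite sum3 !mxE/= expr1n !expr0n/= !addr0.
    by case: ifP => _; apply: vec1; rewrite ?sqrrN.
  rewrite !big_ord_recr big_ord0/=; apply/rowP => k; rewrite !mxE.
  by case: ifP => _; [field|case: ifP => _; ring].
have step n : (exists c : nat -> 'rV[R]_3, (forall i, enorm (c i) = 1) /\ \sum_(i < n) c i = 0) ->
    exists c : nat -> 'rV[R]_3, (forall i, enorm (c i) = 1) /\ \sum_(i < n.+2) c i = 0.
  move=> [c [c1 c0]]; exists (fun i => if (i < n)%N then c i else if i == n then e else - e).
  split=> [i|]; first by case: ifP => _ //; case: ifP => _ //; exact: en.
  rewrite !big_ord_recr/= ltnn eqxx ltnNge leqnSn/= (gtn_eqF (ltnSn n)) -addrA subrr addr0 -[RHS]c0.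
  by apply: eq_bigr => i _; rewrite ltn_ord.
move=> m2; have : exists2 k, m = k.+2 & True by case: m m2 => [|[|k]]// _; exists k.
move=> [k -> _] {m m2}.
suff : (exists c : nat -> 'rV[R]_3, (forall i, enorm (c i) = 1) /\ \sum_(i < k.+2) c i = 0) /\
  (exists c : nat -> 'rV[R]_3, (forall i, enorm (c i) = 1) /\ \sum_(i < k.+3) c i = 0) by case.
by elim: k => [//|k [h1 h2]]; split=> //; exact: step.
Qed.

(** [f] is completed by constant unit vectors adding up to zero; there are at least
    two of them because $N \ge 3$. *)
Lemma calHf_nonempty (Om : set T) N (f : T -> 'rV[R]_3) : open Om -> bounded_set Om ->
  (3 <= N)%N -> H1S2 Om f -> @calHf R N Om f !=set0.
Proof.
move=> oO bO; case: N => [//|m] m2 hf.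
have [c [c1 c0]] := unit_vectors_sum0 m2.
exists (fun i => if unlift ord0 i is Some j then fun=> c j else f); split.
  by move=> i; case: unliftP => [j|] _ //; apply: cst_H1S2.
apply: aeW => x _; rewrite big_ord_recl unlift_none.
by under eq_bigr => i _ do rewrite liftK; rewrite c0 addr0.
Qed.

End UnitVectors.

Section Energies.
Context {R : realType}.
Local Notation vol := (@vol R).
Local Notation T := (R * R * R)%type.
Local Notation T3 := (measurableTypeR R * measurableTypeR R * measurableTypeR R)%type.
Variable Om : set T.
Hypotheses (oO : open Om) (bO : bounded_set Om).
Variables (N : nat) (f : T -> 'rV[R]_3).
Hypotheses (N3 : (3 <= N)%N) (hfS : H1S2 Om f).
Local Notation config := ('I_N -> T -> 'rV[R]_3).
Local Notation edir := (edir Om).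
Local Notation dir := (dir Om).
Local Notation pen := (pen Om f).
Local Notation calHf := (@calHf R N Om f).
Local Notation Elam := (Elam N Om f).
Local Notation Einf := (Einf N Om f).
Local Notation gr := (gr Om).
Local Notation ipO := (@ip _ T3 R vol Om).
Implicit Types (U V w : config).
Let O_fin : (vol Om < +oo)%E := bounded_vol oO bO.
Let hf : H1 Om f := hfS.1.

Lemma Finf_calHf U : calHf U -> Finf_ext Om f U = (2^-1 * edir U)%:E.
Proof. by move=> hU; rewrite /Finf_ext asboolT// half_dirichletE//; exact: calH_H1N hU.1. Qed.

(** Constant sequences are recovery sequences. For the lower bound, either the
    limit violates the constraint and the penalization blows up, or every quadratic
    term of the Dirichlet energy is bounded from below by its tangent at the limit,
    which is weakly continuous. *)
Lemma Gamma_cvg : Gamma_cvg_Flam (N := N) Om f.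
Proof.
move=> lam lam0 lamy; split=> [Un U hUn hU wc|U hU]; last first.
  exists (fun=> U); split=> [n||]; first exact: hU.1.
    by move=> L _; exact: cvg_cst.
  have -> : (fun n => Flam Om f (lam n) U) = fun=> (2^-1 * edir U)%:E.
    apply/funext => n; rewrite (calHf_Flam oO O_fin hf _ hU).
    exact: (half_dirichletE oO (calH_H1N hU.1)).
  by rewrite (Finf_calHf hU) (cvg_limn_einf_sup (cvg_cst _)).2.
have hUn1 n := calH_H1N (hUn n); have hU1 := calH_H1N hU.
have FE n : Flam Om f (lam n) (Un n) = (2^-1 * edir (Un n) + lam n * pen (Un n))%:E.
  exact: (FlamE oO O_fin _ (hUn1 n) hf).
have d0 n : 0 <= edir (Un n) by exact: edir_ge0.
have p0 n : 0 <= pen (Un n) by exact: pen_ge0.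
have wcc i k (g : T -> R) : @sq _ T3 R vol Om g ->
    ipO (cmp (Un n i) k) g @[n --> \oo] --> ipO (cmp (U i) k) g.
  by move=> sg; apply: weak_cvg_cmp.
have [c cU cle] := pen_lsc oO O_fin hUn1 hU1 hf wcc.
have [pU0|pU] := eqVneq (pen U) 0; last first.
  have pU1 : 0 < pen U by rewrite lt_neqAle eq_sym pU; exact: pen_ge0.
  suff -> : limn_einf (fun n => Flam Om f (lam n) (Un n)) = +oo%E by exact: leey.
  apply/eqyP => A A0; apply: limn_einf_ge.
  have h1 : \forall n \near \oo, pen U / 2 < c n.
    by move/cvgrPdist_lt : cU => /(_ (pen U / 2)); rewrite divr_gt0// => /(_ isT);
      apply: filterS => n; rewrite ltr_norml => /andP[_]; set a := pen U; lra.
  have h2 : \forall n \near \oo, A / (pen U / 2) <= lam n by move/cvgryPge : lamy.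
  apply: filterS2 h1 h2 => n h1 h2; rewrite FE lee_fin.
  apply: (@le_trans _ _ (lam n * pen (Un n))); last first.
    by rewrite lerDr mulr_ge0// invr_ge0.
  move: h2; rewrite ler_pdivrMr ?divr_gt0// => h2; apply: (le_trans h2).
  apply: ler_wpM2l; first exact: ltW.
  by apply: le_trans (cle n); exact: ltW.
have hUf : calHf U by split=> //; apply: pen_eq0.
rewrite (Finf_calHf hUf).
have sg i k j : @sq _ T3 R vol Om (gr (U i) k j) by exact: (gr_sq oO k j (hU1 i)).
pose L n := \sum_i \sum_(k < 3) \sum_(j < 3)
  (2 * ipO (gr (Un n i) k j) (gr (U i) k j) - ipO (gr (U i) k j) (gr (U i) k j)).
have Lle n : L n <= edir (Un n).
  apply: ler_sum => i _; apply: ler_sum => k _; apply: ler_sum => j _.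
  have := ip_ge0 vol Om (fun x => gr (Un n i) k j x - gr (U i) k j x).
  rewrite ip_sqrB//; [|exact: open_measurable3|exact: (gr_sq oO k j (hUn1 n i))].
  by set a := ip _ _ _ _; set b := ip _ _ _ _; set d := ip _ _ _ _; lra.
have cL : L n @[n --> \oo] --> edir U.
  apply: cvg_sumS => i; apply: cvg_sumS => k; apply: cvg_sumS => j.
  exact: cvg_tangent (weak_cvg_gr oO O_fin (i := i) (k := k) (j := j) (sg i k j) wc).
apply/lee_subgt0Pr => e e0; apply: limn_einf_ge.
move/cvgrPdist_le : cL => /(_ e e0); apply: filterS => n.
rewrite ler_norml => /andP[_ h]; rewrite FE -EFinB lee_fin.
have lp : 0 <= lam n * pen (Un n) by rewrite mulr_ge0// ltW.
have calc (a b d p : R) : 0 <= p -> d <= b -> a - d <= e -> 2^-1 * a - e <= 2^-1 * b + p by lra.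
exact: calc lp (Lle n) h.
Qed.

Lemma Einf_ge0 : (0 <= Einf)%E.
Proof.
apply: le_ereal_inf_tmp => _ [U hU <-].
rewrite half_dirichletE//; last exact: calH_H1N hU.1.
by rewrite lee_fin mulr_ge0 ?invr_ge0// edir_ge0.
Qed.

Definition E0 : R := fine Einf.

Lemma EinfE : Einf = E0%:E.
Proof.
have [U hU] := calHf_nonempty oO bO N3 hfS.
rewrite /E0 fineK// ge0_fin_numE ?Einf_ge0//.
apply: (@le_lt_trans _ _ (half_dirichlet Om U)); first by apply: ereal_inf_lbound; exists U.
by rewrite half_dirichletE ?ltry//; exact: calH_H1N hU.1.
Qed.

Lemma E0_le U : calHf U -> E0 <= 2^-1 * edir U.
Proof.
move=> hU; rewrite -lee_fin -EinfE -half_dirichletE//; last exact: calH_H1N hU.1.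
by apply: ereal_inf_lbound; exists U.
Qed.

Lemma Elam_le (lam : R) : (Elam lam <= E0%:E)%E.
Proof.
rewrite -EinfE; apply: le_ereal_inf_tmp => _ [U hU <-].
rewrite -(calHf_Flam oO O_fin hf lam hU); apply: ereal_inf_lbound.
by exists U => //; exact: hU.1.
Qed.

Lemma Elam_ge0 (lam : R) : 0 < lam -> (0 <= Elam lam)%E.
Proof.
move=> lam0; apply: le_ereal_inf_tmp => _ [U hU <-].
rewrite FlamE//; last exact: calH_H1N.
by rewrite lee_fin addr_ge0// mulr_ge0 ?invr_ge0 ?edir_ge0 ?pen_ge0// ltW.
Qed.

(** Admissible configurations have no penalization, so [Elam] stays below the
    constrained minimum; a gap that persisted for arbitrarily large $\lambda$ would
    yield, by compactness, an admissible configuration of too small energy. *)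
Lemma Elam_cvg : Elam lam @[lam --> +oo] --> Einf.
Proof.
rewrite EinfE; apply/fine_cvgP.
have fin (lam : R) : 0 < lam -> Elam lam \is a fin_num.
  move=> lam0; rewrite ge0_fin_numE ?Elam_ge0//.
  by apply: le_lt_trans (Elam_le lam) _; exact: ltry.
split.
  by exists 0; split=> // lam; exact: fin.
apply/cvgrPdist_le => e e0.
have [A [A0 hA]] : exists A : R, 0 < A /\ forall lam, A <= lam -> E0 - e <= fine (Elam lam).
  apply: contrapT => no.
  have bad n : exists lamU : R * config, [/\ n.+1%:R <= lamU.1, calH Om lamU.2 &
      2^-1 * edir lamU.2 + lamU.1 * pen lamU.2 <= E0 - e / 2].
    have : ~ forall lam : R, n.+1%:R <= lam -> E0 - e <= fine (Elam lam).
      by move=> h; apply: no; exists n.+1%:R; split=> //; rewrite ltr0n.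
    move=> /existsNP[lam] /not_implyP[nlam /negP]; rewrite -ltNge => lt_e.
    have lam0 : 0 < lam by apply: lt_le_trans nlam; rewrite ltr0n.
    have : (Elam lam < (E0 - e / 2)%:E)%E.
      by rewrite -[Elam lam]fineK ?fin// lte_fin; apply: (lt_le_trans lt_e); lra.
    move=> /ereal_inf_lt[_ [U hU <-]].
    rewrite FlamE//; last exact: calH_H1N.
    by rewrite lte_fin => /ltW h; exists (lam, U).
  have [p hp] := choice bad.
  have p1 n : n.+1%:R <= (p n).1 by have [] := hp n.
  have p2 n : calH Om (p n).2 by have [] := hp n.
  have p3 n : 2^-1 * edir (p n).2 + (p n).1 * pen (p n).2 <= E0 - e / 2 by have [] := hp n.
  have [phi [V [hphi hV cV]]] := penalized_compact oO O_fin hf p2 p1 p3.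
  have : edir V <= 2 * (E0 - e / 2).
    apply: (edir_lsc_freq oO O_fin (fun n => calH_H1N (p2 (phi n))) (calH_H1N hV.1) cV) => n.
    exists n => //; have := p3 (phi n).
    have : 0 <= (p (phi n)).1 * pen (p (phi n)).2.
      by rewrite mulr_ge0 ?pen_ge0//; apply: le_trans (p1 (phi n)); rewrite ler0n.
    by set a := edir _; set b := _ * pen _; lra.
  by have := E0_le hV; set a := edir V; lra.
exists A; split=> [|lam /ltW lamA]; first exact: num_real.
have lam0 : 0 < lam by exact: lt_le_trans lamA.
have h1 := hA lam lamA.
have h2 : fine (Elam lam) <= E0 by rewrite -lee_fin fineK ?fin// Elam_le.
by rewrite ler_norml; apply/andP; split; move: h1 h2; rewrite /=; set a := fine _; lra.
Qed.

Lemma Einf_attained : exists2 V, calHf V & E0 = 2^-1 * edir V.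
Proof.
have almost_min n : exists U : config, calHf U /\ 2^-1 * edir U <= E0 + n.+1%:R^-1.
  have : (Einf < (E0 + n.+1%:R^-1)%:E)%E by rewrite EinfE lte_fin ltrDl invr_gt0.
  move=> /ereal_inf_lt[_ [U hU <-]]; rewrite half_dirichletE//; last exact: calH_H1N hU.1.
  by rewrite lte_fin => /ltW h; exists U.
have [Un hUn] := choice almost_min.
have bd n : 2^-1 * edir (Un n) + n.+1%:R * pen (Un n) <= E0 + 1.
  rewrite (calHf_pen oO O_fin hf (hUn n).1) mulr0 addr0; apply: (le_trans (hUn n).2).
  by rewrite lerD2l invf_le1 ?ltr0n// ler1n.
have [phi [V [hphi hV cV]]] := penalized_compact oO O_fin hf (lam := fun n => n.+1%:R)
  (fun n => (hUn n).1.1) (fun n => lexx _) bd.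
exists V => //; apply/eqP; rewrite eq_le E0_le//=; apply/ler_addgt0Pr => e e0.
have : edir V <= 2 * (E0 + e).
  apply: (edir_lsc_freq oO O_fin (fun n => calH_H1N (hUn (phi n)).1.1) (calH_H1N hV.1) cV) => n.
  have [K _ hK] := near_infty_natSinv_lt (PosNum e0).
  exists (maxn n K); first exact: leq_maxl.
  have h1 := hK _ (leq_trans (leq_maxr n K) (hphi _)).
  have := (hUn (phi (maxn n K))).2; rewrite /= in h1.
  by set a := edir _; set b := _^-1 in h1 *; lra.
by set a := edir V; lra.
Qed.

Let N0 : (0 < N)%N. Proof. exact: leq_trans N3. Qed.

(** The translation by $f/N$ maps [Wf] onto the admissible configurations and changes
    the energy by a constant. *)
Lemma Einf_decomposition : exists2 w : config, Wf Om f w /\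
    (forall w' : config, Wf Om f w' -> (half_dirichlet Om w <= half_dirichlet Om w')%E) &
  Einf = (((2 * N%:R)^-1)%:E * dirichlet Om f + half_dirichlet Om w)%E.
Proof.
have N0' : (N%:R : R) != 0 by rewrite pnatr_eq0 -lt0n.
have calc (a b d : R) : 2^-1 * (d + a) <= 2^-1 * (d + b) -> 2^-1 * a <= 2^-1 * b by lra.
have [V hV EV] := Einf_attained.
pose w : config := fun i x => - N%:R^-1 *: f x + V i x.
have VE : V = fun i x => N%:R^-1 *: f x + w i x.
  by apply/funext => i; apply/funext => x; rewrite /w addrA scaleNr subrr add0r.
have hw : H1N Om w by move=> i; apply: H1_lin => //; exact: (calH_H1N hV.1 i).
have w0 : (fun x => \sum_i w i x) = cst 0 %[ae vol in Om].
  have [_] := hV; apply: filterS => x h Ox; rewrite big_split/= h// sumr_const card_ord.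
  by rewrite -scaler_nat scalerA mulrN mulfV// scaleN1r addNr.
have split_w := split_energy oO O_fin N0 hf hw w0.
rewrite -VE in split_w.
exists w.
  split.
    split=> // i; have [_] := hV.1 i; apply: filterS => x h Ox.
    by have := h Ox; rewrite {1}VE.
  move=> w' [hw' w0' w1'].
  rewrite (half_dirichletE oO hw) (half_dirichletE oO hw') lee_fin.
  have hU : calHf (fun i x => N%:R^-1 *: f x + w' i x).
    split=> [i|]; first by split; [exact: H1_lin|exact: w1'].
    apply: filterS w0' => x h Ox; rewrite big_split/= h// sumr_const card_ord addr0.
    by rewrite -scaler_nat scalerA mulfV// scale1r.
  by have := E0_le hU; rewrite (split_energy oO O_fin N0 hf hw' w0') EV split_w => /calc.
rewrite EinfE EV split_w (half_dirichletE oO hw) (dirichletE oO hf) -EFinM -EFinD.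
by rewrite mulrDr invfM mulrA.
Qed.

(** A limit of the configurations is admissible with energy at most the minimum, so
    the energies converge and the convergence is strong. *)
Lemma smooth_decomposition (Un : nat -> config) (lam : nat -> R) :
  (forall n, n.+1%:R <= lam n) -> (forall n i, smooth_H1S2 Om (Un n i)) ->
  (forall n, (Flam Om f (lam n) (Un n) <= (E0 + n.+1%:R^-1)%:E)%E) ->
  exists U : config, (forall i, H1S2 Om (U i) /\ strong_limit_of_smooth Om (U i)) /\
    f = (fun x => \sum_i U i x) %[ae vol in Om].
Proof.
move=> lamn sU FU.
have hU n : calH Om (Un n) by move=> i; exact: (sU n i).1.
have FU' n : 2^-1 * edir (Un n) + lam n * pen (Un n) <= E0 + n.+1%:R^-1.
  by have := FU n; rewrite FlamE//; exact: calH_H1N.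
have FU1 n : 2^-1 * edir (Un n) + lam n * pen (Un n) <= E0 + 1.
  by apply: (le_trans (FU' n)); rewrite lerD2l invf_le1 ?ltr0n// ler1n.
have [phi [V [hphi hV cV]]] := penalized_compact oO O_fin hf hU lamn FU1.
have dU n : edir (Un n) <= 2 * E0 + 2 * n.+1%:R^-1.
  have : 0 <= lam n * pen (Un n).
    by rewrite mulr_ge0 ?pen_ge0//; apply: le_trans (lamn n); rewrite ler0n.
  by have := FU' n; set a := edir _; set b := _ * pen _; set d := n.+1%:R^-1; lra.
exists V; split; last by have [_] := hV; apply: filterS => x h Ox; rewrite h.
move=> i; split; first exact: hV.1.
pose psi n := phi (2 * n.+1)%N.
have cpsi : cvgL2 Om (fun n => Un (psi n)) V.
  move=> l k; apply: (cvgn_sub (phi := fun n => (2 * n.+1)%N) _ (cV l k)) => n.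
  by apply: leq_trans (leqnSn n) _; rewrite leq_pmull.
exists (fun n => Un (psi n) i); split=> [n|]; first exact: sU.
have inv2 n : 2 * (psi n).+1%:R^-1 <= (n.+1%:R : R)^-1.
  have le2 : (2 * n.+1 <= (psi n).+1)%N by apply: leq_trans (hphi _) _.
  rewrite -[leRHS]mul1r ler_pdivlMr ?ltr0n// mulrAC ler_pdivrMr ?ltr0n// mul1r.
  by rewrite -natrM ler_nat.
have lowV : edir V = 2 * E0.
  have := E0_le hV; suff : edir V <= 2 * E0 by set a := edir V; lra.
  apply/ler_addgt0Pr => e e0.
  apply: (edir_lsc_freq oO O_fin (fun n => calH_H1N (hU (psi n))) (calH_H1N hV.1) cpsi) => n.
  have [K _ hK] := near_infty_natSinv_lt (PosNum e0).
  exists (maxn n K); first exact: leq_maxl.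
  have h1 := hK (maxn n K) (leq_maxr n K); have := dU (psi (maxn n K)); have := inv2 (maxn n K).
  rewrite /= in h1; set a := edir _; set b := _.+1%:R^-1 in h1 *; set d := _.+1%:R^-1; lra.
apply: (strong_cvg oO O_fin (fun n => calH_H1N (hU (psi n))) (calH_H1N hV.1) cpsi lowV) => n.
by apply: (le_trans (dU _)); rewrite lerD2l.
Qed.

(** If the conclusion failed for arbitrarily large $\lambda$, a regular minimizer, or
    an almost minimizer smooth up to the boundary, would provide smooth
    configurations with penalized energy close to the constrained minimum. *)
Lemma singular_minimizers :
  ~ (exists U : config, (forall i, H1S2 Om (U i) /\ strong_limit_of_smooth Om (U i)) /\
       f = (fun x => \sum_i U i x) %[ae vol in Om]) ->
  exists2 lam0 : R, 0 < lam0 & forall lam : R, lam0 <= lam ->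
    (forall U : config, is_minimizer Om f lam U ->
       ~ is_regular Om U /\ exists i, admits_singularity Om (U i)) /\
    (Elam lam < Ereg N Om f lam)%E.
Proof.
move=> nodec; apply: contrapT => no; apply: nodec.
have bad n : exists lamU : R * config, [/\ n.+1%:R <= lamU.1,
    forall i, smooth_H1S2 Om (lamU.2 i) &
    (Flam Om f lamU.1 lamU.2 <= (E0 + n.+1%:R^-1)%:E)%E].
  apply: contrapT => nobad; apply: no; exists n.+1%:R; first by rewrite ltr0n.
  move=> lam lamn; split.
    move=> U [hU mU].
    have nreg : ~ is_regular Om U.
      move=> rU; apply: nobad; exists (lam, U); split; first exact: lamn.
        by move=> i; split; [exact: hU|exact: rU].
      rewrite /= mU; apply: le_trans (Elam_le lam) _; by rewrite lee_fin lerDl invr_ge0 ler0n.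
    split=> //; have /existsNP[i ni] := nreg.
    by exists i; exact: singularity_of_not_regular.
  rewrite ltNge; apply/negP => le_reg; apply: nobad.
  have : (Ereg N Om f lam < (E0 + n.+1%:R^-1)%:E)%E.
    apply: (le_lt_trans le_reg); apply: le_lt_trans (Elam_le lam) _.
    by rewrite lte_fin ltrDl invr_gt0.
  move=> /ereal_inf_lt[_ [U hU <-]] /ltW h.
  exists (lam, U); split; [exact: lamn|move=> i|exact: h].
  exact: (C1bar_smooth oO bO (hU i)).
have [p hp] := choice bad.
apply: (@smooth_decomposition (fun n => (p n).2) (fun n => (p n).1)).
- by move=> n; have [] := hp n.
- by move=> n; have [] := hp n.
- by move=> n; have [] := hp n.
Qed.

End Energies.
Theorem theorem2p2 (R : realType) (Om : set (R * R * R)) (N : nat)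
    (f : R * R * R -> 'rV[R]_3) :
  domain Om -> bounded_set Om -> (3 <= N)%N -> H1S2 Om f ->
  [/\ (@calHf R N Om f !=set0),
      @Gamma_cvg_Flam R N Om f /\
        Elam N Om f lam @[lam --> +oo] --> Einf N Om f,
      exists2 w : 'I_N -> R * R * R -> 'rV[R]_3,
        Wf Om f w /\
          (forall w' : 'I_N -> R * R * R -> 'rV[R]_3, Wf Om f w' ->
             (half_dirichlet Om w <= half_dirichlet Om w')%E) &
        Einf N Om f
          = (((2 * N%:R)^-1)%:E * dirichlet Om f + half_dirichlet Om w)%E &
      ~ (exists U : 'I_N -> R * R * R -> 'rV[R]_3,
           (forall i, H1S2 Om (U i) /\ strong_limit_of_smooth Om (U i)) /\
           f = (fun x => \sum_i U i x) %[ae vol in Om]) ->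
      exists2 lam0 : R, 0 < lam0 &
        forall lam : R, lam0 <= lam ->
          (forall U : 'I_N -> R * R * R -> 'rV[R]_3, is_minimizer Om f lam U ->
             ~ is_regular Om U /\ exists i, admits_singularity Om (U i)) /\
          (Elam N Om f lam < Ereg N Om f lam)%E].
Proof.
move=> [_ oO _] bO N3 hf; split.
- exact: calHf_nonempty.
- by split; [exact: Gamma_cvg|exact: Elam_cvg].
- exact: Einf_decomposition.
- exact: singular_minimizers.
Qed.
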